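(* Let $d_1,d_0,k\in\mathbb{N}$ (with $0\in\mathbb N$). Let $X$ be a $\mathbb{Z}/2$-CW-complex with involution $\tau$. Assume that the free cells of $X$ have dimension at most $d_1$ and that the trivial (fixed) cells of $X$ have dimension at most $d_0$. Let $$k_0 := \max\left\{ d_0, \left\lceil \frac{d_1-1}{2}\right\rceil\right\},\qquad k_1 := \max\left\{ d_0+1, \left\lceil \frac{d_1}{2}\right\rceil\right\}.$$ (1) Let $E$ be a ``real'' vector bundle over $X$ of rank $k\ge k_0$. Then there is an isomorphism of ``real'' vector bundles $E\cong E_0\oplus (X\times\mathbb{C}^{k-k_0})$ for some ``real'' vector bundle $E_0$ over $X$ and the trivial ``real'' vector bundle $X\times\mathbb{C}^{k-k_0}$ of rank $k-k_0$. (2) Let $E_1$ and $E_2$ be two ``real'' vector bundles over $X$ of rank $k\ge k_1$. If $E_1$ and $E_2$ are stably isomorphic, that is, $E_1\oplus E_3\cong E_2\oplus E_3$ for some ``real'' vector bundle $E_3$ over $X$, then $E_1\cong E_2$ as ``real'' vector bundles.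
   Context: An involutive space $(X,\tau)$ is a topological space $X$ with a continuous map $\tau\colon X\to X$ satisfying $\tau^2=\mathrm{id}_X$. A $\mathbb{Z}/2$-CW-complex is an involutive space obtained from the empty set by attaching $\mathbb{Z}/2$-cells of increasing dimensions (by equivariant attaching maps). There are two types of $\mathbb{Z}/2$-cells: free cells $\mathbb{D}^j\times\mathbb{Z}/2$ of dimension $j$, on which the generator of $\mathbb{Z}/2$ acts by $(x,i)\mapsto(x,i+1)$, and fixed (also called trivial) cells $\mathbb{D}^j$ of dimension $j$ with the trivial $\mathbb{Z}/2$-action. A ``real'' vector bundle over an involutive space $(X,\tau)$ is a complex vector bundle $\pi\colon E\to X$ with a homeomorphism $\Theta\colon E\to E$ such that (i) $\pi\circ\Theta=\tau\circ\pi$; (ii) $\Theta$ is fibrewise additive and $\Theta(\lambda p)=\overline{\lambda}\,\Theta(p)$ for all $\lambda\in\mathbb{C}$, $p\in E$; (iii) $\Theta^2=\mathrm{id}_E$. It has rank $k$ if all its fibres are isomorphic to $\mathbb{C}^k$. Isomorphisms of ``real'' vector bundles are isomorphisms of complex vector bundles over $\mathrm{id}_X$ that intertwine the maps $\Theta$; direct sums carry the direct sum of the maps $\Theta$. The trivial ``real'' vector bundle of rank $m$ over $X$ is $X\times\mathbb{C}^m$ with $\Theta(x,v)=(\tau(x),\overline{v})$. *)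

(* Defs.v *)
From HB Require Import structures.
From mathcomp Require Import all_boot all_order all_algebra.
From mathcomp Require Import all_classical all_reals all_analysis.
From mathcomp Require Import complex lra.

Set Implicit Arguments.
Unset Strict Implicit.
Unset Printing Implicit Defensive.

Import Order.TTheory GRing.Theory Num.Theory.
Import numFieldNormedType.Exports.

Local Open Scope classical_set_scope.
Local Open Scope ring_scope.

(* [R[i]^o] is [R[i]] with its norm topology; [R[i]] itself carries none. *)
Notation "''Cn[' R ]_ n" := ('rV[(R[i]%C)^o]_n)
  (at level 8, n at level 2, format "''Cn[' R ]_ n").

Record involutiveSpace := InvolutiveSpace {
  inv_space :> topologicalType ;
  tau : inv_space -> inv_space ;
  tau_continuous : continuous tau ;
  tauK : involutive tau }.

Arguments tau {i} x.

Section Discs.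
Variables (R : realType) (n : nat).
Implicit Type v : 'rV[R]_n.

(* Euclidean; the library norm on ['rV[R]_n] is the sup norm *)
Definition sqnorm v : R := \sum_(i < n) v ord0 i ^+ 2.
Definition disc : set 'rV[R]_n := [set v | sqnorm v <= 1].
Definition open_disc : set 'rV[R]_n := [set v | sqnorm v < 1].
Definition sphere : set 'rV[R]_n := [set v | sqnorm v = 1].

End Discs.

(* A free cell [c] : [I] has two sheets, [inl (c, false)] and [inl (c, true)],
   swapped by the involution; a fixed cell [c] : [J] has one, [inr c]. *)
Definition sheet (I J : Type) : Type := (I * bool + J)%type.
Definition sheet_inv (I J : Type) (s : sheet I J) : sheet I J :=
  match s with inl (c, b) => inl (c, ~~ b) | inr c => inr c end.

(* Filtration form of the iterated attachment: [skel n] is the union of the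
   cells of dimension [< n], i.e. the (n-1)-skeleton, so [skel 0] is the empty
   set.  Only the values of [charmap s] on the disc matter; they include the
   attaching map, its restriction to the sphere.  The fields from [skelS] to
   [skel_open] say that [skel n.+1] is the pushout of [skel n] and the disjoint
   union of the discs along their boundary spheres: [skel_open] gives the
   quotient topology, the others the underlying set.  (A set is open for
   [subspace B] iff its trace on [B] is relatively open in [B].) *)
Record Z2CW (R : realType) (X : involutiveSpace) := {
  free_cell : nat -> Type ;
  fixed_cell : nat -> Type ;
  skel : nat -> set X ;
  charmap : forall n, sheet (free_cell n) (fixed_cell n) -> 'rV[R]_n -> X ;
  charmap_equivariant : forall n (s : sheet (free_cell n) (fixed_cell n)) v,
    disc v -> charmap (sheet_inv s) v = tau (charmap s v) ;
  skel0 : skel 0%N = set0 ;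
  skelS : forall n, skel n `<=` skel n.+1 ;
  charmap_disc : forall n (s : sheet (free_cell n) (fixed_cell n)) v,
    disc v -> skel n.+1 (charmap s v) ;
  charmap_sphere : forall n (s : sheet (free_cell n) (fixed_cell n)) v,
    sphere v -> skel n (charmap s v) ;
  charmap_open_disc : forall n (s : sheet (free_cell n) (fixed_cell n)) v,
    open_disc v -> ~ skel n (charmap s v) ;
  charmap_inj : forall n (s t : sheet (free_cell n) (fixed_cell n)) v w,
    open_disc v -> open_disc w -> charmap s v = charmap t w -> s = t /\ v = w ;
  charmap_onto : forall n x, skel n.+1 x -> ~ skel n x ->
    exists (s : sheet (free_cell n) (fixed_cell n)) v,
      open_disc v /\ charmap s v = x ;
  skel_open : forall n (A : set X),
    open (A : set (subspace (skel n.+1))) <->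
    open (A : set (subspace (skel n))) /\
    (forall s : sheet (free_cell n) (fixed_cell n),
       open (charmap s @^-1` A : set (subspace (@disc R n)))) ;
  skel_cover : \bigcup_n skel n = setT ;
  skel_colimit : forall A : set X,
    (forall n, open (A : set (subspace (skel n)))) -> open A }.

(* the disjoint union of the fibres, as a set *)
Definition total (T : Type) (K : nzRingType) (F : T -> lmodType K) :=
  {x : T & F x}.

Section Continuity.

Lemma within_comp (S T Z : topologicalType) (A : set S) (B : set T)
    (f : S -> T) (g : T -> Z) :
  {within A, continuous f} -> (forall x, A x -> B (f x)) ->
  {within B, continuous g} -> {within A, continuous (g \o f)}.
Proof.
move=> /subspace_continuousP fc AB /subspace_continuousP gc.
apply/subspace_continuousP => x Ax.
move=> P /(gc _ (AB _ Ax)) gP; have := fc x Ax _ gP.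
by apply: (@filterS _ (nbhs x) _ _ _ _) => y Hy Ay; exact: Hy Ay (AB _ Ay).
Qed.

Lemma cvg_row_mx (K : numFieldType) (T : Type) (H : set_system T) m n p
    (f : T -> 'M[K]_(m, n)) (g : T -> 'M[K]_(m, p))
    (a : 'M[K]_(m, n)) (b : 'M[K]_(m, p)) : Filter H ->
  f @ H --> a -> g @ H --> b -> (fun t => row_mx (f t) (g t)) @ H --> row_mx a b.
Proof.
move=> FH fa gb P /nbhs_ballP[e /= e0 eP].
have /fa Hf := nbhsx_ballx a e e0.
have /gb Hg := nbhsx_ballx b e e0.
apply: (@filterS2 _ H _ _ _ _ _ Hf Hg) => t [_ /= {}Hf] [_ /= {}Hg].
apply: eP; split=> // i j; rewrite !mxE.
by case: splitP => k _; [exact: Hf | exact: Hg].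
Qed.

Lemma continuous_fst (S T : topologicalType) :
  continuous (fst : S * T -> S).
Proof. by move=> p; exact: cvg_fst. Qed.

Lemma continuous_snd (S T : topologicalType) :
  continuous (snd : S * T -> T).
Proof. by move=> p; exact: cvg_snd. Qed.

End Continuity.

(* [uphalf n] is the ceiling of [n / 2]; for [d1 = 0] the predecessor is
   truncated, which is harmless as the ceiling of [- 1 / 2] is [0]. *)
Definition k0 (d1 d0 : nat) : nat := maxn d0 (uphalf d1.-1).
Definition k1 (d1 d0 : nat) : nat := maxn d0.+1 (uphalf d1).

Lemma ceil_half (n : nat) : Num.ceil (n%:R / 2 : rat) = (uphalf n)%:Z.
Proof.
have nE : n%:R = (odd n)%:R + n./2%:R * 2 :> rat.
  by rewrite -[2]/(2%:R) -natrM -natrD muln2 odd_double_half.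
apply: ceil_def; rewrite intrB uphalf_half -!pmulrn natrD nE.
by case: (odd n) => /=; lra.
Qed.

Lemma k0E d1 d0 : (k0 d1 d0)%:Z
  = Num.max d0%:Z (Num.ceil ((d1%:R - 1) / 2 : rat)).
Proof.
have -> : Num.ceil ((d1%:R - 1) / 2 : rat) = (uphalf d1.-1)%:Z.
  case: d1 => [|n]; first by apply: ceil_def; rewrite intrB -!pmulrn /=; lra.
  by rewrite -ceil_half -[n.+1]addn1 natrD addrK addn1.
by rewrite /k0 maxEle lez_nat /maxn; case: ltngtP => // ->.
Qed.

Lemma k1E d1 d0 : (k1 d1 d0)%:Z
  = Num.max (d0%:Z + 1) (Num.ceil (d1%:R / 2 : rat)).
Proof.
rewrite ceil_half /k1 [d0%:Z + 1]addrC -intS maxEle lez_nat /maxn.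
by case: ltngtP => // ->.
Qed.

Section Bundles.
Variable R : realType.
Local Notation C := (R[i]%C).

Record fibred (X : topologicalType) := Fibred {
  fibre : X -> lmodType C ;
  total_topology : Topological (total fibre) }.

Definition tot (X : topologicalType) (E : fibred X) := total (fibre E).
HB.instance Definition _ X (E : fibred X) : Topological (tot E) :=
  total_topology E.

Definition proj (X : topologicalType) (E : fibred X) (e : tot E) : X := tag e.

Definition totpt (X : topologicalType) (E : fibred X) x (u : fibre E x) :
  tot E := existT (fun x => fibre E x : Type) x u.

(* [h] and [g] are mutually inverse trivialisations over [U]; their values off
   [U] are irrelevant. *)
Definition trivial_over (X : topologicalType) (E : fibred X) (U : set X) :=
  exists n (h : forall x, {linear fibre E x -> 'Cn[R]_n})
           (g : forall x, 'Cn[R]_n -> fibre E x),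
  [/\ (forall x, U x -> cancel (h x) (g x) /\ cancel (g x) (h x)),
      {within @proj X E @^-1` U, continuous (fun e => h (tag e) (tagged e))} &
      {within U `*` setT,
         continuous (fun p : X * 'Cn[R]_n => totpt (g p.1 p.2))}].

Record vbundle (X : topologicalType) := VBundle {
  vb_fibred :> fibred X ;
  vb_proj_continuous : continuous (@proj X vb_fibred) ;
  vb_locally_trivial : forall x, exists U : set X,
    [/\ open U, U x & trivial_over vb_fibred U] }.

(* a bundle need not have a rank: [n] above may vary with [x] *)
Definition has_rank (X : topologicalType) (E : vbundle X) (k : nat) :=
  forall x, exists h : {linear fibre E x -> 'Cn[R]_k}, bijective h.

(* [Theta] covers [tau] by its typing *)
Record realBundle (X : involutiveSpace) := RealBundle {
  rb_vbundle :> vbundle X ;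
  Theta : forall x, fibre rb_vbundle x -> fibre rb_vbundle (tau x) ;
  ThetaD : forall x (u v : fibre rb_vbundle x),
    Theta (u + v) = Theta u + Theta v ;
  ThetaZ : forall x (a : C) (u : fibre rb_vbundle x),
    Theta (a *: u) = a^* *: Theta u ;
  Theta_continuous : continuous (fun e : tot rb_vbundle =>
    totpt (Theta (tagged e)) : tot rb_vbundle) ;
  ThetaK : forall x (u : fibre rb_vbundle x),
    totpt (Theta (Theta u)) = totpt u :> tot rb_vbundle }.

Definition real_iso (X : involutiveSpace) (E F : realBundle X) :=
  exists (f : forall x, {linear fibre E x -> fibre F x})
         (g : forall x, fibre F x -> fibre E x),
  [/\ (forall x, cancel (f x) (g x) /\ cancel (g x) (f x)),
      continuous (fun e : tot E => totpt (f (tag e) (tagged e)) : tot F),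
      continuous (fun e : tot F => totpt (g (tag e) (tagged e)) : tot E) &
      forall x (u : fibre E x), f (tau x) (Theta u) = Theta (f x u)].

Section Trivial.
Variables (X : involutiveSpace) (m : nat).

Let trivial_fibre (x : X) : lmodType C := 'Cn[R]_m.
Let trivial_split (e : total trivial_fibre) : X * 'Cn[R]_m :=
  (tag e, tagged e).

Definition trivial_fibred : fibred X :=
  @Fibred X trivial_fibre (Topological.class (initial_topology trivial_split)).

Let split_continuous :
  continuous (trivial_split : tot trivial_fibred -> X * 'Cn[R]_m).
Proof. exact: (@initial_continuous _ _ trivial_split). Qed.

Let to_total (T : topologicalType) (f : T -> tot trivial_fibred) :
  continuous (trivial_split \o f) -> continuous f.
Proof. exact: (@continuous_comp_initial _ _ _ trivial_split). Qed.

Lemma trivial_proj_continuous : continuous (@proj X trivial_fibred).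
Proof.
move=> e.
exact: (continuous_comp (@split_continuous e) (@continuous_fst _ _ _)).
Qed.

Lemma trivial_tagged_continuous :
  continuous (fun e : tot trivial_fibred => tagged e : 'Cn[R]_m).
Proof.
move=> e.
exact: (continuous_comp (@split_continuous e) (@continuous_snd _ _ _)).
Qed.

Lemma trivial_trivial : trivial_over trivial_fibred setT.
Proof.
exists m, (fun x => idfun : {linear trivial_fibre x -> 'Cn[R]_m}), (fun=> id).
split=> //.
  by apply: continuous_subspaceT; exact: trivial_tagged_continuous.
apply: continuous_subspaceT; apply: to_total => p.
rewrite (_ : _ \o _ = id); first exact: cvg_id.
by apply/funext => -[].
Qed.

Lemma trivial_locally_trivial x : exists U : set X,
  [/\ open U, U x & trivial_over trivial_fibred U].
Proof.
by exists setT; split=> //; [exact: openT | exact: trivial_trivial].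
Qed.

Definition trivial_vbundle : vbundle X :=
  VBundle trivial_proj_continuous trivial_locally_trivial.

Definition trivial_Theta (x : X) (v : 'Cn[R]_m) : 'Cn[R]_m :=
  map_mx (fun z : C => z^*) v.

Lemma trivial_ThetaD x : {morph @trivial_Theta x : u v / u + v}.
Proof. by move=> u v; apply/rowP => i; rewrite !mxE rmorphD. Qed.

Lemma trivial_ThetaZ x (a : C) (u : 'Cn[R]_m) :
  @trivial_Theta x (a *: u) = a^* *: @trivial_Theta x u.
Proof. by apply/rowP => i; rewrite !mxE rmorphM. Qed.

Lemma conj_mx_continuous n :
  continuous (map_mx (fun z : C => z^*) : 'Cn[R]_n -> 'Cn[R]_n).
Proof.
move=> u A /nbhs_ballP[e /= e0 eA]; apply/nbhs_ballP; exists e => //= v.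
move=> [_ uv]; apply: eA; split=> // i j.
by have := uv i j; rewrite !mxE /ball/= -rmorphB norm_conjC.
Qed.

Lemma trivial_Theta_continuous : continuous (fun e : tot trivial_vbundle =>
  totpt (trivial_Theta (tag e) (tagged e) : fibre trivial_vbundle (tau (tag e)))
  : tot trivial_vbundle).
Proof.
apply: to_total => e.
apply: (@cvg_pair _ _ _ (nbhs e) (nbhs (tau (tag e)))
  (nbhs (trivial_Theta (tag e) (tagged e)))).
  apply: (@continuous_comp _ _ _ (@proj X trivial_fibred) tau).
    exact: trivial_proj_continuous.
  exact: tau_continuous.
apply: (@continuous_comp _ _ _
  (fun e : tot trivial_fibred => tagged e : 'Cn[R]_m) (map_mx _)).
  exact: trivial_tagged_continuous.
exact: conj_mx_continuous.
Qed.

Lemma trivial_ThetaK x (u : fibre trivial_vbundle x) :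
  totpt (trivial_Theta (tau x) (trivial_Theta x u)
         : fibre trivial_vbundle (tau (tau x)))
  = totpt u :> tot trivial_vbundle.
Proof.
rewrite /totpt; have -> : trivial_Theta (tau x) (trivial_Theta x u) = u.
  by apply/rowP => i; rewrite !mxE conjCK.
by rewrite tauK.
Qed.

Definition trivial_bundle : realBundle X :=
  @RealBundle X trivial_vbundle trivial_Theta trivial_ThetaD trivial_ThetaZ
    trivial_Theta_continuous trivial_ThetaK.

End Trivial.

Section DirectSum.
Variables (X : involutiveSpace).

Section DirectSumVector.
Variables (E F : vbundle X).

Let dsum_fibre (x : X) : lmodType C := (fibre E x * fibre F x)%type.
Let dsum_split (e : total dsum_fibre) : tot E * tot F :=
  (totpt (tagged e).1, totpt (tagged e).2).

(* the topology of the fibre product over [X] *)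
Definition dsum_fibred : fibred X :=
  @Fibred X dsum_fibre (Topological.class (initial_topology dsum_split)).

Lemma dsum_fst_continuous :
  continuous (fun e : tot dsum_fibred => totpt (tagged e).1 : tot E).
Proof.
move=> e.
exact: (continuous_comp (@initial_continuous _ _ dsum_split e)
  (@continuous_fst _ _ _)).
Qed.

Lemma dsum_snd_continuous :
  continuous (fun e : tot dsum_fibred => totpt (tagged e).2 : tot F).
Proof.
move=> e.
exact: (continuous_comp (@initial_continuous _ _ dsum_split e)
  (@continuous_snd _ _ _)).
Qed.

Lemma continuous_to_dsum (T : topologicalType) (f : T -> tot dsum_fibred) :
  continuous (fun t => totpt (tagged (f t)).1 : tot E) ->
  continuous (fun t => totpt (tagged (f t)).2 : tot F) ->
  continuous f.
Proof.
move=> cE cF; apply: (@continuous_comp_initial _ _ _ dsum_split).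
move=> t; pose e := dsum_split (f t).
by apply: (@cvg_pair _ _ _ (nbhs t) (nbhs e.1) (nbhs e.2));
  [exact: cE | exact: cF].
Qed.

Lemma dsum_proj_continuous : continuous (@proj X dsum_fibred).
Proof.
move=> e; exact: (continuous_comp (@dsum_fst_continuous e)
  (@vb_proj_continuous _ E _)).
Qed.

Lemma dsum_trivial_over (U V : set X) :
  trivial_over E U -> trivial_over F V -> trivial_over dsum_fibred (U `&` V).
Proof.
move=> [n [h [g [hgK hc gc]]]] [p [h' [g' [hgK' hc' gc']]]].
pose H x (u : dsum_fibre x) : 'Cn[R]_(n + p) := row_mx (h x u.1) (h' x u.2).
have Hlin x : linear (@H x).
  by move=> a u v; rewrite /H/= !linearP/= scale_row_mx add_row_mx.
pose HL x := GRing.isLinear.Build _ _ _ _ (@H x) (Hlin x).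
pose HH x : {linear dsum_fibre x -> 'Cn[R]_(n + p)} := HB.pack (@H x) (HL x).
exists (n + p)%N, HH, (fun x w => (g x (lsubmx w), g' x (rsubmx w))).
split=> [x [Ux Vx]| |].
- have [hK gK] := hgK x Ux; have [hK' gK'] := hgK' x Vx.
  split=> [[u v]|w] /=; rewrite /H /=.
    by rewrite row_mxKl row_mxKr hK hK'.
  by rewrite gK gK' hsubmxK.
- set A := @proj X dsum_fibred @^-1` (U `&` V).
  pose f1 (e : tot E) := h (tag e) (tagged e).
  pose f2 (e : tot F) := h' (tag e) (tagged e).
  have c1 := within_comp
    (continuous_subspaceT (A := A) dsum_fst_continuous) _ hc.
  have c2 := within_comp
    (continuous_subspaceT (A := A) dsum_snd_continuous) _ hc'.
  have {}c1 := c1 (fun e He => proj1 He).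
  have {}c2 := c2 (fun e He => proj2 He).
  move=> e; apply: (@cvg_row_mx _ _ (nbhs (e : subspace A)) _ _ _ _ _
    (f1 (totpt (tagged e).1)) (f2 (totpt (tagged e).2))).
    exact: (c1 e).
  exact: (c2 e).
- apply: continuous_to_dsum => /=.
    apply: (@within_comp _ _ _ _ (U `*` setT)
      (fun q : X * 'Cn[R]_(n + p) => (q.1, lsubmx q.2)) _ _ _ gc).
      apply: continuous_subspaceT => q.
      apply: (@cvg_pair _ _ _ (nbhs q) (nbhs q.1) (nbhs (lsubmx q.2)));
        first exact: cvg_fst.
      exact: (continuous_comp (@continuous_snd _ _ q)
        (@continuous_lsubmx _ _ _ _ q.2)).
    by move=> q [[? ?] _].
  apply: (@within_comp _ _ _ _ (V `*` setT)
    (fun q : X * 'Cn[R]_(n + p) => (q.1, rsubmx q.2)) _ _ _ gc').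
    apply: continuous_subspaceT => q.
      apply: (@cvg_pair _ _ _ (nbhs q) (nbhs q.1) (nbhs (rsubmx q.2)));
        first exact: cvg_fst.
    exact: (continuous_comp (@continuous_snd _ _ q)
        (@continuous_rsubmx _ _ _ _ q.2)).
  by move=> q [[? ?] _].
Qed.

Lemma dsum_locally_trivial x : exists U : set X,
  [/\ open U, U x & trivial_over dsum_fibred U].
Proof.
have [U [oU Ux tU]] := vb_locally_trivial E x.
have [V [oV Vx tV]] := vb_locally_trivial F x.
exists (U `&` V); split=> //; first exact: openI.
exact: dsum_trivial_over.
Qed.

Definition dsum_vbundle : vbundle X :=
  VBundle dsum_proj_continuous dsum_locally_trivial.

End DirectSumVector.

Variables (E F : realBundle X).

Definition dsum_Theta (x : X) (u : fibre (dsum_vbundle E F) x) :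
  fibre (dsum_vbundle E F) (tau x) := (Theta u.1, Theta u.2).

Lemma dsum_ThetaD x : {morph @dsum_Theta x : u v / u + v}.
Proof. by move=> u v; rewrite /dsum_Theta/= !ThetaD. Qed.

Lemma dsum_ThetaZ x (a : C) (u : fibre (dsum_vbundle E F) x) :
  dsum_Theta (a *: u) = a^* *: dsum_Theta u.
Proof. by rewrite /dsum_Theta/= !ThetaZ. Qed.

Lemma dsum_Theta_continuous :
  continuous (fun e : tot (dsum_vbundle E F) =>
    totpt (dsum_Theta (tagged e)) : tot (dsum_vbundle E F)).
Proof.
apply: continuous_to_dsum => /= e.
  apply: (@continuous_comp _ _ _
    (fun e : tot (dsum_vbundle E F) => totpt (tagged e).1 : tot E)
    (fun e => totpt (Theta (tagged e)))).
    exact: dsum_fst_continuous.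
  exact: Theta_continuous.
apply: (@continuous_comp _ _ _
  (fun e : tot (dsum_vbundle E F) => totpt (tagged e).2 : tot F)
  (fun e => totpt (Theta (tagged e)))).
  exact: dsum_snd_continuous.
exact: Theta_continuous.
Qed.

Lemma dsum_ThetaK x (u : fibre (dsum_vbundle E F) x) :
  totpt (dsum_Theta (dsum_Theta u)) = totpt u :> tot (dsum_vbundle E F).
Proof.
case: u => u v; rewrite /dsum_Theta/=.
have := ThetaK u; have := ThetaK v; rewrite /totpt.
move: (Theta (Theta u)) (Theta (Theta v)).
case: _ / (esym (tauK x)) => u' v' ev eu.
by rewrite (existT_inj2 eu) (existT_inj2 ev).
Qed.

Definition dsum : realBundle X :=
  @RealBundle X (dsum_vbundle E F) dsum_Theta dsum_ThetaD dsum_ThetaZ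
    dsum_Theta_continuous dsum_ThetaK.

End DirectSum.

End Bundles.

(* Main.v *)
(** Everything reduces to extending, cell by cell, equivariant families of
    fibrewise linear maps with values in a class stable under [Theta]; on a
    fixed cell one works in charts identifying [Theta] with complex conjugation,
    so that the matrices are real.

    Injective maps of an [a]-dimensional space into a [b]-dimensional one can be
    extended over a compact space of dimension [p < dim_R F * (b - a + 1)] with
    [F] the reals or the complex numbers: the matrices with dependent rows have
    that codimension, hence a Lipschitz family of matrices avoids them after
    translation by a suitable constant.  A counting of grid points replaces
    Sard's theorem.  Left inverses always extend, as they form an affine space.

    (1) Over [X] this yields an embedding of the trivial bundle of rank [k - k0]
    into [E] together with a left inverse, whose kernel is [E0].

    (2) An isomorphism of [E1 + E3] with [V = E2 + E3] and the inclusion of [E3]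
    into [V] give two embeddings of [E3] into [V]; over [X * [0, 1]], whose cells
    have one dimension more, they are joined by embeddings [N t] with left
    inverses [P t].  The complements of their images are the kernels of the
    [P t], and if [s] and [t] are close then [1 - N s (P s)] is injective on the
    kernel of [P t].  Composing these projections along small steps from [0] to
    [1] carries a copy of [E1] to one of [E2]; the size of the steps is a
    continuous invariant function on [X], and further steps at time [1] change
    nothing, so that the number of steps need not be locally constant. *)

From HB Require Import structures.
From mathcomp Require Import all_boot all_order all_algebra.
From mathcomp Require Import all_classical all_reals all_analysis.
From mathcomp Require Import complex.
From mathcomp Require Import ring lra zify.
Require Import Defs.

Set Implicit Arguments.
Unset Strict Implicit.
Unset Printing Implicit Defensive.

Import Order.TTheory GRing.Theory Num.Theory.
Import numFieldNormedType.Exports.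

Local Open Scope classical_set_scope.
Local Open Scope ring_scope.

(** * Limits of matrices *)

(** The codimension bound is the origin of the constants. In (1), with ranks [k - k0] and [k], it
    reads [d1 < 2 * (k0 + 1)] on free cells and [d0 < k0 + 1] on fixed ones. In (2) the interval
    raises the dimensions by one, while the ranks of [E3] and [V] differ by [k] at every point, even
    where the rank of [E3] jumps: [d1 + 1 < 2 * (k + 1)] and [d0 + 1 < k + 1]. As [X] need not be
    compact, all estimates are made over compact pieces of a disc times a set of times, inside one
    pair of charts. Each global object, including the step size, comes from the single theorem
    [cellular_extension], applied to a predicate [P] on linear maps whose extension problem is
    solvable in charts. Its families are indexed by [X] and a compact set [T] of times, with values
    prescribed on [T0]: [T] is a point and [T0] is empty for the embedding in (1), [T] is the unit
    interval and [T0] its two ends in (2), and [T0] is empty for left inverses. *)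

Section MatrixCvg.

Lemma cvg_mxP (T : Type) (Z : topologicalType) (F : set_system T) m n
    (f : T -> 'M[Z]_(m, n)) (a : 'M[Z]_(m, n)) : Filter F ->
  f @ F --> a <-> forall i j, (fun t => f t i j) @ F --> a i j.
Proof.
move=> FF; split=> [fa i j A Aa|fa A [P Pa PA]].
  apply: (fa [set M : 'M[Z]_(m, n) | A (M i j)]).
  exists (fun i' j' => [set z | i' = i -> j' = j -> A z]) => [i' j'|M]; last exact.
  have [->|?] := pselect (i' = i); last first.
    by apply: (filterS _ (filterT)) => z _ /=.
  have [->|?] := pselect (j' = j); last first.
    by apply: (filterS _ (filterT)) => z _ /=.
  by apply: filterS Aa => z Az _ _; exact: Az.
have : \forall t \near F, forall i j, P i j (f t i j).
  by apply: filter_forall => i; apply: filter_forall => j; exact: (fa i j _ (Pa i j)).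
by apply: filterS => t; exact: PA.
Qed.

Variable (K : numFieldType) (T : Type) (F : set_system T).
Context {FF : Filter F}.

Lemma cvg_addmx m n (f g : T -> 'M[K^o]_(m, n)) (a b : 'M[K^o]_(m, n)) :
  f @ F --> a -> g @ F --> b -> (fun t => f t + g t) @ F --> a + b.
Proof.
move=> /cvg_mxP fa /cvg_mxP gb; apply/cvg_mxP => i j; rewrite mxE.
under eq_fun do rewrite mxE.
exact: cvgD (fa i j) (gb i j).
Qed.

Lemma cvg_oppmx m n (f : T -> 'M[K^o]_(m, n)) (a : 'M[K^o]_(m, n)) :
  f @ F --> a -> (fun t => - f t) @ F --> - a.
Proof.
move=> /cvg_mxP fa; apply/cvg_mxP => i j; rewrite mxE.
under eq_fun do rewrite mxE.
exact: cvgN (fa i j).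
Qed.

Lemma cvg_submx m n (f g : T -> 'M[K^o]_(m, n)) (a b : 'M[K^o]_(m, n)) :
  f @ F --> a -> g @ F --> b -> (fun t => f t - g t) @ F --> a - b.
Proof. by move=> fa gb; apply: cvg_addmx => //; exact: cvg_oppmx. Qed.

Lemma cvg_sumK (I : Type) (r : seq I) (P : pred I) (f : I -> T -> K^o) (a : I -> K^o) :
  (forall i, P i -> f i @ F --> a i) ->
  (fun t => \sum_(i <- r | P i) f i t) @ F --> \sum_(i <- r | P i) a i.
Proof.
move=> fa; elim: r => [|i r IH].
  by under eq_fun do rewrite big_nil; rewrite big_nil; exact: cvg_cst.
under eq_fun do rewrite big_cons; rewrite big_cons.
by case: ifP => // Pi; apply: cvgD => //; exact: fa.
Qed.

Lemma cvg_prodK (I : Type) (r : seq I) (P : pred I) (f : I -> T -> K^o) (a : I -> K^o) :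
  (forall i, P i -> f i @ F --> a i) ->
  (fun t => \prod_(i <- r | P i) f i t) @ F --> \prod_(i <- r | P i) a i.
Proof.
move=> fa; elim: r => [|i r IH].
  by under eq_fun do rewrite big_nil; rewrite big_nil; exact: cvg_cst.
under eq_fun do rewrite big_cons; rewrite big_cons.
by case: ifP => // Pi; apply: cvgM => //; exact: fa.
Qed.

Lemma cvg_mulmx m n p (f : T -> 'M[K^o]_(m, n)) (g : T -> 'M[K^o]_(n, p))
    (a : 'M[K^o]_(m, n)) (b : 'M[K^o]_(n, p)) :
  f @ F --> a -> g @ F --> b -> (fun t => f t *m g t) @ F --> a *m b.
Proof.
move=> /cvg_mxP fa /cvg_mxP gb; apply/cvg_mxP => i j; rewrite mxE.
under eq_fun do rewrite mxE.
by apply: cvg_sumK => k _; apply: cvgM; [exact: fa | exact: gb].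
Qed.

Lemma cvg_trmx m n (f : T -> 'M[K^o]_(m, n)) (a : 'M[K^o]_(m, n)) :
  f @ F --> a -> (fun t => (f t)^T) @ F --> a^T.
Proof.
move=> /cvg_mxP fa; apply/cvg_mxP => i j; rewrite mxE.
by under eq_fun do rewrite mxE; exact: fa.
Qed.

Lemma cvg_scalemx m n (c : K) (f : T -> 'M[K^o]_(m, n)) (a : 'M[K^o]_(m, n)) :
  f @ F --> a -> (fun t => c *: f t) @ F --> c *: a.
Proof.
move=> /cvg_mxP fa; apply/cvg_mxP => i j; rewrite mxE.
under eq_fun do rewrite mxE.
by apply: cvgM; [exact: cvg_cst | exact: fa].
Qed.

Lemma cvg_det n (f : T -> 'M[K^o]_n) (a : 'M[K^o]_n) :
  f @ F --> a -> (fun t => \det (f t) : K^o) @ F --> (\det a : K^o).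
Proof.
move=> /cvg_mxP fa; apply: cvg_sumK => s _.
by apply: cvgM; [exact: cvg_cst | apply: cvg_prodK => i _; exact: fa].
Qed.

(** Cramer's formula is continuous, but [invmx] follows it only on invertible matrices; the
    determinant stays nonzero near the limit. *)
Lemma cvg_invmx n (f : T -> 'M[K^o]_n) (a : 'M[K^o]_n) :
  a \in unitmx -> f @ F --> a -> (fun t => invmx (f t)) @ F --> invmx a.
Proof.
move=> ua fa.
have /= da := cvg_det fa.
have nz : \det a != 0 :> K^o by rewrite -unitfE -unitmxE.
have fu : \forall t \near F, f t \in unitmx.
  apply: filterS (cvgr_neq0 _ da nz) => t /= h.
  by rewrite unitmxE unitfE.
have adj : (fun t => (\det (f t))^-1 *: \adj (f t)) @ F
    --> (\det a)^-1 *: \adj a.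
  apply/cvg_mxP => i j; under eq_fun do rewrite !mxE; rewrite !mxE.
  apply: cvgM; first exact: cvgV.
  apply: cvgM; first exact: cvg_cst.
  apply: cvg_det; apply/cvg_mxP => k l.
  under eq_fun do rewrite !mxE; rewrite !mxE.
  by move/cvg_mxP : fa; exact.
rewrite [X in _ --> X]/invmx ua; apply: cvg_trans adj.
by apply: near_eq_cvg; apply: filterS fu => t ut; rewrite /invmx ut.
Qed.

End MatrixCvg.

Section ComplexCvg.
Variables (R : realType) (T : Type) (F : set_system T).
Context {FF : Filter F}.
Local Notation C := (R[i]%C).

Lemma normc_le_ReIm (z : C) : `|z| <= (`|complex.Re z| + `|complex.Im z|)%:C%C.
Proof.
rewrite {1}(complexE z) (le_trans (ler_normD _ _))// normrM.
rewrite rmorphD/= !normc_def/= !expr0n/= !addr0 !add0r !expr1n !sqrtr_sqr sqrtr1.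
by rewrite mul1r.
Qed.

Lemma normc_ge_Im (z : C) : (`|complex.Im z|%:C)%C <= `|z|.
Proof.
rewrite normc_def lecR -sqrtr_sqr ler_wsqrtr// lerDr; exact: sqr_ge0.
Qed.

Lemma cvg_complexP (f : T -> C^o) (a : C^o) : f @ F --> a <->
  (fun t => complex.Re (f t)) @ F --> complex.Re a /\ (fun t => complex.Im (f t)) @ F --> complex.Im a.
Proof.
split=> [/cvgrPdist_lt fa|[/cvgrPdist_lt ra /cvgrPdist_lt ia]].
  split; apply/cvgrPdist_lt => e e0;
    have e0' : 0 < (e%:C)%C by rewrite ltcR.
    apply: filterS (fa _ e0') => t /= h.
    rewrite -ltcR; apply: le_lt_trans h.
    by rewrite -raddfB; exact: normc_ge_Re.
  apply: filterS (fa _ e0') => t /= h.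
  rewrite -ltcR; apply: le_lt_trans h.
  by rewrite -raddfB; exact: normc_ge_Im.
apply/cvgrPdist_lt => e e0.
have er : e = ((complex.Re e)%:C)%C by rewrite RRe_real// gtr0_real.
have e0' : 0 < complex.Re e / 2.
  by move: e0; rewrite er ltcR => e0; rewrite divr_gt0.
apply: filterS2 (ra _ e0') (ia _ e0') => t h1 h2.
apply: le_lt_trans (normc_le_ReIm _) _; rewrite er ltcR !raddfB/=.
by rewrite (splitr (complex.Re e)) ltrD.
Qed.

Lemma cvg_conjc (f : T -> C^o) (a : C^o) : f @ F --> a ->
  (fun t => (f t)^* : C^o) @ F --> (a^* : C^o).
Proof.
move=> /cvgrPdist_lt fa; apply/cvgrPdist_lt => e e0.
by apply: filterS (fa _ e0) => t; rewrite -rmorphB norm_conjC.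
Qed.

Definition cjmx m n (A : 'M[C^o]_(m, n)) : 'M[C^o]_(m, n) :=
  map_mx (fun z : C => z^*) A.

Lemma cvg_cjmx m n (f : T -> 'M[C^o]_(m, n)) (a : 'M[C^o]_(m, n)) :
  f @ F --> a -> (fun t => cjmx (f t)) @ F --> cjmx a.
Proof.
move=> /cvg_mxP fa; apply/cvg_mxP => i j; rewrite mxE.
under eq_fun do rewrite mxE.
by apply: cvg_conjc; exact: fa.
Qed.

End ComplexCvg.

Section ConjugateMatrix.
Variable R : realType.
Local Notation C := (R[i]%C).

Lemma cjmxK m n : involutive (@cjmx R m n).
Proof. by move=> A; apply/matrixP => i j; rewrite !mxE conjCK. Qed.

Lemma cjmxD m n : {morph @cjmx R m n : A B / A + B}.
Proof. by move=> A B; apply/matrixP => i j; rewrite !mxE rmorphD. Qed.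

Lemma cjmxZ m n (c : C) (A : 'M[C^o]_(m, n)) : cjmx (c *: A) = c^* *: cjmx A.
Proof. by apply/matrixP => i j; rewrite !mxE rmorphM. Qed.

Lemma cjmxB m n : {morph @cjmx R m n : A B / A - B}.
Proof. by move=> A B; apply/matrixP => i j; rewrite !mxE rmorphB. Qed.

Lemma cjmxM m n p (A : 'M[C^o]_(m, n)) (B : 'M[C^o]_(n, p)) :
  cjmx (A *m B) = cjmx A *m cjmx B.
Proof.
apply/matrixP => i j; rewrite !mxE rmorph_sum/=; apply: eq_bigr => k _.
by rewrite rmorphM !mxE.
Qed.

Lemma cjmx1 n : cjmx (1%:M : 'M[C^o]_n) = 1%:M.
Proof. by apply/matrixP => i j; rewrite !mxE rmorph_nat. Qed.

Lemma cjmx_tr m n (A : 'M[C^o]_(m, n)) : cjmx A^T = (cjmx A)^T.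
Proof. by apply/matrixP => i j; rewrite !mxE. Qed.

End ConjugateMatrix.

(** * Continuous families of fibrewise linear maps *)

Section ContinuityWithin.

(** Pointwise form of continuity on the subspace [S], meaningful for [z] in [S]. Keeping the type
    [Z] makes it easy to change [S] from one step to the next. *)
Definition cwa (Z T : topologicalType) (S : set Z) (f : Z -> T) (z : Z) :=
  f @ within S (nbhs z) --> f z.

Lemma cwa_withinP (Z T : topologicalType) (S : set Z) (f : Z -> T) :
  {within S, continuous f} <-> forall z, S z -> cwa S f z.
Proof. exact: subspace_continuousP. Qed.

Lemma cwa_continuous (Z T : topologicalType) (S : set Z) (f : Z -> T) z :
  {for z, continuous f} -> cwa S f z.
Proof. by move=> fc A /fc; exact: (@cvg_within _ (nbhs z)). Qed.

Lemma cwa_id (Z : topologicalType) (S : set Z) z : cwa S idfun z.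
Proof. by apply: cwa_continuous; exact: cvg_id. Qed.

Lemma cwa_cst (Z T : topologicalType) (S : set Z) (t : T) z :
  cwa S (fun=> t) z.
Proof. by apply: cwa_continuous; exact: cvg_cst. Qed.

Lemma cwa_sub (Z T : topologicalType) (S S' : set Z) (f : Z -> T) z :
  S' `<=` S -> cwa S f z -> cwa S' f z.
Proof.
move=> SS fc A /fc.
by apply: (@filterS _ (nbhs z)) => y Ay /SS; exact: Ay.
Qed.

Lemma cwa_comp (Z T V : topologicalType) (S : set Z) (B : set T)
    (f : Z -> T) (g : T -> V) z :
  cwa S f z -> (\forall y \near within S (nbhs z), B (f y)) ->
  cwa B g (f z) -> cwa S (g \o f) z.
Proof.
move=> fc SB gc A /gc gA; have := fc _ gA; move: SB.
by apply: filterS2 => y By; exact.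
Qed.

Lemma cwa_near_eq (Z T : topologicalType) (S : set Z) (f g : Z -> T) z :
  S z -> (\forall y \near within S (nbhs z), f y = g y) ->
  cwa S f z -> cwa S g z.
Proof.
move=> Sz fg; have fgz : f z = g z by exact: (nbhs_singleton fg).
rewrite /cwa fgz => fc; apply: cvg_trans fc.
by apply: near_eq_cvg; apply: filterS fg => y ->.
Qed.

Lemma cwa_pair (Z T V : topologicalType) (S : set Z) (f : Z -> T) (g : Z -> V) z :
  cwa S f z -> cwa S g z -> cwa S (fun y => (f y, g y)) z.
Proof.
move=> fc gc.
exact: (@cvg_pair _ _ _ (within S (nbhs z)) (nbhs (f z)) (nbhs (g z))).
Qed.

Lemma near_within_self (Z : topologicalType) (S : set Z) (z : Z) :
  \forall y \near within S (nbhs z), S y.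
Proof. by apply: (@filterS _ (nbhs z) _ setT) => [y _ //|]; exact: filterT. Qed.

Lemma near_withinW (Z : topologicalType) (S P : set Z) (z : Z) :
  (forall y, S y -> P y) -> \forall y \near within S (nbhs z), P y.
Proof. by move=> SP; apply: filterS (near_within_self S z). Qed.

Lemma cwa_open (Z T : topologicalType) (S : set Z) (f : Z -> T) z (U : set T) :
  cwa S f z -> open U -> U (f z) -> \forall y \near within S (nbhs z), U (f y).
Proof. by move=> fc oU Uz; apply: fc; exact: open_nbhs_nbhs. Qed.

(** Pasting lemma: if [z] misses one of the closed sets, so does a whole neighbourhood, and that set
    imposes nothing there. *)
Lemma cwa_union (Z T : topologicalType) (A B : set Z) (f : Z -> T) z :
  closed A -> closed B -> (A z -> cwa A f z) -> (B z -> cwa B f z) ->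
  cwa (A `|` B) f z.
Proof.
have aux (D : set Z) : closed D -> (D z -> cwa D f z) ->
    forall P, nbhs (f z) P -> \forall y \near z, D y -> P (f y).
  move=> cD fD P Pz; have [/fD/(_ _ Pz)//|nD] := pselect (D z).
  have : \forall y \near z, ~ D y.
    by apply: open_nbhs_nbhs; split=> //; exact: closed_openC.
  by apply: filterS => y + /[dup] ? => /[apply].
move=> cA cB fA fB P Pz.
apply: filterS2 (aux _ cA fA _ Pz) (aux _ cB fB _ Pz) => y Ay By.
by case=> [/Ay|/By].
Qed.

End ContinuityWithin.

Section Hom.
Variable R : realType.
Local Notation C := (R[i]%C).

(** Linear maps with Leibniz extensionality, [hom_ext], so that equal maps can be exchanged inside
    dependent families and matrices. *)
Record hom (U V : lmodType C) := Hom {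
  hom_fun :> U -> V ;
  homP : forall (a : C) u v, hom_fun (a *: u + v) = a *: hom_fun u + hom_fun v }.

Lemma hom_ext (U V : lmodType C) (f g : hom U V) : f =1 g -> f = g.
Proof.
case: f g => [f fl] [g gl] /= /funext fg; case: _ / fg gl => gl.
by congr Hom; exact: Prop_irrelevance.
Qed.

Lemma hom0 (U V : lmodType C) (f : hom U V) : f 0 = 0.
Proof. by have := homP f (-1) 0 0; rewrite addr0 scaler0 scaleN1r addNr. Qed.

Lemma homD (U V : lmodType C) (f : hom U V) : {morph f : u v / u + v}.
Proof. by move=> u v; have := homP f 1 u v; rewrite !scale1r. Qed.

Lemma homZ (U V : lmodType C) (f : hom U V) a u : f (a *: u) = a *: f u.
Proof. by have := homP f a u 0; rewrite !addr0 hom0 addr0. Qed.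

Lemma homB (U V : lmodType C) (f : hom U V) : {morph f : u v / u - v}.
Proof. by move=> u v; rewrite homD -scaleN1r homZ scaleN1r. Qed.

Lemma hom_sum (U V : lmodType C) (f : hom U V) (I : Type) (r : seq I)
    (P : pred I) (F : I -> U) :
  f (\sum_(i <- r | P i) F i) = \sum_(i <- r | P i) f (F i).
Proof. by rewrite (big_morph f (homD f) (hom0 f)). Qed.

Lemma hom_inj (U V : lmodType C) (f : hom U V) :
  (forall u, f u = 0 -> u = 0) -> injective f.
Proof.
move=> f0 u v fuv; apply/eqP; rewrite -subr_eq0; apply/eqP; apply: f0.
by rewrite homB fuv subrr.
Qed.

Definition hom_comp (U V W : lmodType C) (g : hom V W) (f : hom U V) : hom U W.
Proof. by exists (g \o f) => a u v; rewrite /= !homP. Defined.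

Definition hom_id (U : lmodType C) : hom U U.
Proof. by exists idfun. Defined.

Definition hom_zero (U V : lmodType C) : hom U V.
Proof. by exists (fun=> 0) => a u v; rewrite scaler0 addr0. Defined.

Definition hom_add (U V : lmodType C) (f g : hom U V) : hom U V.
Proof.
by exists (fun u => f u + g u) => a u v; rewrite /= !homP scalerDr addrACA.
Defined.

Definition hom_sub (U V : lmodType C) (f g : hom U V) : hom U V.
Proof.
exists (fun u => f u - g u) => a u v.
by rewrite /= !homP scalerBr opprD addrACA.
Defined.

Definition hom_scale (U V : lmodType C) (l : C) (f : hom U V) : hom U V.
Proof.
exists (fun u => l *: f u) => a u v.
by rewrite homP scalerDr !scalerA [l * a]mulrC.
Defined.

Definition hom_of_linear (U V : lmodType C) (f : {linear U -> V}) : hom U V :=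
  Hom (linearP f).

Definition hom_to_linear (U V : lmodType C) (f : hom U V) : {linear U -> V} :=
  HB.pack (f : U -> V) (GRing.isLinear.Build C U V _ f (homP f)).

Definition hom_inverse (U V : lmodType C) (f : hom U V) (g : V -> U) :
  cancel f g -> cancel g f -> hom V U.
Proof.
move=> fK gK; exists g => a u v.
by apply: (can_inj fK); rewrite homP !gK.
Defined.

Definition CV n : lmodType C := 'Cn[R]_n.

Lemma mulmx_homP n m (A : 'M[C^o]_(n, m)) (a : C) (u v : CV n) :
  ((a *: u + v : CV n) : 'Cn[R]_n) *m A
  = (a *: ((u : 'Cn[R]_n) *m A : CV m) + ((v : 'Cn[R]_n) *m A : CV m) : CV m).
Proof.
apply/rowP => j; rewrite !mxE big_distrr -big_split; apply: eq_bigr => i _.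
by rewrite !mxE /= mulrDl mulrA.
Qed.

End Hom.

(** * Charts, and continuity of families of linear maps through their matrices *)

Section Charts.
Variables (R : realType) (X : topologicalType).
Local Notation C := (R[i]%C).

(** Both maps are linear over every point; off the domain, where they are not related,
    [chart_exists] makes the inverse zero. *)
Record chart (E : fibred R X) (n : nat) := Chart {
  chart_dom : set X ;
  chart_map : forall x, hom (fibre E x) (CV R n) ;
  chart_inv : forall x, hom (CV R n) (fibre E x) ;
  chart_open : open chart_dom ;
  chart_mapK : forall x, chart_dom x -> cancel (chart_map x) (chart_inv x) ;
  chart_invK : forall x, chart_dom x -> cancel (chart_inv x) (chart_map x) ;
  chart_map_cont : {within @proj R X E @^-1` chart_dom,
    continuous (fun e => chart_map (tag e) (tagged e) : 'Cn[R]_n)} ;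
  chart_inv_cont : {within chart_dom `*` setT,
    continuous (fun p : X * 'Cn[R]_n => totpt (chart_inv p.1 p.2))} }.

Lemma chart_map_cwa (E : fibred R X) n (c : chart E n) (e : tot E) :
  chart_dom c (proj e) -> cwa (@proj R X E @^-1` chart_dom c)
    (fun t : tot E => chart_map c (tag t) (tagged t) : 'Cn[R]_n) e.
Proof. by move=> ce; apply/(cwa_withinP _ _).1 => //; exact: chart_map_cont. Qed.

Lemma chart_inv_cwa (E : fibred R X) n (c : chart E n) (p : X * 'Cn[R]_n) :
  chart_dom c p.1 -> cwa (chart_dom c `*` setT)
    (fun q : X * 'Cn[R]_n => totpt (chart_inv c q.1 q.2) : tot E) p.
Proof. by move=> cp; apply/(cwa_withinP _ _).1 => //; exact: chart_inv_cont. Qed.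

Lemma chart_exists (E : vbundle R X) x :
  exists n (c : chart E n), chart_dom c x.
Proof.
have [U [oU Ux [n [h [g [hgK hc gc]]]]]] := vb_locally_trivial E x.
have glin y : U y -> forall (a : C) u v, g y (a *: u + v) = a *: g y u + g y v.
  move=> Uy a u v; have [hK gK] := hgK _ Uy.
  by apply: (can_inj hK); rewrite linearP/= !gK.
pose g' y : hom (CV R n) (fibre E y) :=
  match pselect (U y) with
  | left Uy => @Hom R (CV R n) (fibre E y) (g y) (glin y Uy)
  | right _ => hom_zero _ _
  end.
have g'E y : U y -> g' y = g y :> (CV R n -> fibre E y).
  by move=> Uy; rewrite /g'; case: pselect.
pose h' y : hom (fibre E y) (CV R n) := @Hom R (fibre E y) (CV R n) (h y) (linearP (h y)).
exists n; unshelve eexists.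
  refine (@Chart E n U h' g' oU _ _ hc _).
  - by move=> y Uy u; rewrite g'E//; exact: (hgK y Uy).1.
  - by move=> y Uy u; rewrite g'E//; exact: (hgK y Uy).2.
  - apply: subspace_eq_continuous gc => p; rewrite inE => -[Up _].
    by congr totpt; rewrite g'E.
exact: Ux.
Qed.

Section HomMatrix.
Variables (E F : fibred R X) (n m : nat) (c : chart E n) (d : chart F m).

(** Coordinates are row vectors multiplied from the right, so composites become products in the
    reverse order and injectivity becomes [row_free]. *)
Definition hmx x (f : hom (fibre E x) (fibre F x)) : 'M[C^o]_(n, m) :=
  \matrix_(i, j) (chart_map d x (f (chart_inv c x (delta_mx 0 i : 'rV_n)))
                  : 'rV_m) 0 j.

Lemma hmxE x (f : hom (fibre E x) (fibre F x)) (w : 'Cn[R]_n) :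
  chart_map d x (f (chart_inv c x w)) = w *m hmx f.
Proof.
transitivity (\sum_i w 0 i *: (chart_map d x (f (chart_inv c x
    (delta_mx 0 i : 'Cn[R]_n))) : CV R m)).
  rewrite [in LHS](row_sum_delta w) !hom_sum.
  by apply: eq_bigr => i _; rewrite !homZ.
apply/rowP => j; rewrite summxE !mxE; apply: eq_bigr => i _.
by rewrite !mxE.
Qed.

Lemma hmxE' x (f : hom (fibre E x) (fibre F x)) u : chart_dom c x ->
  chart_map d x (f u) = (chart_map c x u : 'rV_n) *m hmx f.
Proof. by move=> cx; rewrite -hmxE chart_mapK. Qed.

Lemma hmx_eq x (f g : hom (fibre E x) (fibre F x)) :
  chart_dom c x -> chart_dom d x -> hmx f = hmx g -> f = g.
Proof.
move=> cx dx fg; apply: hom_ext => u; apply: (can_inj (chart_mapK dx)).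
by rewrite !hmxE'// fg.
Qed.

Lemma hmxP x (f : hom (fibre E x) (fibre F x)) A :
  (forall w : 'Cn[R]_n, chart_map d x (f (chart_inv c x w)) = w *m A) ->
  hmx f = A.
Proof.
move=> fA; apply/row_matrixP => i.
by rewrite !rowE -hmxE fA.
Qed.

Definition mxhom x (A : 'M[C^o]_(n, m)) : hom (fibre E x) (fibre F x).
Proof.
exists (fun u => chart_inv d x ((chart_map c x u : 'rV_n) *m A)) => a u v.
rewrite homP -[RHS]homP; congr (chart_inv d x _).
exact: mulmx_homP.
Defined.

Lemma mxhomK x A : chart_dom c x -> chart_dom d x -> hmx (mxhom x A) = A.
Proof. by move=> cx dx; apply: hmxP => w; rewrite /= !chart_invK. Qed.

Lemma hmxK x (f : hom (fibre E x) (fibre F x)) :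
  chart_dom c x -> chart_dom d x -> mxhom x (hmx f) = f.
Proof. by move=> cx dx; apply: hmx_eq => //; rewrite mxhomK. Qed.

End HomMatrix.

Lemma hmx_comp (E F G : fibred R X) n m p (c : chart E n) (d : chart F m)
    (e : chart G p) x (f : hom (fibre E x) (fibre F x))
    (g : hom (fibre F x) (fibre G x)) : chart_dom d x ->
  hmx c e (hom_comp g f) = hmx c d f *m hmx d e g.
Proof.
move=> dx; apply: hmxP => w.
by rewrite mulmxA -(hmxE c d) -hmxE /= chart_mapK.
Qed.

Lemma hmx_scale (E F : fibred R X) n m (c : chart E n) (d : chart F m) x
    (l : C) (f : hom (fibre E x) (fibre F x)) :
  hmx c d (hom_scale l f) = l *: hmx c d f.
Proof. by apply/matrixP => i j; rewrite !mxE homZ !mxE. Qed.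

Lemma hmx_id (E : fibred R X) n (c : chart E n) x : chart_dom c x ->
  hmx c c (hom_id (fibre E x)) = 1%:M.
Proof. by move=> cx; apply: hmxP => w; rewrite mulmx1 chart_invK. Qed.

(** An entry is a composite of continuous maps: a constant basis vector, the inverse of [c], the
    chart [c'], a coordinate. *)
Lemma chart_transition (E : fibred R X) n n' (c : chart E n) (c' : chart E n') x :
  chart_dom c x -> chart_dom c' x ->
  cwa (chart_dom c `&` chart_dom c')
    (fun y => hmx c c' (hom_id (fibre E y))) x.
Proof.
move=> cx c'x; apply/cvg_mxP => i j; rewrite mxE.
under eq_fun do rewrite mxE.
pose k (v : 'Cn[R]_n') : C^o := v 0 j.
have kc : continuous k by exact: coord_continuous.
pose a := fun y : X => (y, delta_mx 0 i : 'Cn[R]_n).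
pose b := fun p : X * 'Cn[R]_n => totpt (chart_inv c p.1 p.2) : tot E.
pose e (t : tot E) := chart_map c' (tag t) (tagged t) : 'Cn[R]_n'.
suff : cwa (chart_dom c `&` chart_dom c') (k \o ((e \o b) \o a)) x by [].
apply: (@cwa_comp _ _ _ _ setT ((e \o b) \o a) k).
- apply: (@cwa_comp _ _ _ _ ((chart_dom c `&` chart_dom c') `*` setT) a).
  + by apply: cwa_pair; [exact: cwa_id | exact: cwa_cst].
  + by apply: near_withinW => y Sy; split.
  apply: (@cwa_comp _ _ _ _ (@proj R X E @^-1` chart_dom c') b e).
  + apply: (@cwa_sub _ _ (chart_dom c `*` setT)) => [y [[]]//|].
    exact: chart_inv_cwa.
  + apply: near_withinW => y [[_ ?] _] //.
  + exact: chart_map_cwa.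
- exact: nearW.
- by apply: cwa_continuous; exact: kc.
Qed.

Section HomContinuity.
Variables (Z : topologicalType) (phi : Z -> X) (S : set Z).

(** Continuity of a map between the pullbacks of [E] and [F] along [phi], without forming pullback
    bundles. All charts are allowed, for ease of use; by [hcont_local] one pair at each point
    suffices, as transition matrices are continuous. *)
Definition hcont (E F : fibred R X)
    (f : forall z, hom (fibre E (phi z)) (fibre F (phi z))) :=
  forall z, S z -> forall n m (c : chart E n) (d : chart F m),
    chart_dom c (phi z) -> chart_dom d (phi z) ->
    cwa S (fun y => hmx c d (f y)) z.

Lemma hcont_chart (E F : fibred R X)
    (f : forall z, hom (fibre E (phi z)) (fibre F (phi z)))
    n m (c : chart E n) (d : chart F m) n' m' (c' : chart E n') (d' : chart F m')
    z : S z -> cwa S phi z ->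
  chart_dom c (phi z) -> chart_dom d (phi z) ->
  chart_dom c' (phi z) -> chart_dom d' (phi z) ->
  cwa S (fun y => hmx c d (f y)) z -> cwa S (fun y => hmx c' d' (f y)) z.
Proof.
move=> Sz phic cz dz c'z d'z fc.
have nc := cwa_open phic (chart_open c) cz.
have nd := cwa_open phic (chart_open d) dz.
have nc' := cwa_open phic (chart_open c') c'z.
have nd' := cwa_open phic (chart_open d') d'z.
pose g y := hmx c' c (hom_id (fibre E (phi y)))
  *m hmx c d (f y) *m hmx d d' (hom_id (fibre F (phi y))).
apply: (@cwa_near_eq _ _ _ g) => //.
  apply: filterS2 nc nd => y cy dy; rewrite /g.
  by rewrite -!hmx_comp//; congr hmx; exact: hom_ext.
apply: cvg_mulmx; first apply: cvg_mulmx => //.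
  apply: (@cwa_comp _ _ _ _ (chart_dom c' `&` chart_dom c) phi _ z phic _
    (chart_transition c'z cz)).
  by apply: filterS2 nc' nc.
apply: (@cwa_comp _ _ _ _ (chart_dom d `&` chart_dom d') phi _ z phic _
  (chart_transition dz d'z)).
by apply: filterS2 nd nd'.
Qed.

Hypothesis phic : forall z, S z -> cwa S phi z.

Lemma hcont_local (E F : fibred R X)
    (f : forall z, hom (fibre E (phi z)) (fibre F (phi z))) :
  (forall z, S z -> exists n m (c : chart E n) (d : chart F m),
    [/\ chart_dom c (phi z), chart_dom d (phi z) &
        cwa S (fun y => hmx c d (f y)) z]) -> hcont f.
Proof.
move=> loc z Sz n m c d cz dz; have [n' [m' [c' [d' [c'z d'z fc]]]]] := loc z Sz.
exact: (hcont_chart (c := c') (d := d')) (phic Sz) _ _ _ _ fc.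
Qed.

Lemma hcont_comp (E F G : vbundle R X)
    (f : forall z, hom (fibre E (phi z)) (fibre F (phi z)))
    (g : forall z, hom (fibre F (phi z)) (fibre G (phi z))) :
  hcont f -> hcont g -> hcont (fun z => hom_comp (g z) (f z)).
Proof.
move=> fc gc z Sz n p c e cz ez.
have [m [d dz]] := chart_exists F (phi z).
apply: (@cwa_near_eq _ _ _ (fun y => hmx c d (f y) *m hmx d e (g y))) => //.
  apply: filterS (cwa_open (phic Sz) (chart_open d) dz) => y dy.
  by rewrite (hmx_comp _ _ _ _ dy).
by apply: cvg_mulmx; [exact: fc | exact: gc].
Qed.

Lemma hcont_id (E : vbundle R X) :
  hcont (fun z => hom_id (fibre E (phi z))).
Proof.
apply: hcont_local => z Sz; have [n [c cz]] := chart_exists E (phi z).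
exists n, n, c, c; split=> //.
apply: (@cwa_near_eq _ _ _ (fun=> 1%:M : 'M[C^o]_n)) => //; last exact: cwa_cst.
apply: filterS (cwa_open (phic Sz) (chart_open c) cz) => y cy.
by rewrite hmx_id.
Qed.

Lemma hcont_sub (E F : fibred R X)
    (f g : forall z, hom (fibre E (phi z)) (fibre F (phi z))) :
  hcont f -> hcont g -> hcont (fun z => hom_sub (f z) (g z)).
Proof.
move=> fc gc z Sz n m c d cz dz.
apply: (@cwa_near_eq _ _ _ (fun y => hmx c d (f y) - hmx c d (g y))) => //.
  apply: nearW => y.
  by apply/matrixP => i j; rewrite !mxE homB !mxE.
by apply: cvg_submx; [exact: fc | exact: gc].
Qed.

Lemma hcont_add (E F : fibred R X)
    (f g : forall z, hom (fibre E (phi z)) (fibre F (phi z))) :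
  hcont f -> hcont g -> hcont (fun z => hom_add (f z) (g z)).
Proof.
move=> fc gc z Sz n m c d cz dz.
apply: (@cwa_near_eq _ _ _ (fun y => hmx c d (f y) + hmx c d (g y))) => //.
  apply: nearW => y.
  by apply/matrixP => i j; rewrite !mxE homD !mxE.
by apply: cvg_addmx; [exact: fc | exact: gc].
Qed.

Lemma hcont0 (E F : fibred R X) :
  hcont (fun z => hom_zero (fibre E (phi z)) (fibre F (phi z))).
Proof.
move=> z Sz n m c d cz dz.
apply: (@cwa_near_eq _ _ _ (fun=> 0 : 'M[C^o]_(n, m))) => //; last exact: cwa_cst.
apply: nearW => y.
by apply/matrixP => i j; rewrite !mxE hom0 mxE.
Qed.

Lemma bij_chart_dim (E F : fibred R X) x n m (c : chart E n) (d : chart F m)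
    (f : hom (fibre E x) (fibre F x)) (g : fibre F x -> fibre E x) :
  chart_dom c x -> chart_dom d x -> cancel f g -> cancel g f -> n = m.
Proof.
move=> cx dx fK gK.
pose gl := hom_inverse fK gK.
have e1 : hmx c d f *m hmx d c gl = 1%:M.
  by rewrite -hmx_comp// -(hmx_id cx); congr hmx; apply: hom_ext => u /=; rewrite fK.
have e2 : hmx d c gl *m hmx c d f = 1%:M.
  by rewrite -hmx_comp// -(hmx_id dx); congr hmx; apply: hom_ext => u /=; rewrite gK.
by apply/eqP; rewrite eqn_leq (mulmx1_min e1) (mulmx1_min e2).
Qed.

Lemma hcont_inv (E F : vbundle R X)
    (f : forall z, hom (fibre E (phi z)) (fibre F (phi z)))
    (g : forall z, hom (fibre F (phi z)) (fibre E (phi z))) :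
  (forall z, S z -> cancel (f z) (g z) /\ cancel (g z) (f z)) ->
  hcont f -> hcont g.
Proof.
move=> fgK fc; apply: hcont_local => z Sz.
have [n [c cz]] := chart_exists E (phi z).
have [m [d dz]] := chart_exists F (phi z).
have nm := bij_chart_dim cz dz (fgK z Sz).1 (fgK z Sz).2.
case: _ / nm d dz => d dz; exists n, n, d, c; split=> //.
have inv y : S y -> chart_dom c (phi y) -> chart_dom d (phi y) ->
    hmx c d (f y) *m hmx d c (g y) = 1%:M.
  move=> Sy cy dy; rewrite -hmx_comp// -(hmx_id cy); congr hmx.
  by apply: hom_ext => u /=; rewrite (fgK y Sy).1.
apply: (@cwa_near_eq _ _ _ (fun y => invmx (hmx c d (f y)))) => //.
  have nc := cwa_open (phic Sz) (chart_open c) cz.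
  have nd := cwa_open (phic Sz) (chart_open d) dz.
  near=> y; have Sy : S y by near: y; exact: near_within_self.
  have e : hmx c d (f y) *m hmx d c (g y) = 1%:M by apply: inv => //; near: y.
  have [u _] := mulmx1_unit e.
  by apply: (can_inj (mulKmx u)); rewrite mulmxV.
apply: cvg_invmx; last exact: fc.
by have [uz _] := mulmx1_unit (inv z Sz cz dz); exact: uz.
Unshelve. all: by end_near. Qed.

End HomContinuity.

Lemma hcont_pull (Z Z' : topologicalType) (phi : Z -> X) (S : set Z)
    (psi : Z' -> Z) (S' : set Z') (E F : fibred R X)
    (f : forall z, hom (fibre E (phi z)) (fibre F (phi z))) :
  (forall z, S' z -> cwa S' psi z) -> (forall z, S' z -> S (psi z)) ->
  hcont S f -> hcont S' (fun z => f (psi z) :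
    hom (fibre E ((phi \o psi) z)) (fibre F ((phi \o psi) z))).
Proof.
move=> psic SS fc z Sz n m c d cz dz.
apply: (@cwa_comp _ _ _ _ S psi (fun y => hmx c d (f y))).
- exact: psic.
- exact: near_withinW.
- exact: fc (SS _ Sz) _ _ _ _ cz dz.
Qed.

(** Links the matrices of the proof with the maps of total spaces in which [real_iso] is stated:
    charts turn the total spaces locally into products, and conversely the entries are values on
    basis sections. *)
Lemma hcont_cont (E F : vbundle R X)
    (f : forall x, hom (fibre E x) (fibre F x)) :
  @hcont X id setT E F f <->
  continuous (fun e : tot E => totpt (f (tag e) (tagged e)) : tot F).
Proof.
split=> fc.
  move=> e; set x := proj e.
  have [n [c cx]] := chart_exists E x.
  have [m [d dx]] := chart_exists F x.
  have near_dom (G : set X) : open G -> G x -> \forall t \near e, G (proj t).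
    by move=> oG Gx; apply: (vb_proj_continuous (v := E)); exact: open_nbhs_nbhs.
  pose k (t : tot E) := (proj t,
    chart_map c (tag t) (tagged t) *m hmx c d (f (tag t))).
  pose l (p : X * 'Cn[R]_m) := totpt (chart_inv d p.1 p.2) : tot F.
  pose S : set (tot E) := [set t | chart_dom c (proj t) /\ chart_dom d (proj t)].
  have nS : nbhs e S.
    by apply: filterS2 (near_dom _ (chart_open c) cx) (near_dom _ (chart_open d) dx).
  have Se := nbhs_singleton nS.
  suff : cwa S (fun e : tot E => totpt (f (tag e) (tagged e)) : tot F) e.
    move=> h P /h Pe; apply: filterS2 nS Pe => t St; exact.
  apply: (@cwa_near_eq _ _ _ (l \o k)) => //.
    apply: near_withinW => t [ct dt].
    rewrite /l /k /= -hmxE' ?chart_mapK//.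
  apply: (@cwa_comp _ _ _ _ (chart_dom d `*` setT)).
  - apply: cwa_pair.
      by apply: cwa_continuous; exact: vb_proj_continuous.
    apply: cvg_mulmx.
      apply: (@cwa_sub _ _ (@proj R X E @^-1` chart_dom c)) => [t []//|].
      exact: chart_map_cwa.
    apply: (@cwa_comp _ _ _ _ setT (@proj R X E) (fun x => hmx c d (f x))).
    + by apply: cwa_continuous; exact: vb_proj_continuous.
    + exact: nearW.
    + exact: fc.
  - by apply: near_withinW => t [].
  - exact: chart_inv_cwa.
move=> x _ n m c d cx dx; apply/cvg_mxP => i j; rewrite mxE.
under eq_fun do rewrite mxE.
pose k (v : 'Cn[R]_m) : C^o := v 0 j.
have kc : continuous k by exact: coord_continuous.
pose a := fun y : X => (y, delta_mx 0 i : 'Cn[R]_n).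
pose b := fun p : X * 'Cn[R]_n => totpt (chart_inv c p.1 p.2) : tot E.
pose g := fun e : tot E => totpt (f (tag e) (tagged e)) : tot F.
pose e (t : tot F) := chart_map d (tag t) (tagged t) : 'Cn[R]_m.
suff : cwa setT (k \o (e \o (g \o (b \o a)))) x by [].
apply: (@cwa_comp _ _ _ _ setT (e \o (g \o (b \o a))) k).
- have nS : nbhs x (chart_dom c `&` chart_dom d).
    by apply: open_nbhs_nbhs; split=> //; apply: openI; exact: chart_open.
  have bac : cwa (chart_dom c) (b \o a) x.
    apply: (@cwa_comp _ _ _ _ (chart_dom c `*` setT) a).
    + by apply: cwa_pair; [exact: cwa_id | exact: cwa_cst].
    + by apply: near_withinW => y Sy; split.
    + exact: chart_inv_cwa.
  suff h : cwa (chart_dom c `&` chart_dom d) (e \o (g \o (b \o a))) x.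
    by move=> P /h Pe; apply: filterS2 nS Pe => t St Q _; exact: Q.
  apply: (@cwa_comp _ _ _ _ (@proj R X F @^-1` chart_dom d) (g \o (b \o a)) e).
  + apply: (@cwa_comp _ _ _ _ setT (b \o a) g).
    * by apply: cwa_sub bac => t [].
    * exact: nearW.
    * by apply: cwa_continuous; exact: fc.
  + by apply: near_withinW => t [].
  + exact: chart_map_cwa.
- exact: nearW.
- by apply: cwa_continuous; exact: kc.
Qed.

End Charts.

(** * Real charts *)

Section ChartConstruction.
Variables (R : realType) (X : topologicalType).
Local Notation C := (R[i]%C).

Lemma chart_build (E : fibred R X) n (U : set X)
    (h : forall x, hom (fibre E x) (CV R n)) (g : forall x, CV R n -> fibre E x) :
  open U -> (forall x, U x -> cancel (h x) (g x) /\ cancel (g x) (h x)) ->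
  (forall e : tot E, U (proj e) -> cwa (@proj R X E @^-1` U)
     (fun t : tot E => h (tag t) (tagged t) : 'Cn[R]_n) e) ->
  (forall p : X * 'Cn[R]_n, U p.1 -> cwa (U `*` setT)
     (fun q : X * 'Cn[R]_n => totpt (g q.1 q.2) : tot E) p) ->
  exists2 c : chart E n, chart_dom c = U & chart_map c = h.
Proof.
move=> oU hgK hc gc.
pose g' y : hom (CV R n) (fibre E y) :=
  match pselect (U y) with
  | left Uy => hom_inverse (hgK y Uy).1 (hgK y Uy).2
  | right _ => hom_zero _ _
  end.
have g'E y : U y -> forall w, g' y w = g y w.
  by move=> Uy w; rewrite /g'; case: pselect.
unshelve eexists.
  refine (@Chart R X E n U h g' oU _ _ _ _).
  - by move=> y Uy u; rewrite g'E//; exact: (hgK y Uy).1.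
  - by move=> y Uy u; rewrite g'E//; exact: (hgK y Uy).2.
  - by apply/cwa_withinP => e Ue; exact: hc.
  - apply/cwa_withinP => p Up; apply: cwa_near_eq (gc p Up.1) => //.
    by apply: near_withinW => q [Uq _]; congr totpt; rewrite g'E.
all: by [].
Qed.

Lemma chart_change (E : vbundle R X) n (c : chart E n) (V : set X)
    (A : X -> 'M[C^o]_n) (h : forall x, hom (fibre E x) (CV R n)) :
  open V -> V `<=` chart_dom c -> (forall x, V x -> A x \in unitmx) ->
  (forall x, V x -> cwa V A x) ->
  (forall x, V x -> forall u, h x u = (chart_map c x u : 'Cn[R]_n) *m A x) ->
  exists2 c' : chart E n, chart_dom c' = V & chart_map c' = h.
Proof.
move=> oV Vc uA cA hE.
apply: (@chart_build E n V h
  (fun x w => chart_inv c x ((w : 'Cn[R]_n) *m invmx (A x)))) => //.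
- move=> x Vx; split=> u.
    by rewrite hE// mulmxK ?uA// chart_mapK//; exact: Vc.
  by rewrite hE// chart_invK ?mulmxKV ?uA//; exact: Vc.
- move=> e Ve.
  pose k (t : tot E) := (chart_map c (tag t) (tagged t) : 'Cn[R]_n) *m A (proj t).
  apply: (@cwa_near_eq _ _ _ k) => //.
    by apply: near_withinW => t Vt; rewrite hE.
  apply: cvg_mulmx.
    apply: (@cwa_sub _ _ (@proj R X E @^-1` chart_dom c)) => [t /Vc //|].
    by apply: chart_map_cwa; exact: Vc.
  apply: (@cwa_comp _ _ _ _ V (@proj R X E) A).
  + by apply: cwa_continuous; exact: vb_proj_continuous.
  + exact: near_withinW.
  + exact: cA.
- move=> p Vp.
  pose k (q : X * 'Cn[R]_n) := (q.1, q.2 *m invmx (A q.1)) : X * 'Cn[R]_n.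
  apply: (@cwa_comp _ _ _ _ (chart_dom c `*` setT) k
    (fun q : X * 'Cn[R]_n => totpt (chart_inv c q.1 q.2) : tot E)).
  + apply: cwa_pair; first by apply: cwa_continuous; exact: cvg_fst.
    apply: cvg_mulmx; first by apply: cwa_continuous; exact: cvg_snd.
    apply: cvg_invmx; first exact: uA.
    apply: (@cwa_comp _ _ _ _ V fst A).
    * by apply: cwa_continuous; exact: cvg_fst.
    * by apply: near_withinW => q [].
    * exact: cA.
  + by apply: near_withinW => q [/Vc cq _].
  + by apply: chart_inv_cwa; exact: Vc.
Qed.

End ChartConstruction.

Section RealCharts.
Variables (R : realType) (X : involutiveSpace).
Local Notation C := (R[i]%C).

Lemma trivial_chart m : exists2 c : chart (trivial_fibred R X m) m,
  chart_dom c = setT & forall x, chart_map c x = hom_id (CV R m).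
Proof.
pose split_tot (e : tot (trivial_fibred R X m)) : X * 'Cn[R]_m := (tag e, tagged e).
have [||||c cU cm] := @chart_build R X (trivial_fibred R X m) m setT
  (fun x => hom_id (CV R m)) (fun x w => w).
- exact: openT.
- by [].
- by move=> e _; apply: cwa_continuous; exact: trivial_tagged_continuous.
- move=> p _; apply: cwa_continuous; apply: (@continuous_comp_initial _ _ _ split_tot).
  move=> q; rewrite (_ : _ \o _ = id); first exact: cvg_id.
  by apply/funext => -[].
- by exists c => // x; rewrite cm.
Qed.

(** As [tau (tau x)] is equal but not convertible to [x], vectors over the two points are compared
    as points of the total space. *)
Lemma fibre_hom_totpt (E F : fibred R X) (f : forall x, hom (fibre E x) (fibre F x))
    x y (u : fibre E x) (v : fibre E y) :
  totpt u = totpt v -> totpt (f x u) = totpt (f y v).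
Proof. exact: (congr1 (fun e : tot E => totpt (f (tag e) (tagged e)) : tot F)). Qed.

Lemma chart_map_totpt (E : fibred R X) n (c : chart E n) x y
    (u : fibre E x) (v : fibre E y) :
  totpt u = totpt v -> chart_map c x u = chart_map c y v.
Proof. exact: (congr1 (fun e : tot E => chart_map c (tag e) (tagged e))). Qed.

Lemma totpt_inj (E : fibred R X) x : injective (fun u : fibre E x => totpt u).
Proof. by move=> u v uv; exact: existT_inj2 uv. Qed.

Section Theta.
Variable E : realBundle R X.

Lemma Theta0 x : Theta (0 : fibre E x) = 0.
Proof. by have := ThetaZ 0 (0 : fibre E x); rewrite conjC0 !scale0r. Qed.

Lemma Theta_totpt x y (u : fibre E x) (v : fibre E y) :
  totpt u = totpt v -> totpt (Theta u) = totpt (Theta v).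
Proof. exact: (congr1 (fun e : tot E => totpt (Theta (tagged e)) : tot E)). Qed.

Lemma Theta_inj x : injective (@Theta R X E x).
Proof.
move=> u v uv; apply: totpt_inj.
by rewrite -ThetaK uv ThetaK.
Qed.

Lemma Theta_surj x (w : fibre E (tau x)) : exists u, Theta u = w.
Proof.
have [u uw] : exists u : fibre E x, totpt u = totpt (Theta w).
  move: (Theta w); rewrite tauK => u; by exists u.
exists u; apply: totpt_inj.
by rewrite (Theta_totpt uw) ThetaK.
Qed.

(** The inverse of [Theta] landing in the fibre over [x] itself; [Theta w] would lie over
    [tau (tau x)]. *)
Definition ThetaV x (w : fibre E (tau x)) := projT1 (cid (Theta_surj w)).

Lemma ThetaVK x (w : fibre E (tau x)) : Theta (ThetaV w) = w.
Proof. exact: projT2 (cid (Theta_surj w)). Qed.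

End Theta.

Lemma conj_chart_hom (E : realBundle R X) n (c : chart E n) x :
  {h : hom (fibre E x) (CV R n) |
    forall u, h u = cjmx (chart_map c (tau x) (Theta u) : 'Cn[R]_n)}.
Proof.
unshelve eexists.
  exists (fun u => cjmx (chart_map c (tau x) (Theta u) : 'Cn[R]_n)) => a u v.
  rewrite ThetaD ThetaZ homP.
  by rewrite cjmxD; congr (_ + _); rewrite cjmxZ conjCK.
by [].
Qed.

(** [Theta] is antilinear, so a chart composed with it becomes linear again after conjugating the
    coordinates. *)
Lemma conj_chart (E : realBundle R X) n (c : chart E n) :
  exists2 c' : chart E n, chart_dom c' = tau @^-1` chart_dom c &
    forall x u, chart_map c' x u = cjmx (chart_map c (tau x) (Theta u) : 'Cn[R]_n).
Proof.
pose U := @tau X @^-1` chart_dom c.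
pose h x := projT1 (conj_chart_hom c x).
have hE x u : h x u = cjmx (chart_map c (tau x) (Theta u) : 'Cn[R]_n).
  exact: projT2 (conj_chart_hom c x) u.
pose g x (w : CV R n) := ThetaV (chart_inv c (tau x) (cjmx (w : 'Cn[R]_n))).
have [||||c' c'U c'h] := @chart_build R X E n U h g.
- apply: open_comp; last exact: chart_open.
  by move=> x _; exact: tau_continuous.
- move=> x Ux; split=> u.
    apply: Theta_inj; rewrite ThetaVK hE cjmxK chart_mapK//.
  by rewrite hE ThetaVK chart_invK// cjmxK.
- move=> e Ue.
  pose k (t : tot E) := totpt (Theta (tagged t)) : tot E.
  pose l (t : tot E) := chart_map c (tag t) (tagged t) : 'Cn[R]_n.
  apply: (@cwa_near_eq _ _ _ (fun t => cjmx (l (k t)))) => //.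
    by apply: near_withinW => t _; rewrite hE.
  apply: cvg_cjmx.
  apply: (@cwa_comp _ _ _ _ (@proj R X E @^-1` chart_dom c) k l).
  + by apply: cwa_continuous; exact: Theta_continuous.
  + by apply: near_withinW => t Ut.
  + exact: chart_map_cwa.
- move=> p Up.
  pose k (q : X * 'Cn[R]_n) := (tau q.1, cjmx q.2) : X * 'Cn[R]_n.
  pose l (q : X * 'Cn[R]_n) := totpt (chart_inv c q.1 q.2) : tot E.
  pose m (t : tot E) := totpt (Theta (tagged t)) : tot E.
  apply: (@cwa_near_eq _ _ _ (m \o (l \o k))) => //.
    apply: nearW => q; rewrite /m /l /k /= /g -[RHS]ThetaK.
    by congr totpt; rewrite ThetaVK.
  apply: (@cwa_comp _ _ _ _ setT (l \o k) m).
  + apply: (@cwa_comp _ _ _ _ (chart_dom c `*` setT) k l).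
    * apply: cwa_pair.
        apply: (@cwa_comp _ _ _ _ setT fst (@tau X)).
        - by apply: cwa_continuous; exact: cvg_fst.
        - exact: nearW.
        - by apply: cwa_continuous; exact: tau_continuous.
      by apply: cvg_cjmx; apply: cwa_continuous; exact: cvg_snd.
    * by apply: near_withinW => q [].
    * exact: chart_inv_cwa.
  + exact: nearW.
  + by apply: cwa_continuous; exact: Theta_continuous.
- by exists c' => // x u; rewrite c'h.
Qed.

Lemma conj_chart_Theta (E : realBundle R X) n (c c' : chart E n) :
  (forall x u, chart_map c' x u
    = cjmx (chart_map c (tau x) (Theta u) : 'Cn[R]_n)) ->
  forall x (u : fibre E x), chart_map c' (tau x) (Theta u)
    = cjmx (chart_map c x u : 'Cn[R]_n).
Proof.
move=> c'E x u; rewrite c'E; congr cjmx; apply: chart_map_totpt.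
exact: ThetaK.
Qed.

(** Required over fixed points only: these are the points where [hmx_real] turns equivariance into
    reality of a matrix. *)
Definition real_chart (E : realBundle R X) n (c : chart E n) :=
  forall x, tau x = x -> chart_dom c x -> forall u : fibre E x,
    chart_map c (tau x) (Theta u) = cjmx (chart_map c x u : 'Cn[R]_n).

(* For [D] with at most [n] eigenvalues, one of the [n + 1] distinct points
   [(a + i) / (a - i)] of the unit circle, [a <= n], is not one of [- D]. *)
Lemma unit_combination n (D : 'M[C^o]_n) :
  exists l : C, l%:M + l^* *: D \in unitmx.
Proof.
pose l (a : nat) : C := a%:R + 'i.
have lJ a : (l a)^* = a%:R - 'i by rewrite /l rmorphD/= conjCi conjC_nat.
have ln0 a : (l a)^* != 0.
  rewrite lJ; apply/eqP => /(congr1 (fun z => z * (a%:R + 'i))).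
  rewrite mul0r -subr_sqr sqrCi opprK => /eqP.
  by rewrite -natrX natr1 pnatr_eq0.
pose mu a := l a / (l a)^*.
have mu_inj : injective mu.
  move=> a b /eqP; rewrite /mu eqr_div ?ln0// !lJ /l => /eqP ab.
  have : 2 * 'i * (a%:R - b%:R) = 0 :> C.
    transitivity ((b%:R + 'i) * (a%:R - 'i) - (a%:R + 'i) * (b%:R - 'i) : C).
      by ring.
    by rewrite -ab subrr.
  move=> /eqP; rewrite !mulf_eq0 pnatr_eq0 /= (negPf (neq0Ci _)) /=.
  by rewrite subr_eq0 eqr_nat => /eqP.
have [a|/= h] := pselect (exists a, ~~ root (char_poly (- D)) (mu a)); last first.
  have := @max_poly_roots _ (char_poly (- D)) [seq mu a | a <- iota 0 n.+1].
  rewrite monic_neq0 ?char_poly_monic// size_char_poly size_map size_iota ltnn.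
  rewrite map_inj_uniq// iota_uniq => H; exfalso.
  suff: false by []; apply: H => //; apply/allP => z /mapP[a _ ->].
  by apply/negPn/negP => ra; apply: h; exists a.
case: a => a; rewrite -eigenvalue_root_char /eigenvalue /eigenspace.
rewrite kermx_eq0 negbK row_free_unit => u.
exists (l a).
have -> : (l a)%:M + (l a)^* *: D = - (l a)^* *: (- D - (mu a)%:M).
  rewrite scalerBr scalerN scaleNr opprK addrC; congr (_ + _).
  by rewrite scaleNr opprK -scalemx1 scalerA [mu a]/mu mulrC divfK ?ln0 // scalemx1.
by rewrite unitmxZ// unitfE oppr_eq0 ln0.
Qed.

(** At a fixed point [Theta] followed by [c] is the conjugate of [c'], and vice versa; hence
    [l c + l^* c'] commutes with conjugation. The plain sum may be singular, for instance if
    [c' = - c]; [unit_combination] supplies an [l] making the combination invertible at [x], hence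
    nearby. *)
Lemma real_chart_exists (E : realBundle R X) x : tau x = x ->
  exists n (c : chart E n), real_chart c /\ chart_dom c x.
Proof.
move=> tx; have [n [c cx]] := chart_exists E x.
have [c' c'U c'E] := conj_chart c.
pose D y := hmx c c' (hom_id (fibre E y)).
have [l ul] := unit_combination (D x).
pose A y : 'M[C^o]_n := l%:M + l^* *: D y.
pose U := chart_dom c `&` chart_dom c'.
have oU : open U by apply: openI; exact: chart_open.
have Ux : U x by split=> //; rewrite c'U /= tx.
have cA y : U y -> cwa U A y.
  move=> [cy c'y]; apply: cvg_addmx; first exact: cvg_cst.
  by apply: cvg_scalemx; exact: chart_transition.
pose V := [set y | U y /\ A y \in unitmx].
have VU : V `<=` U by move=> y [].
have oV : open V.
  rewrite openE => y [Uy Ay].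
  have dy : cwa U (fun y => \det (A y) : C^o) y by apply: cvg_det; exact: cA.
  have nz : \det (A y) != 0 :> C^o by rewrite -unitfE -unitmxE.
  have h : \forall t \near y, U t -> \det (A t) != 0 :> C^o.
    by have := cvgr_neq0 _ dy nz; apply.
  have nU : nbhs y U by exact: open_nbhs_nbhs.
  suff : \forall t \near y, V t by [].
  apply: filterS2 nU h => t Ut /(_ Ut) dt.
  by split=> //; rewrite unitmxE unitfE.
pose h y := hom_add (hom_scale l (chart_map c y)) (hom_scale l^* (chart_map c' y)).
have [|||c2 c2V c2h] := chart_change oV (fun y Vy => (VU y Vy).1) (A := A) (h := h).
- by move=> y [].
- by move=> y Vy; apply: cwa_sub (cA y (VU _ Vy)).
- move=> y [[cy c'y] _] u.
  have -> : h y u = (l *: (chart_map c y u : 'Cn[R]_n)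
      + l^* *: (chart_map c' y u : 'Cn[R]_n)) by [].
  have -> : chart_map c' y u = (chart_map c y u : 'Cn[R]_n) *m D y.
    by rewrite -(hmxE' _ (hom_id _)).
  by rewrite /A mulmxDr mul_mx_scalar -scalemxAr.
exists n, c2; split; last by rewrite c2V.
move=> y ty; rewrite c2V => Vy u; rewrite c2h /h /=.
have e1 : chart_map c (tau y) (Theta u) = cjmx (chart_map c' y u : 'Cn[R]_n).
  by rewrite c'E cjmxK.
rewrite e1 (conj_chart_Theta c'E).
apply/rowP => j; rewrite !mxE. rewrite rmorphD !rmorphM /=.
by rewrite conjCK addrC.
Qed.


Section Equivariance.
Variables E F : realBundle R X.

(** A relation between two single maps, so that one can be constructed from the other; a family is
    equivariant when it relates [f x] to [f (tau x)]. *)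
Definition Theta_rel x (f : hom (fibre E x) (fibre F x))
    (f' : hom (fibre E (tau x)) (fibre F (tau x))) :=
  forall u, f' (Theta u) = Theta (f u).

Lemma Theta_rel_sym (f : forall x, hom (fibre E x) (fibre F x)) x :
  Theta_rel (f x) (f (tau x)) -> Theta_rel (f (tau x)) (f (tau (tau x))).
Proof.
move=> fx w; rewrite -[w]ThetaVK; set u := ThetaV w; rewrite fx.
apply: totpt_inj; rewrite ThetaK.
by apply: fibre_hom_totpt; exact: ThetaK.
Qed.

Lemma Theta_rel_exists x (f' : hom (fibre E (tau x)) (fibre F (tau x))) :
  exists f : hom (fibre E x) (fibre F x), Theta_rel f f'.
Proof.
unshelve eexists.
  exists (fun u => ThetaV (f' (Theta u))) => a u v.
  apply: Theta_inj.
  by rewrite ThetaVK ThetaD ThetaZ homP ThetaD ThetaZ !ThetaVK.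
by move=> u /=; rewrite ThetaVK.
Qed.

Lemma Theta_rel_injective x (f : hom (fibre E x) (fibre F x))
    (f' : hom (fibre E (tau x)) (fibre F (tau x))) :
  Theta_rel f f' -> injective f -> injective f'.
Proof.
move=> ff' fi v w; rewrite -[v]ThetaVK -[w]ThetaVK !ff'.
by move=> /Theta_inj /fi ->.
Qed.

Lemma hmx_real n m (c : chart E n) (d : chart F m)
    (f : forall x, hom (fibre E x) (fibre F x)) x :
  real_chart c -> real_chart d -> tau x = x ->
  chart_dom c x -> chart_dom d x ->
  Theta_rel (f x) (f (tau x)) <-> cjmx (hmx c d (f x)) = hmx c d (f x).
Proof.
move=> rc rd tx cx dx.
have ctx : chart_dom c (tau x) by rewrite tx.
have dtx : chart_dom d (tau x) by rewrite tx.
have Htx : hmx c d (f (tau x)) = hmx c d (f x) by rewrite tx.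
split=> [fx|Hx u].
  apply/row_matrixP => i; rewrite !rowE; set w : 'Cn[R]_n := delta_mx 0 i.
  pose u := chart_inv c x (cjmx w).
  have uw : cjmx (chart_map c x u : 'Cn[R]_n) = w.
    by rewrite chart_invK// cjmxK.
  have := congr1 (chart_map d (tau x)) (fx u).
  by rewrite rd// (hmxE' _ _ _ cx) (hmxE' _ _ _ ctx) rc// cjmxM uw Htx.
apply: (can_inj (chart_mapK dtx)).
by rewrite rd// (hmxE' _ _ _ cx) (hmxE' _ _ _ ctx) rc// cjmxM Hx Htx.
Qed.

(** In the conjugate charts over [tau (phi z)] the matrix of [f'] is the conjugate of that of [f].
    This gives continuity on the second sheet of a free cell. *)
Lemma hcont_conj (Z : topologicalType) (phi : Z -> X) (S : set Z)
    (f : forall z, hom (fibre E (phi z)) (fibre F (phi z)))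
    (f' : forall z, hom (fibre E (tau (phi z))) (fibre F (tau (phi z)))) :
  (forall z, S z -> cwa S phi z) ->
  (forall z, S z -> Theta_rel (f z) (f' z)) ->
  hcont S f -> @hcont _ _ _ (tau \o phi) S _ _ f'.
Proof.
move=> phic ff' fc; apply: hcont_local => [z Sz|z Sz].
  apply: (@cwa_comp _ _ _ _ setT phi (@tau X)); [exact: phic | exact: nearW |].
  by apply: cwa_continuous; exact: tau_continuous.
have [n [c cz]] := chart_exists E (phi z).
have [m [d dz]] := chart_exists F (phi z).
have [c' c'U c'E] := conj_chart c; have [d' d'U d'E] := conj_chart d.
have c'z : chart_dom c' (tau (phi z)) by rewrite c'U /= tauK.
have d'z : chart_dom d' (tau (phi z)) by rewrite d'U /= tauK.
exists n, m, c', d'; split=> //.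
apply: (@cwa_near_eq _ _ _ (fun y => cjmx (hmx c d (f y)))) => //; last first.
  by apply: cvg_cjmx; exact: fc.
near=> y.
have Sy : S y by near: y; exact: near_within_self.
have cy : chart_dom c (phi y).
  by near: y; apply: (cwa_open (phic z Sz)) cz; exact: chart_open.
have dy : chart_dom d (phi y).
  by near: y; apply: (cwa_open (phic z Sz)) dz; exact: chart_open.
apply/esym; apply: hmxP => w.
have c'y : chart_dom c' (tau (phi y)) by rewrite c'U /= tauK.
set v := chart_inv c' _ w.
have uw : cjmx (chart_map c (phi y) (ThetaV v) : 'Cn[R]_n) = w.
  by rewrite -(conj_chart_Theta c'E) ThetaVK chart_invK.
rewrite -[v]ThetaVK (ff' y Sy) (conj_chart_Theta d'E) (hmxE' _ _ _ cy).
by rewrite cjmxM uw.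
Unshelve. all: by end_near. Qed.

End Equivariance.

Lemma has_rank_chart (E : realBundle R X) k x n (c : chart E n) :
  has_rank E k -> chart_dom c x -> n = k.
Proof.
move=> /(_ x)[h [g hK gK]] cx.
have [d dU _] := trivial_chart k.
apply: (@bij_chart_dim _ _ E (trivial_fibred R X k) x n k c d
  (@Hom R (fibre E x) (CV R k) h (linearP h)) g) => //.
by rewrite dU.
Qed.

Lemma trivial_chart_dim m x n (c : chart (trivial_bundle R X m) n) :
  chart_dom c x -> n = m.
Proof.
by apply: (@has_rank_chart (trivial_bundle R X m)) => y; exists idfun; exists idfun.
Qed.

Lemma chart_rank_iso (E F : realBundle R X) x n m (c : chart E n) (d : chart F m)
    (f : hom (fibre E x) (fibre F x)) :
  chart_dom c x -> chart_dom d x -> injective f <-> row_free (hmx c d f).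
Proof.
move=> cx dx; split=> [fi|].
  rewrite -kermx_eq0; apply/eqP/row_matrixP => i; rewrite row0.
  set w : 'Cn[R]_n := row i _.
  have : w *m hmx c d f = 0.
    by rewrite /w -row_mul mulmx_ker row0.
  rewrite -hmxE => h.
  have : f (chart_inv c x w) = f 0.
    apply: (can_inj (chart_mapK dx)); rewrite h hom0.
    by rewrite (hom0 (chart_map d x)).
  move=> /fi /(congr1 (chart_map c x)); rewrite chart_invK// => ->.
  exact: hom0.
move=> /row_free_inj rf; apply: hom_inj => u fu.
apply: (can_inj (chart_mapK cx)); rewrite hom0; apply: rf.
by rewrite -hmxE'// fu mul0mx hom0.
Qed.

End RealCharts.

(** * Skeleta and extension over cells *)

Section Subspaces.

Lemma open_subspace_near (Z : topologicalType) (A B : set Z) x :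
  open (A : set (subspace B)) -> B x -> A x ->
  \forall y \near within B (nbhs x), A y.
Proof.
move=> oA Bx Ax; have : nbhs (x : subspace B) A by exact: open_nbhs_nbhs.
by rewrite /nbhs /= -nbhs_subspace_in.
Qed.

Lemma near_open_subspace (Z : topologicalType) (A B : set Z) :
  (forall x, B x -> A x -> \forall y \near within B (nbhs x), A y) ->
  open (A : set (subspace B)).
Proof.
move=> h; rewrite openE => x Ax; rewrite /interior.
have [Bx|nBx] := pselect (B x); rewrite /nbhs /=.
  by rewrite -nbhs_subspace_in//; exact: h.
by rewrite -nbhs_subspace_out// => _ ->.
Qed.

End Subspaces.

Section Skeleton.
Variables (R : realType) (X : involutiveSpace) (CW : Z2CW R X).

(** Continuity of the characteristic maps is the direct half of [skel_open], applied to the trace of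
    an open set of [X]. *)
Lemma charmap_cwa n (s : sheet (free_cell CW n) (fixed_cell CW n)) v :
  disc v -> cwa (@disc R n) (charmap s) v.
Proof.
move=> dv P; rewrite nbhsE => -[W [oW Wv] WP].
have /skel_open[_ /(_ s) oW'] : open (W : set (subspace (skel CW n.+1))).
  exact: open_subspaceW.
by apply: filterS (open_subspace_near oW' dv Wv) => y; exact: WP.
Qed.

Lemma tau_skel n x : skel CW n x -> skel CW n (tau x).
Proof.
elim: n x => [|n IH] x; first by rewrite skel0.
move=> sx; have [/IH|nx] := pselect (skel CW n x); first exact: skelS.
have [s [v [ov <-]]] := charmap_onto sx nx.
rewrite -charmap_equivariant; last exact: ltW.
by apply: charmap_disc; exact: ltW.
Qed.

Lemma skel_eventually_full N :
  (forall n, (N <= n)%N -> sheet (free_cell CW n) (fixed_cell CW n) -> False) ->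
  forall x, skel CW N x.
Proof.
move=> h x; have : (\bigcup_n skel CW n) x by rewrite skel_cover.
have up m k : (m <= k)%N -> skel CW m `<=` skel CW k.
  move=> /subnK <-; elim: (k - m)%N => // j IH y /IH; rewrite addSn.
  exact: skelS.
case=> n _; have [nN|Nn] := leqP n N; first exact: up.
rewrite -(subnK (ltnW Nn)); elim: (n - N)%N => // j IH; rewrite addSn => sx.
apply: IH; apply/not_notP => nx; have [s _] := charmap_onto sx nx.
by apply: (h _ _ s); rewrite leq_addl.
Qed.

Section SkeletonContinuity.
Variables (E F : fibred R X).
Implicit Types f : forall x : X, R -> hom (fibre E x) (fibre F x).

Definition fcont (Z : topologicalType) (phi : Z -> X) (theta : Z -> R)
    (S : set Z) f :=
  @hcont R X Z phi S E F (fun z => f (phi z) (theta z)).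

Lemma fcont_eq (Z : topologicalType) (phi phi' : Z -> X) (theta : Z -> R)
    (S : set Z) f f' :
  (forall z, S z -> phi z = phi' z) ->
  (forall z, S z -> f (phi z) (theta z) = f' (phi z) (theta z)) ->
  fcont phi theta S f -> fcont phi' theta S f'.
Proof.
move=> pp' ff' fc z Sz n m c d cz dz.
rewrite -(pp' z Sz) in cz dz.
apply: cwa_near_eq (fc z Sz n m c d cz dz) => //.
by apply: near_withinW => y Sy; rewrite ff'// pp'.
Qed.

Lemma fcont_sub (Z : topologicalType) (phi : Z -> X) (theta : Z -> R)
    (S S' : set Z) f : S' `<=` S -> fcont phi theta S f -> fcont phi theta S' f.
Proof.
move=> SS fc z Sz n m c d cz dz.
by apply: (cwa_sub SS); exact: fc (SS _ Sz) _ _ _ _ cz dz.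
Qed.

Lemma fcont_union (Z : topologicalType) (phi : Z -> X) (theta : Z -> R)
    (A B : set Z) f : closed A -> closed B ->
  fcont phi theta A f -> fcont phi theta B f -> fcont phi theta (A `|` B) f.
Proof.
move=> cA cB fA fB z _ n m c d cz dz.
by apply: cwa_union => // [Az|Bz]; [exact: fA | exact: fB].
Qed.

Variables (T : set R).

Section Tube.
Variables (Z : topologicalType) (phi : Z -> X) (S : set Z) (f : forall x : X,
  R -> hom (fibre E x) (fibre F x)).
Hypothesis phic : forall z, S z -> cwa S phi z.
Hypothesis fc : fcont (Z := Z * R)%type (phi \o fst) snd (S `*` T) f.
Variables (n m : nat) (c : chart E n) (d : chart F m) (P : set 'M[R[i]^o]_(n, m)).
Hypothesis oP : open P.

(** Tube lemma: compactness of [J] gives one neighbourhood of [y] that serves all times. *)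
Lemma near_tube (J : set R) y : compact J -> J `<=` T -> S y ->
  chart_dom c (phi y) -> chart_dom d (phi y) ->
  (forall t, J t -> P (hmx c d (f (phi y) t))) ->
  \forall z \near within S (nbhs y), forall t, J t -> P (hmx c d (f (phi z) t)).
Proof.
move=> cJ JT Sy cy dy Py.
have H : \forall z \near within S (nbhs y),
    J `<=` (fun t => T t -> P (hmx c d (f (phi z) t))).
  apply: (proj1 (compact_near_coveringP J) cJ Z (within S (nbhs y))
    (fun z t => T t -> P (hmx c d (f (phi z) t)))) => t Jt.
  have := @fc (y, t) (conj Sy (JT _ Jt)) n m c d cy dy _
    (open_nbhs_nbhs (conj oP (Py _ Jt))).
  case=> -[A B] /= [Ay Bt] AB.
  exists (B, [set z | S z /\ A z]).
    by split=> //=; apply: filterS Ay => z Az Sz; split.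
  by move=> -[t' z] /= [Bt' [Sz Az]] Tt'; exact: (AB (z, t')).
by apply: filterS H => z zP t Jt; exact: zP (JT _ Jt).
Qed.

End Tube.

(** The obstacle is that [skel_open] tests sets of points, not sets of pairs of a point and a time.
    For a small closed interval of times around [t0], the points whose matrices stay in [P]
    throughout it form a set, open in each piece by [near_tube] and therefore open in
    [skel n.+1]. *)
Lemma fcont_skelS n f : compact T ->
  fcont (Z := X * R)%type fst snd (skel CW n `*` T) f ->
  (forall s : sheet (free_cell CW n) (fixed_cell CW n),
    fcont (Z := 'rV[R]_n * R)%type (charmap s \o fst) snd (@disc R n `*` T) f) ->
  fcont (Z := X * R)%type fst snd (skel CW n.+1 `*` T) f.
Proof.
move=> cT fn fs [x0 t0] [/= sx0 Tt0] a b c d /= cx0 dx0.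
pose M x t := hmx c d (f x t).
move=> P0; rewrite nbhsE => -[P [oP PM] PP0].
suff : \forall z \near within (skel CW n.+1 `*` T) (nbhs (x0, t0)),
  P (M z.1 z.2) by apply: filterS => z; exact: PP0.
(* One piece through [x0], either the old skeleton or a cell, suffices to find the interval of
   times. *)
have : exists (Z : topologicalType) (S : set Z) (phi : Z -> X) y, [/\ S y, phi y = x0 &
    fcont (Z := Z * R)%type (phi \o fst) snd (S `*` T) f].
  have [nx0|nx0] := pselect (skel CW n x0); first by exists X, (skel CW n), id, x0.
  have [s [v [ov sv]]] := charmap_onto sx0 nx0.
  exists 'rV[R]_n, (@disc R n), (charmap s), v; split=> //; first exact: ltW.
case=> Z [S [phi [y [Sy yx0 fphi]]]]; subst x0.
have [e e0 eP] : exists2 e : R, 0 < e &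
    forall t, T t -> `|t0 - t| <= e -> P (M (phi y) t).
  have := @fphi (y, t0) (conj Sy Tt0) a b c d cx0 dx0 _
    (open_nbhs_nbhs (conj oP PM)).
  case=> -[A B] /= [Ay Bt0] AB.
  move: Bt0 => /nbhs_ballP[e /= e0 eB]; exists (e / 2); first exact: divr_gt0.
  move=> t Tt et; apply: (AB (y, t)) => //=; split.
    exact: nbhs_singleton Ay.
  apply: eB; rewrite /ball /=; apply: (le_lt_trans et).
  by rewrite ltr_pdivrMr// ltr_pMr// ltr1n.
pose J := T `&` closed_ball (t0 : R^o) e.
have cJ : compact J by apply: compact_closedI => //; exact: closed_ball_closed.
have JT : J `<=` T by move=> t [].
pose A := [set x | [/\ chart_dom c x, chart_dom d x & forall t, J t -> P (M x t)]].
have loc (Z' : topologicalType) (phi' : Z' -> X) (S' : set Z') :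
    (forall z, S' z -> cwa S' phi' z) ->
    fcont (Z := Z' * R)%type (phi' \o fst) snd (S' `*` T) f ->
    open (phi' @^-1` A : set (subspace S')).
  move=> phic' fc'; apply: near_open_subspace => z Sz [cz dz Pz].
  have nc := cwa_open (phic' z Sz) (chart_open c) cz.
  have nd := cwa_open (phic' z Sz) (chart_open d) dz.
  have nP := near_tube fc' oP cJ JT Sz cz dz Pz.
  by apply: filterS3 nc nd nP => w cw dw Pw; split.
have oA : open (A : set (subspace (skel CW n.+1))).
  apply/skel_open; split.
    apply: (loc X id (skel CW n)) => // z _; exact: cwa_id.
  by move=> s; apply: loc => // v dv; exact: charmap_cwa.
have Ax0 : A (phi y).
  split=> // t [Tt]; rewrite closed_ballE// => et; exact: eP.
have nA := open_subspace_near oA sx0 Ax0.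
exists ([set x | skel CW n.+1 x -> A x], closed_ball (t0 : R^o) e).
  split=> //=; apply: filterS (nbhsx_ballx (t0 : R^o) e e0).
  exact: subset_closed_ball.
move=> [x t] /= [Ax et] [/= sx Tt].
by have [_ _] := Ax sx; apply; split.
Qed.

End SkeletonContinuity.
End Skeleton.

Section FiniteCover.

(** The near-covering form of compactness, for the filter of lists of points of [K] directed by
    inclusion. *)
Lemma compact_list_cover (Z : topologicalType) (K : set Z) (N : Z -> set Z) :
  compact K -> (forall z, K z -> nbhs z (N z)) ->
  exists2 r : seq Z, forall z, z \in r -> K z &
    forall y, K y -> exists2 z, z \in r & N z y.
Proof.
move=> cK nN.
pose D : set (seq Z) := [set r : seq Z | forall z, z \in r -> K z].
pose B (r : seq Z) : set (seq Z) := [set r' : seq Z | D r' /\ {subset r <= r'}].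
have FF : Filter (filter_from D B).
  apply: filter_from_filter; first by exists [::].
  move=> r1 r2 D1 D2; exists (r1 ++ r2).
    by move=> z; rewrite mem_cat => /orP[/D1|/D2].
  move=> r [Dr sr]; split; split=> // z zr; apply: sr; rewrite mem_cat zr//.
  by rewrite orbT.
have [|r Dr rP] := proj1 (compact_near_coveringP K) cK (seq Z) (filter_from D B)
  (fun r y => exists2 z, z \in r & N z y) FF.
  move=> z Kz; exists (N z, B [:: z]).
    split=> /=; first exact: nN.
    by exists [:: z] => // y; rewrite inE => /eqP->.
  by move=> [y r] /= [Ny [_ zr]]; exists z => //; apply: zr; exact: mem_head.
exists r => // y Ky; exact: rP (conj Dr (fun _ h => h)) y Ky.
Qed.

End FiniteCover.

(** * Equivariant extension over the cells of a complex *)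

Section CellExtension.
Variables (R : realType) (X : involutiveSpace) (CW : Z2CW R X).
Variables (E F : realBundle R X) (T T0 : set R).
Hypotheses (cT : compact T) (cT0 : closed T0) (T0T : T0 `<=` T).
Variable P : forall x : X, R -> hom (fibre E x) (fibre F x) -> Prop.
Implicit Types f : forall x : X, R -> hom (fibre E x) (fibre F x).

(** The extension problem inside one pair of charts, where it concerns matrices over a compact piece
    [K] of the cell times [T]. With [real], for fixed cells, the charts are real and the matrices
    must remain real. *)
Definition local_extension (real : bool) n (phi : 'rV[R]_n -> X) :=
  forall a b (c : chart E a) (d : chart F b),
  (real -> real_chart c /\ real_chart d) ->
  forall K S : set ('rV[R]_n * R)%type, compact K -> closed S -> S `<=` K ->
  (forall z, K z -> [/\ disc z.1, T z.2, chart_dom c (phi z.1)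
    & chart_dom d (phi z.1)]) ->
  forall G : 'rV[R]_n * R -> 'M[R[i]^o]_(a, b),
  (forall z, S z -> cwa S G z) ->
  (forall z, S z -> P z.2 (mxhom c d (phi z.1) (G z))) ->
  (real -> forall z, S z -> cjmx (G z) = G z) ->
  exists G', [/\ forall z, K z -> cwa K G' z, forall z, S z -> G' z = G z,
    forall z, K z -> P z.2 (mxhom c d (phi z.1) (G' z)) &
    real -> forall z, K z -> cjmx (G' z) = G' z].

Section OneCell.
Variables (n : nat) (s : sheet (free_cell CW n) (fixed_cell CW n)) (real : bool).
Hypothesis realP : real -> forall v, disc v -> tau (charmap s v) = charmap s v.
Hypothesis LE : local_extension real (charmap s).
Local Notation phi := (charmap s).
Local Notation D := (@disc R n).
Local Notation Y := ('rV[R]_n * R)%type.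

Let S0 : set Y := (@sphere R n `*` T) `|` (D `*` T0).

Definition cell_ok (S : set Y) f :=
  [/\ fcont (phi \o fst) snd S f, forall z, S z -> P z.2 (f (phi z.1) z.2) &
      real -> forall z, S z ->
        Theta_rel (f (phi z.1) z.2) (f (tau (phi z.1)) z.2)].

(** The only places where the extension may alter [f]; this protects the lower skeleton, the other
    cells and, on this cell, the times in [T0]. *)
Definition changed x t := exists v, [/\ open_disc v, phi v = x & ~ S0 (v, t)].

Lemma sqnorm_continuous : continuous (@sqnorm R n).
Proof.
move=> v; apply: (@cvg_sumK _ _ (nbhs v)) => i _.
by apply: cvgM; exact: coord_continuous.
Qed.

Lemma disc_closed : closed D.
Proof.
apply: (@closed_comp _ _ (@sqnorm R n) [set x : R | x <= 1]); last exact: closed_le.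
by move=> v _; exact: sqnorm_continuous.
Qed.

Lemma sphere_closed : closed (@sphere R n).
Proof.
apply: (@closed_comp _ _ (@sqnorm R n) [set x : R | x = 1]); last exact: closed_eq.
by move=> v _; exact: sqnorm_continuous.
Qed.

Lemma disc_coord (v : 'rV[R]_n) i : disc v -> `|v ord0 i| <= 1.
Proof.
move=> dv; rewrite -(@expr_le1 _ 2)// real_normK ?num_real//.
apply: le_trans dv; rewrite /sqnorm (bigD1 i)//= lerDl sumr_ge0// => j _.
exact: sqr_ge0.
Qed.

Lemma disc_compact : compact D.
Proof.
have cbox : compact [set v : 'rV[R]_n | forall i, `[(-1 : R), 1]%classic (v ord0 i)].
  by apply: (@rV_compact _ _ (fun=> `[(-1 : R), 1]%classic)) => _; exact: segment_compact.
apply: subclosed_compact disc_closed cbox _ => v dv i.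
by rewrite /= in_itv /= -ler_norml; exact: disc_coord.
Qed.

Lemma closed_prod (Z1 Z2 : topologicalType) (A : set Z1) (B : set Z2) :
  closed A -> closed B -> closed (A `*` B).
Proof.
move=> cA cB; rewrite (_ : A `*` B = fst @^-1` A `&` snd @^-1` B)//.
by apply: closedI; apply: closed_comp => // z _; [exact: cvg_fst | exact: cvg_snd].
Qed.

Lemma closed_time : closed T.
Proof. by apply: compact_closed => //; exact: Rhausdorff. Qed.

Lemma closed_boundary : closed S0.
Proof.
apply: closedU; first exact: closed_prod sphere_closed closed_time.
exact: closed_prod disc_closed cT0.
Qed.

Lemma phi_cwa z : (D `*` T) z -> cwa (D `*` T) (phi \o fst) z.
Proof.
move=> [Dz Tz]; apply: (@cwa_comp _ _ _ _ D fst phi).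
- by apply: cwa_continuous; exact: cvg_fst.
- by apply: near_withinW => y [].
- exact: charmap_cwa.
Qed.

Lemma chart_at v : D v -> exists a b (c : chart E a) (d : chart F b),
  [/\ chart_dom c (phi v), chart_dom d (phi v) &
      real -> real_chart c /\ real_chart d].
Proof.
move=> dv; have [r|nr] := boolP real.
  have [a [c [rc cv]]] := real_chart_exists E (realP r dv).
  have [b [d [rd dv']]] := real_chart_exists F (realP r dv).
  by exists a, b, c, d.
have [a [c cv]] := chart_exists E (phi v).
have [b [d dv']] := chart_exists F (phi v).
by exists a, b, c, d; split=> // r; rewrite r in nr.
Qed.

(** The neighbourhood [N] is chosen before [S] and [f], so that finitely many of them can be treated
    one after the other. *)
Lemma cell_step z0 : (D `*` T) z0 -> exists N : set Y,
  [/\ nbhs z0 N, closed N & forall S f, closed S -> S0 `<=` S ->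
    S `<=` D `*` T -> cell_ok S f -> exists2 f',
      cell_ok (S `|` (D `*` T `&` N)) f' &
      forall x t, ~ changed x t -> f' x t = f x t].
Proof.
move=> z0K; have [a [b [c [d [cz dz rcd]]]]] := chart_at z0K.1.
have nU : nbhs z0 [set z | (D `*` T) z ->
    chart_dom c (phi z.1) /\ chart_dom d (phi z.1)].
  have nc := cwa_open (phi_cwa z0K) (chart_open c) cz.
  have nd := cwa_open (phi_cwa z0K) (chart_open d) dz.
  suff : \forall z \near within (D `*` T) (nbhs z0),
    chart_dom c (phi z.1) /\ chart_dom d (phi z.1) by [].
  by apply: filterS2 nc nd => z cz' dz'; split.
(* Regularity shrinks the neighbourhood so that its closure still lies in the domains of both
   charts. *)
have [B nB BU] := @uniform_regular Y z0 _ nU.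
exists (closure B); split; [by apply: filterS nB; exact: subset_closure
  | exact: closed_closure |].
move=> S f cS S0S SK [fc fP fT]; set K := D `*` T `&` closure B.
have KU z : K z -> chart_dom c (phi z.1) /\ chart_dom d (phi z.1).
  by move=> [Kz /BU]; exact.
have cK : compact K.
  apply: compact_closedI; last exact: closed_closure.
  exact: compact_setX disc_compact cT.
have clK : closed K.
  apply: closedI; last exact: closed_closure.
  exact: closed_prod disc_closed closed_time.
pose G (z : Y) := hmx c d (f (phi z.1) z.2).
have [|||||G' [G'c G'G G'P G'r]] := LE rcd cK (closedI cS clK) _ _ (G := G).
- by move=> z [].
- by move=> z Kz; have [cz' dz'] := KU z Kz; case: Kz => -[].
- move=> z [Sz Kz]; have [cz' dz'] := KU z Kz.
  apply: (@cwa_sub _ _ S) => [y [] //|].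
  exact: (@fc z Sz a b c d cz' dz').
- move=> z [Sz Kz]; have [cz' dz'] := KU z Kz.
  by rewrite hmxK//; exact: fP.
- move=> r z [Sz Kz]; have [cz' dz'] := KU z Kz; have [rc rd] := rcd r.
  have Dz : D z.1 by case: Kz => -[].
  apply: (hmx_real (fun x => f x z.2) rc rd (realP r Dz) cz' dz').1.
  exact: fT.
(* New values are given only at points not yet treated; there [v] is determined by [x], as [charmap]
   is injective on the open disc. *)
pose Q x t v := [/\ open_disc v, phi v = x, K (v, t) & ~ S (v, t)].
pose f' x t := match pselect (exists v, Q x t v) with
  | left e => mxhom c d x (G' (projT1 (cid e), t))
  | right _ => f x t
  end.
have f'S z : S z -> f' (phi z.1) z.2 = f (phi z.1) z.2.
  case: z => v t Sz; rewrite /f'; case: pselect => //= -[w [ow wv Kw nSw]].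
  have [/= Dv Tt] := SK _ Sz.
  have [ov|nov] := pselect (open_disc v).
    by have [_ vw] := charmap_inj ow ov wv; case: nSw; rewrite vw.
  have sv : sphere v.
    by apply/eqP; rewrite eq_le Dv leNgt; apply/negP.
  have nsk : ~ skel CW n (phi w) by exact: charmap_open_disc.
  by exfalso; apply: nsk; rewrite wv; exact: charmap_sphere.
have f'K z : K z -> f' (phi z.1) z.2 = mxhom c d (phi z.1) (G' z).
  case: z => v t Kz; have [cz' dz'] := KU _ Kz.
  have [Sz|nSz] := pselect (S (v, t)).
    by rewrite f'S// G'G// /G hmxK.
  have [[/= Dv Tt] _] := Kz.
  have ov : open_disc v.
    rewrite /open_disc /= lt_neqAle Dv andbT; apply/eqP => sv.
    by apply: nSz; apply: S0S; left.
  rewrite /f'; case: pselect => [e|[]]; last by exists v.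
  have [ow wv _ _] := projT2 (cid e).
  by have [_ ->] := charmap_inj ow ov wv.
exists f'; last first.
  move=> x t nc; rewrite /f'; case: pselect => // -[v [ov vx Kv nSv]].
  by exfalso; apply: nc; exists v; split=> // /S0S.
have clSK : closed (S `|` K) by exact: closedU.
split.
- apply: (fcont_union cS clK).
    apply: (@fcont_eq R X E F Y (phi \o fst) (phi \o fst) snd S f f') fc.
      by [].
    by move=> z Sz; rewrite [RHS]f'S.
  apply: hcont_local => z Kz.
    by apply: cwa_sub (phi_cwa _) => [y []//|]; case: Kz.
  have [cz' dz'] := KU z Kz; exists a, b, c, d; split=> //.
  apply: cwa_near_eq (G'c z Kz) => //.
  apply: near_withinW => y Ky; have [cy dy] := KU y Ky.
  by rewrite f'K// mxhomK.
- by move=> z [Sz|Kz]; [rewrite f'S//; exact: fP | rewrite f'K//; exact: G'P].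
- move=> r z [Sz|Kz].
    have := fT r z Sz; have Dz : D z.1 by have [] := SK _ Sz.
    have e : f' (tau (phi z.1)) z.2 = f (tau (phi z.1)) z.2.
      by rewrite (realP r Dz); exact: f'S.
    by rewrite e f'S.
  have [cz' dz'] := KU z Kz; have [rc rd] := rcd r.
  have Dz : D z.1 by case: Kz => -[].
  apply: (hmx_real (fun x => f' x z.2) rc rd (realP r Dz) cz' dz').2.
  by rewrite f'K// mxhomK//; exact: G'r.
Qed.

Lemma cell_extend f : cell_ok S0 f -> exists2 f',
  cell_ok (D `*` T) f' & forall x t, ~ changed x t -> f' x t = f x t.
Proof.
move=> ok0.
have S0K : S0 `<=` D `*` T.
  move=> z [[sz Tz]|[dz Tz]]; split=> //; last exact: T0T.
  by rewrite /disc /= sz.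
pose N z := if pselect ((D `*` T) z) is left h then projT1 (cid (cell_step h)) else setT.
have NP z : (D `*` T) z -> [/\ nbhs z (N z), closed (N z) & forall S f, closed S ->
    S0 `<=` S -> S `<=` D `*` T -> cell_ok S f -> exists2 f',
      cell_ok (S `|` (D `*` T `&` N z)) f' &
      forall x t, ~ changed x t -> f' x t = f x t].
  by move=> Kz; rewrite /N; case: pselect => // h; exact: projT2 (cid (cell_step h)).
have cK : compact (D `*` T) by exact: compact_setX disc_compact cT.
have clK : closed (D `*` T) by exact: closed_prod disc_closed closed_time.
have [A AK KA] := compact_list_cover cK (fun z Kz =>
  let: And3 nN _ _ := NP z Kz in nN).
suff [f' [S [clS S0S SK [ok fu] AS]]] : exists f' S, [/\ closed S, S0 `<=` S,
    S `<=` D `*` T, cell_ok S f' /\ (forall x t, ~ changed x t -> f' x t = f x t)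
    & forall z, z \in A -> D `*` T `&` N z `<=` S].
  exists f' => //; rewrite (_ : D `*` T = S)//; apply/seteqP; split=> // z Kz.
  have [w wA Nz] := KA z Kz; exact: (AS w wA).
elim: A AK {KA} => [|z r IH] AK.
  exists f, S0; split=> //; exact: closed_boundary.
have [w wr|f1 [S [clS S0S SK [ok fu] AS]]] := IH.
  by apply: AK; rewrite inE wr orbT.
have [_ clN ext] := NP z (AK z (mem_head _ _)).
have [f2 ok2 fu2] := ext S f1 clS S0S SK ok.
exists f2, (S `|` (D `*` T `&` N z)); split=> //.
- by apply: closedU => //; exact: closedI.
- by move=> y /S0S; left.
- by move=> y [/SK//|[]].
- by split=> // x t nc; rewrite fu2// fu.
move=> w; rewrite inE => /orP[/eqP->|wr]; first by move=> y ?; right.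
by move=> y /(AS w wr); left.
Qed.

End OneCell.

(* The extension is chosen on the primary sheet of every cell; equivariance
   dictates it on the other one. *)
Definition primary (I J : Type) (s : sheet I J) : bool :=
  if s is inl (_, true) then false else true.
Definition fixed_sheet (I J : Type) (s : sheet I J) : bool :=
  if s is inr _ then true else false.

Hypothesis LE : forall n (s : sheet (free_cell CW n) (fixed_cell CW n)),
  primary s -> local_extension (fixed_sheet s) (charmap s).
Hypothesis P_Theta : forall x t (g : hom (fibre E x) (fibre F x)) g',
  Theta_rel g g' -> P t g -> P t g'.
Variable f0 : forall x : X, R -> hom (fibre E x) (fibre F x).
Hypotheses (f0c : fcont (Z := X * R)%type fst snd (setT `*` T0) f0)
  (f0P : forall x t, T0 t -> P t (f0 x t))
  (f0T : forall x t, T0 t -> Theta_rel (f0 x t) (f0 (tau x) t)).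

(** The last clause ranges over all of [X], so that the values prescribed on [T0] are available on
    cells still to be attached. *)
Definition stage n f :=
  [/\ fcont (Z := X * R)%type fst snd (skel CW n `*` T) f,
      forall x t, skel CW n x -> T t -> P t (f x t),
      forall x t, skel CW n x -> T t -> Theta_rel (f x t) (f (tau x) t) &
      forall x t, T0 t -> f x t = f0 x t].

Lemma stage_boundary n f (s : sheet (free_cell CW n) (fixed_cell CW n)) :
  stage n f -> cell_ok s (fixed_sheet s) (@sphere R n `*` T `|` @disc R n `*` T0) f.
Proof.
move=> [fc fP fT ff0].
have sd v : sphere v -> @disc R n v by move=> sv; rewrite /disc /= sv.
pose psi (z : 'rV[R]_n * R) : X * R := (charmap s z.1, z.2).
have psic (B : set 'rV[R]_n) (A : set R) : B `<=` @disc R n ->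
    forall z, (B `*` A) z -> cwa (B `*` A) psi z.
  move=> BD z [Bz Az]; apply: cwa_pair.
    apply: (@cwa_comp _ _ _ _ (@disc R n) fst (charmap s)).
    - by apply: cwa_continuous; exact: cvg_fst.
    - by apply: near_withinW => y [/BD].
    - by apply: charmap_cwa; exact: BD.
  by apply: cwa_continuous; exact: cvg_snd.
split.
- apply: fcont_union.
  + exact: closed_prod (@sphere_closed n) closed_time.
  + exact: closed_prod (@disc_closed n) cT0.
  + apply: (hcont_pull (phi := fst) (S := skel CW n `*` T) (psi := psi)
      (f := fun z => f z.1 z.2)) => //.
      exact: psic.
    by move=> z [sz Tz]; split=> //; exact: charmap_sphere.
  + apply: (@fcont_eq _ _ _ _ _ (charmap s \o fst) _ snd _ f0 f) => //.
      by move=> z [_ Tz]; rewrite ff0.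
    apply: (hcont_pull (phi := fst) (S := setT `*` T0) (psi := psi)
      (f := fun z => f0 z.1 z.2)) => //.
      exact: psic.
    by move=> z [_ Tz]; split.
- move=> z [[sz Tz]|[dz Tz]]; first by apply: fP => //; exact: charmap_sphere.
  by rewrite ff0//; exact: f0P.
- move=> r z [[sz Tz]|[dz Tz]]; first by apply: fT => //; exact: charmap_sphere.
  by rewrite !ff0//; exact: f0T.
Qed.

Lemma fixed_sheet_tau n (s : sheet (free_cell CW n) (fixed_cell CW n)) :
  fixed_sheet s -> forall v, disc v -> tau (charmap s v) = charmap s v.
Proof. by case: s => // c _ v dv; rewrite -charmap_equivariant. Qed.

Lemma stage_step n f : stage n f -> exists f', stage n.+1 f'.
Proof.
move=> st; have [fc fP fT ff0] := st.
have ext s : exists f', primary s -> cell_ok s (fixed_sheet s) (@disc R n `*` T) f' /\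
    (forall x t, ~ changed s x t -> f' x t = f x t).
  have [ps|nps] := boolP (primary s); last by exists f.
  have [f' ok fu] := cell_extend (@fixed_sheet_tau n s) (LE ps) (stage_boundary s st).
  by exists f'.
have {ext}[g gP] := choice ext.
pose cell := sheet (free_cell CW n) (fixed_cell CW n).
pose in_primary (x : X) (s : cell) := primary s /\ exists v, open_disc v /\ charmap s v = x.
(* The extensions over all primary cells together; disjointness of the open cells makes the choice
   of [s] unambiguous. *)
pose h (x : X) t := match pselect (exists s, in_primary x s) with
  | left e => g (projT1 (cid e)) x t
  | right _ => f x t
  end.
pose in_second (x : X) := exists c v, open_disc v /\ charmap (inl (c, true) : cell) v = x.
(* Over a second sheet, [tau x] lies in a primary cell and the value there is conjugated by
   [Theta]. *)
pose f' (x : X) t := match pselect (in_second x) with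
  | left e => projT1 (cid (Theta_rel_exists (h (tau x) t)))
  | right _ => h x t
  end.
have open_nskel (s : cell) v :
  open_disc v -> ~ skel CW n (charmap s v) by exact: charmap_open_disc.
have open_disc_disc (v : 'rV[R]_n) : open_disc v -> disc v by exact: ltW.
have f'skel x t : skel CW n x -> f' x t = f x t.
  move=> sx; rewrite /f'; case: pselect => [[c [v [ov vx]]]|_].
    by exfalso; have := open_nskel (inl (c, true)) v ov; rewrite vx.
  rewrite /h; case: pselect => // -[s [ps [v [ov vx]]]].
  by exfalso; have := open_nskel s v ov; rewrite vx.
have f'prim (s : cell) v t : primary s -> open_disc v ->
    f' (charmap s v) t = g s (charmap s v) t /\ h (charmap s v) t = g s (charmap s v) t.
  move=> ps ov.
  have hg : h (charmap s v) t = g s (charmap s v) t.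
    rewrite /h; case: pselect => [e|[]]; last by exists s; split=> //; exists v.
    have [_ [w [ow wv]]] := projT2 (cid e).
    by have [-> _] := charmap_inj ow ov wv.
  split=> //; rewrite /f'; case: pselect => // -[c [w [ow wv]]]; exfalso.
  by have [sc _] := charmap_inj ow ov wv; rewrite -sc in ps.
(* On the sphere both sides equal [f]: [g s] alters nothing on the lower skeleton. *)
have f'disc (s : cell) v t : primary s -> disc v -> f' (charmap s v) t = g s (charmap s v) t.
  move=> ps dv; have [ov|nov] := pselect (open_disc v).
    by have [] := f'prim s v t ps ov.
  have sv : sphere v.
    by apply/eqP; rewrite eq_le dv leNgt; apply/negP.
  have sk : skel CW n (charmap s v) by exact: charmap_sphere.
  rewrite f'skel//; have [_ ->//] := gP s ps.
  by move=> [w [ow wv _]]; have := open_nskel s w ow; rewrite wv.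
have f'second c v t : open_disc v ->
    Theta_rel (f' (charmap (inl (c, true) : cell) v) t)
              (f' (tau (charmap (inl (c, true) : cell) v)) t).
  move=> ov; set x := charmap _ v.
  have tx : tau x = charmap (inl (c, false) : cell) v.
    by rewrite -charmap_equivariant//; exact: open_disc_disc.
  have <- : h (tau x) t = f' (tau x) t.
    by rewrite tx; have [-> ->] := f'prim (inl (c, false)) v t isT ov.
  rewrite {1}/f'; case: pselect => [_|[]]; last by exists c, v.
  exact: projT2 (cid (Theta_rel_exists _)).
have f'first c v t : disc v -> T t ->
    Theta_rel (f' (charmap (inl (c, false) : cell) v) t)
              (f' (tau (charmap (inl (c, false) : cell) v)) t).
  move=> dv Tt; have [ov|nov] := pselect (open_disc v).
    have -> : charmap (inl (c, false) : cell) v = tau (charmap (inl (c, true)) v).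
      by rewrite -charmap_equivariant.
    by apply: (@Theta_rel_sym _ _ _ _ (fun x => f' x t)); exact: f'second.
  have sv : sphere v.
    by apply/eqP; rewrite eq_le dv leNgt; apply/negP.
  have sk : skel CW n (charmap (inl (c, false) : cell) v) by exact: charmap_sphere.
  rewrite !f'skel//; [exact: fT | exact: tau_skel].
have f'P (s : cell) v t : disc v -> T t -> P t (f' (charmap s v) t).
  move=> dv Tt; have [ps|] := boolP (primary s).
    by rewrite f'disc//; have [[_ gp _] _] := gP s ps; exact: (gp (v, t)).
  case: s => // -[c []] // _.
  have -> : charmap (inl (c, true) : cell) v = tau (charmap (inl (c, false)) v).
    by rewrite -charmap_equivariant.
  apply: P_Theta (f'first c v t dv Tt) _; rewrite f'disc//.
  have [[_ gp _] _] := gP (inl (c, false)) isT; exact: (gp (v, t)).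
exists f'; split.
- apply: (fcont_skelS cT).
    apply: (@fcont_eq R X E F (X * R)%type fst fst snd (skel CW n `*` T) f f') fc.
      by [].
    by move=> z [sz _]; rewrite [RHS]f'skel.
  move=> s; have [ps|] := boolP (primary s).
    have [[gc _ _] _] := gP s ps.
    apply: (@fcont_eq _ _ _ _ _ (charmap s \o fst) _ snd _ (g s) f') gc => //.
    by move=> z [dz _]; rewrite [RHS]f'disc.
  case: s => // -[c []] // _.
  (* The second sheet is the primary one followed by [tau], so continuity is transported by
     [hcont_conj]. *)
  pose s : cell := inl (c, false).
  apply: (@fcont_eq _ _ _ _ _ (tau \o (charmap s \o fst)) _ snd _ f' f') => //.
    by move=> z [dz _] /=; rewrite -charmap_equivariant.
  have [[gc _ _] _] := gP s isT.
  apply: (@hcont_conj _ _ E F _ (charmap s \o fst) _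
    (fun z => f' (charmap s z.1) z.2)).
  + exact: phi_cwa.
  + by move=> z [dz Tz]; exact: f'first.
  + apply: (@fcont_eq _ _ _ _ _ (charmap s \o fst) _ snd _ (g s) f') gc => //.
    by move=> z [dz _]; rewrite [RHS]f'disc.
- move=> x t sx Tt; have [nx|nx] := pselect (skel CW n x).
    by rewrite f'skel//; exact: fP.
  have [s [v [ov <-]]] := charmap_onto sx nx.
  by apply: f'P => //; exact: open_disc_disc.
- move=> x t sx Tt; have [nx|nx] := pselect (skel CW n x).
    rewrite !f'skel//; [exact: fT | exact: tau_skel].
  have [s [v [ov <-]]] := charmap_onto sx nx.
  have dv := open_disc_disc _ ov.
  case: s => [[c []]|c]; [exact: f'second | exact: f'first |].
  have [[_ _ /(_ isT (v, t) (conj dv Tt)) gT] _] := gP (inr c) isT.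
  have tx := @fixed_sheet_tau n (inr c) isT v dv.
  have -> : f' (tau (charmap (inr c) v)) t = g (inr c) (tau (charmap (inr c) v)) t.
    by rewrite tx f'disc.
  by rewrite f'disc.
- move=> x t T0t.
  (* At times in [T0] no extension alters [f]; conjugation over the second sheets returns [f0]
     because [f0] is equivariant. *)
  have hf0 y : h y t = f0 y t.
    rewrite /h; case: pselect => [e|_]; last exact: ff0.
    have [ps [v [ov vy]]] := projT2 (cid e).
    have [_ ->] := gP _ ps; first exact: ff0.
    move=> [w [ow wy]]; apply; right; split=> //; exact: open_disc_disc.
  rewrite /f'; case: pselect => [_|_]; last exact: hf0.
  apply: hom_ext => u; apply: Theta_inj.
  rewrite -(projT2 (cid (Theta_rel_exists (h (tau x) t)))) hf0.
  exact: f0T.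
Qed.

(** Stage 0 is vacuous, the skeleton being empty, so [f0] may be arbitrary off [T0]. Without cells
    of dimension [N] or more, stage [N] already covers [X] and no limit is taken. *)
Theorem cellular_extension N :
  (forall n, (N <= n)%N -> sheet (free_cell CW n) (fixed_cell CW n) -> False) ->
  exists f, [/\ fcont (Z := X * R)%type fst snd (setT `*` T) f,
    forall x t, T t -> P t (f x t),
    forall x t, T t -> Theta_rel (f x t) (f (tau x) t) &
    forall x t, T0 t -> f x t = f0 x t].
Proof.
move=> /skel_eventually_full full.
have [f [fc fP fT ff0]] : exists f, stage N f.
  elim: N {full} => [|n [f /stage_step]]; last exact.
  exists f0; split=> //; by rewrite skel0 => // z [].
exists f; split=> //.
- by apply: fcont_sub fc => z [_ Tz]; split.
- by move=> x t; exact: fP.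
- by move=> x t; exact: fT.
Qed.

End CellExtension.

(** * Generic translates and Lipschitz approximation *)

Section Covering.
Variable R : realType.

(* box dimension at most [p] *)
Definition covered (Y : normedModType R) (K : set Y) (p : nat) :=
  exists C : nat, forall N : nat, (0 < N)%N -> exists s : seq Y,
    (size s <= C * N ^ p)%N /\
    forall y, K y -> exists2 z, z \in s & `|y - z| <= N%:R^-1.

Lemma covered_sub (Y : normedModType R) (K K' : set Y) p :
  K' `<=` K -> covered K p -> covered K' p.
Proof.
move=> KK [C h]; exists C => N N0; have [s [sC sK]] := h N N0.
by exists s; split=> // y /KK; exact: sK.
Qed.

Lemma covered_prod (Y Z : normedModType R) (K : set Y) (K' : set Z) p q :
  covered K p -> covered K' q -> covered (K `*` K') (p + q).
Proof.
move=> [C h] [C' h']; exists (C * C')%N => N N0.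
have [s [sC sK]] := h N N0; have [s' [sC' sK']] := h' N N0.
exists [seq (x, y) | x <- s, y <- s']; split.
  by rewrite size_allpairs expnD mulnACA leq_mul.
move=> [y z] [/= Ky Kz].
have [y' y's yy'] := sK y Ky; have [z' z's zz'] := sK' z Kz.
exists (y', z'); first by apply/allpairsP; exists (y', z').
by rewrite /= [leLHS]prod_normE /= ge_max yy' zz'.
Qed.

Lemma covered_point (Y : normedModType R) (y : Y) : covered [set y] 0.
Proof.
exists 1%N => N N0; exists [:: y]; split=> // _ ->; exists y.
  exact: mem_head.
by rewrite subrr normr0 invr_ge0.
Qed.

(** A point of the lattice of mesh [1 / N], coded by its numerators counted from [- B]; the range
    from [- B] to [B] takes [2 * B * N + 1] codes. *)
Definition grid (I : Type) (B N : nat) k (e : I -> 'I_k) (i : I) : R :=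
  (e i)%:R / N%:R - B%:R.

Lemma near_grid (I : finType) (B N : nat) (c : I -> R) : (0 < N)%N ->
  (forall i, `|c i| <= B%:R) -> exists e : {ffun I -> 'I_(2 * B * N).+1},
    forall i, `|c i - grid B N e i| <= N%:R^-1.
Proof.
move=> N0 cB; have N0' : 0 < N%:R :> R by rewrite ltr0n.
have c0 i : 0 <= (c i + B%:R) * N%:R.
  by have := cB i; rewrite ler_norml -subr_ge0 opprK => /andP[? _]; rewrite mulr_ge0.
have lt i : (Num.truncn ((c i + B%:R) * N%:R) < (2 * B * N).+1)%N.
  rewrite truncn_lt_nat//; apply: (@le_lt_trans _ _ ((2 * B * N)%N%:R)).
    rewrite natrM ler_pM2r// mul2n -addnn natrD lerD2r.
    by apply: le_trans (cB i); exact: ler_norm.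
  by rewrite ltr_nat.
exists [ffun i => Ordinal (lt i)] => i; rewrite /grid ffunE /=.
have /andP[h1 h2] := truncn_itv (c0 i).
have -> : c i - ((Num.truncn ((c i + B%:R) * N%:R))%:R / N%:R - B%:R)
    = ((c i + B%:R) * N%:R - (Num.truncn ((c i + B%:R) * N%:R))%:R) / N%:R.
  by rewrite mulrBl mulfK ?gt_eqF// opprB addrA addrAC.
rewrite normrM (ger0_norm (x := N%:R^-1)) ?invr_ge0//.
rewrite -[leRHS]mul1r ler_pM2r ?invr_gt0// ger0_norm ?subr_ge0//.
by rewrite lerBlDl -natr1 in h2 *; exact: ltW.
Qed.

Lemma covered_box n : @covered 'rV[R]_n [set v | forall i, `|v ord0 i| <= 1] n.
Proof.
(* Each coordinate takes [2 * N + 1] values, at most [3 * N]. *)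
exists (3 ^ n)%N => N N0.
exists [seq (\row_i grid 1 N e i : 'rV[R]_n) | e : {ffun 'I_n -> 'I_(2 * 1 * N).+1}].
split.
  rewrite size_map -cardE card_ffun !card_ord -expnMn.
  by case: n => [|n]; rewrite ?expn0// leq_exp2r//; lia.
move=> v v1; have [e ve] := near_grid (B := 1) N0 v1.
exists (\row_i grid 1 N e i); first by apply/mapP; exists e => //; rewrite mem_enum.
rewrite [leLHS]/Num.norm /= mx_normrE; apply/bigmax_leP; split; first by rewrite invr_ge0.
by move=> [i j] _ /=; rewrite !mxE ord1.
Qed.

(* If all points of a grid of mesh [eps / M] were bad, rounding [y] and [c] to
   a mesh [1 / N] with [N] proportional to [M] would inject the [M ^ #|I|] grid
   points into [O(N ^ (p + #|I'|))] data. *)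
Lemma generic_translate (Y : normedModType R) (K : set Y) p (I I' J : finType)
    (g : Y -> I -> R) (beta : J -> (I' -> R) -> I -> R) (B L L' : nat) (eps : R) :
  covered K p -> (p + #|I'| < #|I|)%N -> 0 < eps ->
  (forall y y' i, `|g y i - g y' i| <= L%:R * `|y - y'|) ->
  (forall j c c' e, 0 <= e -> (forall i, `|c i| <= B%:R) -> (forall i, `|c' i| <= B%:R) ->
    (forall i, `|c i - c' i| <= e) ->
    forall i, `|beta j c i - beta j c' i| <= L'%:R * e) ->
  exists q : I -> R, (forall i, 0 <= q i <= eps) /\
    forall y, K y -> forall j c, (forall i, `|c i| <= B%:R) ->
      ~ (forall i, g y i - q i = beta j c i).
Proof.
move=> [C covK] lt e0 gL bL.
(* [A] makes the total rounding error [2 * (L + L') / (A * M)] smaller than the mesh [eps / M], so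
   equal codes force equal grid points. There are at most [D * M ^ (p + #|I'|)] codes, fewer than
   [M ^ #|I|] once [M] exceeds [D]. *)
pose A : nat := (Num.truncn (2 * (L + L')%:R / eps)).+1.
have eA : 2 * (L + L')%:R < eps * A%:R.
  by rewrite [ltRHS]mulrC -ltr_pdivrMr//; exact: truncnS_gt.
pose D := (C * #|J| * (2 * B + 1) ^ #|I'| * A ^ (p + #|I'|))%N.
pose M := D.+1; pose N := (A * M)%N.
have M0 : 0 < M%:R :> R by rewrite ltr0n.
have N0 : (0 < N)%N by rewrite muln_gt0.
have N0' : 0 < N%:R :> R by rewrite ltr0n.
have [s [sC sK]] := covK N N0.
apply/not_notP => /forallNP bad.
pose q (G : {ffun I -> 'I_M}) i : R := eps * (G i)%:R / M%:R.
have code (G : {ffun I -> 'I_M}) : exists w : 'I_(size s) * J * {ffun I' -> 'I_(2 * B * N).+1},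
    exists y c, [/\ `|y - s`_(w.1.1)| <= N%:R^-1, (forall i, `|c i| <= B%:R),
      (forall i, `|c i - grid B N w.2 i| <= N%:R^-1) &
      forall i, g y i - q G i = beta w.1.2 c i].
  have /not_andP[[]|] := bad (q G).
    move=> i; rewrite /q !mulr_ge0//= ?invr_ge0//; last exact: ltW.
    rewrite ler_pdivrMr// ler_pM2l// ler_nat; exact: ltnW.
  move=> /existsNP[y /not_implyP[Ky /existsNP[j /existsNP[c /not_implyP[cB /contrapT gq]]]]].
  have [z zs yz] := sK y Ky.
  have [e ce] := near_grid N0 cB.
  have ltz : (index z s < size s)%N by rewrite index_mem.
  by exists (Ordinal ltz, j, e), y, c; rewrite /= nth_index.
have [w wP] := choice code.
have winj : injective w.
  move=> G G' GG'; apply/ffunP => i; apply/val_inj => /=.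
  have [y [c [ys cB cg gq]]] := wP G; have [y' [c' [y's c'B c'g gq']]] := wP G'.
  rewrite -GG' in y's c'g gq'.
  have yy' : `|y - y'| <= 2 * N%:R^-1.
    rewrite -(subrKA s`_(w G).1.1) mulr2n mulrDl mul1r.
    by apply: le_trans (ler_normD _ _) _; rewrite lerD// distrC.
  have cc' k : `|c k - c' k| <= 2 * N%:R^-1.
    rewrite -(subrKA (grid B N (w G).2 k)) mulr2n mulrDl mul1r.
    by apply: le_trans (ler_normD _ _) _; rewrite lerD// distrC.
  have h1 := gL y y' i; have N2 : 0 <= 2 * N%:R^-1 :> R by rewrite mulr_ge0.
  have h2 := bL (w G).1.2 _ _ _ N2 cB c'B cc' i.
  have h3 : `|q G i - q G' i| < eps / M%:R.
    have -> : q G i - q G' i = (g y i - g y' i)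
        - (beta (w G).1.2 c i - beta (w G).1.2 c' i).
      by rewrite -gq -gq'; lra.
    apply: le_lt_trans (ler_normB _ _) _.
    apply: (@le_lt_trans _ _ (2 * (L + L')%:R / N%:R)).
      apply: le_trans (lerD h1 h2) _.
      have -> : 2 * (L + L')%:R / N%:R = L%:R * (2 * N%:R^-1) + L'%:R * (2 * N%:R^-1) :> R.
        by rewrite natrD; ring.
      by rewrite lerD2r ler_wpM2l.
    rewrite /N natrM invfM mulrA ltr_pM2r ?invr_gt0//.
    by rewrite ltr_pdivrMr ?ltr0n.
  have h4 : `|(G i)%:R - (G' i)%:R| < 1 :> R.
    have -> : (G i)%:R - (G' i)%:R = (q G i - q G' i) * (M%:R / eps) :> R.
      by rewrite /q; field; rewrite !gt_eqF.
    rewrite normrM (ger0_norm (x := M%:R / eps)).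
      by rewrite -ltr_pdivlMr ?divr_gt0// mul1r invf_div.
    by rewrite divr_ge0// ltW.
  move: h4; rewrite ltr_norml => /andP[h5 h6].
  suff [h7 h8] : (G i < (G' i).+1)%N /\ (G' i < (G i).+1)%N.
    by apply/eqP; rewrite eqn_leq -ltnS h7 -ltnS h8.
  rewrite -!(ltr_nat R) -!natr1; split.
    by rewrite addrC -ltrBlDr.
  by rewrite -ltrBlDr addrC -ltrBrDr.
have := leq_card w winj; rewrite card_ffun !card_prod card_ffun !card_ord.
apply/negP; rewrite -ltnNge.
have h : (size s * #|J| * (2 * B * N).+1 ^ #|I'| <= D * M ^ (p + #|I'|))%N.
  apply: (@leq_trans (C * N ^ p * #|J| * ((2 * B + 1) * N) ^ #|I'|)).
    apply: leq_mul; first exact: leq_mul.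
    have [->|I'0] := posnP #|I'|; first by rewrite !expn0.
    by rewrite leq_exp2r//; lia.
  have e m r j : (C * (A * m) ^ p * j * ((2 * B + 1) * (A * m)) ^ r
      = C * j * (2 * B + 1) ^ r * A ^ (p + r) * m ^ (p + r))%N.
    by rewrite !expnMn !expnD; ring.
  by rewrite e.
apply: leq_ltn_trans h _.
apply: (@leq_trans (M * M ^ (p + #|I'|))).
  by rewrite ltn_pmul2r// expn_gt0.
by rewrite -expnS leq_pexp2l.
Qed.

End Covering.

(** * Extension and Lipschitz approximation of real functions on compact sets *)

Section RealExtension.
Variables (R : realType) (Y : normedModType R).

Lemma tietze_compact (S : set Y) (f : Y -> R) : compact S ->
  (forall z, S z -> cwa S f z) ->
  exists2 g : Y -> R, continuous g & forall z, S z -> g z = f z.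
Proof.
move=> cS fc; have cf : {within S, continuous f} by apply/cwa_withinP.
have clS : closed S by apply: compact_closed => //; exact: norm_hausdorff.
have [M [Mr Mf]] : bounded_set (f @` S).
  by apply: compact_bounded; exact: continuous_compact.
have M0 : 0 < `|M| + 1 by rewrite ltr_wpDl.
have [|g [gf gc _]] := continuous_bounded_extension (@pseudometric_normal R Y) clS M0 cf.
- move=> x Sx; apply: Mf; last by exists x.
  by rewrite (le_lt_trans (ler_norm M))// ltrDl.
- by exists g => // z Sz; rewrite gf ?inE.
Qed.

Lemma compact_uniform (K : set Y) (f : Y -> R) (e : R) : compact K -> 0 < e ->
  (forall z, K z -> cwa K f z) -> exists2 d : R, 0 < d &
    forall y z, K y -> K z -> `|y - z| < d -> `|f y - f z| <= e.
Proof.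
move=> cK e0 fc.
have dP : \forall d \near 0^'+, K `<=` (fun y => K y ->
    forall z, K z -> `|y - z| < d -> `|f y - f z| <= e).
  apply: (proj1 (compact_near_coveringP K) cK R 0^'+ (fun d y => K y ->
    forall z, K z -> `|y - z| < d -> `|f y - f z| <= e)) => x Kx.
  have e2 : 0 < e / 2 by rewrite divr_gt0.
  have : \forall z \near x, K z -> `|f x - f z| < e / 2.
    have := fc x Kx; move=> /cvgrPdist_lt /(_ _ e2); exact.
  move=> /nbhs_ballP[r /= r0 rP].
  have r2 : 0 < r / 2 by rewrite divr_gt0.
  exists (ball x (r / 2), [set d | d < r / 2]).
    by split=> /=; [exact: nbhsx_ballx | exact: nbhs_right_lt].
  move=> [y d] /= [xy dr] Ky z Kz yz.
  have hy : `|f x - f y| < e / 2.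
    by apply: rP => //; apply: le_ball xy; rewrite ler_pdivrMr// ler_peMr ?ltW// ltr1n.
  have hz : `|f x - f z| < e / 2.
    apply: rP => //; rewrite -ball_normE /= -(subrKA y) (splitr r).
    apply: le_lt_trans (ler_normD _ _) _; apply: ltrD.
      by move: xy; rewrite -ball_normE.
    exact: lt_trans yz dr.
  rewrite -(subrKA (f x)) (splitr e); apply: le_trans (ler_normD _ _) _.
  by rewrite lerD// ltW// distrC.
have [d [dP' d0]] := filter_ex (filterI dP (nbhs_right_gt (0 : R))).
by exists d => // y z Ky; exact: dP'.
Qed.

Lemma lipschitz_approximation (K : set Y) (f : Y -> R) (e : R) :
  compact K -> 0 < e -> (forall z, K z -> cwa K f z) ->
  exists (g : Y -> R) (L : nat), (forall y y', `|g y - g y'| <= L%:R * `|y - y'|) /\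
    forall y, K y -> `|g y - f y| <= e.
Proof.
move=> cK e0 fc.
have [K0|/set0P[y0 Ky0]] := eqVneq K set0.
  exists (fun=> 0), 0%N; split=> [y y'|y]; last by rewrite K0.
  by rewrite subrr normr0 mul0r.
have cf : {within K, continuous f} by apply/cwa_withinP.
have [M [M0 fM]] : exists M, 0 <= M /\ forall y, K y -> `|f y| <= M.
  have [M [Mr Mf]] : bounded_set (f @` K).
    by apply: compact_bounded; exact: continuous_compact.
  exists (`|M| + 1); split=> [|y Ky]; first by rewrite addr_ge0.
  apply: Mf; last by exists y.
  by rewrite (le_lt_trans (ler_norm M))// ltrDl.
have [d d0 fd] := compact_uniform cK e0 fc.
(* At distance at least [d] the penalty exceeds the oscillation [2 * M] of [f], so only points
   closer than [d] can lower the infimum by more than [e]. *)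
pose L := (Num.truncn (2 * M / d)).+1.
have Ld : 2 * M <= L%:R * d.
  by rewrite -ler_pdivrMr// ltW// truncnS_gt.
(* the infimal convolution of [f] with [L |.|] *)
pose A y := [set f z + L%:R * `|y - z| | z in K].
have A0 y : A y !=set0 by exists (f y0 + L%:R * `|y - y0|); exists y0.
have lbA y : has_lbound (A y).
  exists (- M) => _ [z Kz <-]; have := fM z Kz; rewrite ler_norml => /andP[h _].
  by rewrite (le_trans h)// lerDl mulr_ge0.
have step y y' : inf (A y) <= inf (A y') + L%:R * `|y - y'|.
  rewrite -lerBlDr; apply: lb_le_inf => // _ [z Kz <-]; rewrite lerBlDr.
  apply: (@le_trans _ _ (f z + L%:R * `|y - z|)); first by apply: ge_inf => //; exists z.
  rewrite -addrA lerD2l -mulrDr ler_wpM2l// [leRHS]addrC.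
  exact: ler_distD.
exists (fun y => inf (A y)), L; split=> [y y'|y Ky].
  have h1 := step y y'; have h2 := step y' y; rewrite distrC in h2.
  by rewrite ler_norml; apply/andP; split; lra.
rewrite ler_norml; apply/andP; split; last first.
  rewrite lerBlDr; apply: (@le_trans _ _ (f y)); last by rewrite lerDr ltW.
  by apply: ge_inf => //=; exists y => //; rewrite subrr normr0 mulr0 addr0.
rewrite lerBrDl; apply: lb_le_inf => // _ [z Kz <-].
have [yz|yz] := ltP `|y - z| d.
  have := fd y z Ky Kz yz; rewrite ler_norml => /andP[_ h].
  have : 0 <= L%:R * `|y - z| by rewrite mulr_ge0.
  lra.
have h1 : L%:R * d <= L%:R * `|y - z| by rewrite ler_wpM2l.
have := fM y Ky; have := fM z Kz; rewrite !ler_norml => /andP[h2 _] /andP[_ h3].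
lra.
Qed.

Lemma lipschitz_continuous (g : Y -> R) (L : nat) :
  (forall y y', `|g y - g y'| <= L%:R * `|y - y'|) -> continuous g.
Proof.
move=> gL y; apply/cvgrPdist_lt => e e0.
have d0 : 0 < e / L.+1%:R by rewrite divr_gt0.
have : \forall z \near y, `|y - z| < e / L.+1%:R.
  have /cvgrPdist_lt := @cvg_id _ (nbhs y); exact.
apply: filterS => z yz; apply: le_lt_trans (gL _ _) _.
apply: (@le_lt_trans _ _ (L.+1%:R * `|y - z|)).
  by rewrite ler_wpM2r// ler_nat.
by rewrite mulrC -ltr_pdivlMr.
Qed.

Lemma urysohn_compact (S Z : set Y) : compact S -> compact Z -> S `&` Z = set0 ->
  exists l : Y -> R, [/\ continuous l, forall y, S y -> l y = 1,
    forall y, Z y -> l y = 0 & forall y, 0 <= l y <= 1].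
Proof.
move=> cS cZ SZ.
have clS : closed S by apply: compact_closed => //; exact: norm_hausdorff.
have clZ : closed Z by apply: compact_closed => //; exact: norm_hausdorff.
pose f y : R := if pselect (S y) then 1 else 0.
have fS y : S y -> f y = 1 by rewrite /f; case: pselect.
have fZ y : Z y -> f y = 0.
  rewrite /f; case: pselect => // Sy Zy.
  by have : (S `&` Z) y by []; rewrite SZ.
have [y|l lc lf] := @tietze_compact (S `|` Z) f (compactU cS cZ).
  move=> _; apply: cwa_union => // hy.
    apply: (@cwa_near_eq Y R S (fun=> 1)) => //; last exact: cwa_cst.
    by apply: near_withinW => z /fS ->.
  apply: (@cwa_near_eq Y R Z (fun=> 0)) => //; last exact: cwa_cst.
  by apply: near_withinW => z /fZ ->.
pose l' y := Num.max 0 (Num.min 1 (l y)).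
exists l'; split=> [y|y Sy|y Zy|y].
- suff : {for y, continuous ((fun _ : Y => 0 : R^o) \max
      ((fun _ : Y => 1 : R^o) \min (l : Y -> R^o)))} by [].
  apply: continuous_max; first exact: cvg_cst.
  by apply: continuous_min; [exact: cvg_cst | exact: lc].
- rewrite /l' lf; last by left.
  by rewrite fS// minxx; apply/max_idPr.
- rewrite /l' lf; last by right.
  by rewrite fZ// (min_idPr _)// maxxx.
- by rewrite /l' le_max lexx /= ge_max ler01 ge_min lexx.
Qed.

End RealExtension.

(** * Extending families of injective matrices *)

Section Coordinates.
Variable R : realType.
Local Notation C := (R[i]%C).
Local Notation re := complex.Re.
Local Notation im := complex.Im.

(* Real and complex matrices are treated together: [k] is the dimension over
   the reals of the field, and a real number is a complex one whose only
   coordinate is that of index [l = 0]. *)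
Definition coord (z : C) (l : nat) : R := if l is 0 then re z else im z.

Definition combine k (u : 'I_k -> R) : C := \sum_(l < k) (u l)%:C%C * 'i%C ^+ l.

Definition in_field (k : nat) (z : C) := (k <= 1)%N -> im z = 0.

Lemma in_fieldN k z : in_field k z -> in_field k (- z).
Proof. by move=> hz k1; rewrite raddfN /= hz// oppr0. Qed.

Lemma im_mul (z w : C) : im (z * w) = re z * im w + im z * re w.
Proof. by case: z w => a b [c d]. Qed.

Lemma re_mul (z w : C) : re (z * w) = re z * re w - im z * im w.
Proof. by case: z w => a b [c d]. Qed.

Lemma in_fieldM k z w : in_field k z -> in_field k w -> in_field k (z * w).
Proof. by move=> hz hw k1; rewrite im_mul hz// hw// mulr0 mul0r addr0. Qed.

Lemma in_fieldV k z : in_field k z -> in_field k z^-1.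
Proof. by case: z => a b h k1; have /= -> := h k1; rewrite mul0r oppr0. Qed.

Lemma in_field1P (z : C) : in_field 1 z <-> z^* = z.
Proof.
case: z => a b; split=> [/(_ isT)/= -> |].
  by rewrite -[Num.conj _]/(conjc _) /= oppr0.
rewrite -[Num.conj _]/(conjc _) /= => -[bb] _ /=.
by apply/eqP; rewrite -eqNr bb.
Qed.

Section CoordDim.
Variable k : nat.
Hypothesis k0 : (0 < k <= 2)%N.

Lemma in_field_combine (u : 'I_k -> R) : in_field k (combine u).
Proof.
case: k k0 u => [|[|m]]// _ u _.
by rewrite /combine big_ord1 expr0 mulr1.
Qed.

Lemma coord_combine (u : 'I_k -> R) (l : 'I_k) : coord (combine u) l = u l.
Proof.
case: k k0 u l => [|[|[|m]]]// _ u l; rewrite /combine.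
  by rewrite big_ord1 expr0 mulr1 (ord1 l).
rewrite big_ord_recl big_ord1 expr0 expr1 mulr1.
have -> : lift ord0 ord0 = 1 :> 'I_2 by exact/val_inj.
case: l => -[|[|l]]//= hl; rewrite ?mulr0 ?mulr1 ?mul0r ?subr0 ?addr0 ?add0r;
  by congr u; exact/val_inj.
Qed.

Lemma combine_coord z : in_field k z -> combine (fun l : 'I_k => coord z l) = z.
Proof.
case: k k0 => [|[|[|m]]]// _ hz; rewrite /combine.
  by rewrite big_ord1 expr0 mulr1 /= [RHS]complexE hz// mulr0 addr0.
by rewrite big_ord_recl big_ord1 expr0 expr1 mulr1 [RHS]complexE mulrC /=.
Qed.

End CoordDim.

(** A submultiplicative norm with values in [R], whereas the norm of [R[i]] takes its values in
    [R[i]]. *)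
Definition norm1 (z : C) : R := `|re z| + `|im z|.

Lemma norm1D z w : norm1 (z + w) <= norm1 z + norm1 w.
Proof.
rewrite /norm1 !raddfD /= addrACA.
by rewrite lerD// ler_normD.
Qed.

Lemma norm1_ge0 z : 0 <= norm1 z. Proof. by rewrite addr_ge0. Qed.

Lemma norm1M z w : norm1 (z * w) <= norm1 z * norm1 w.
Proof.
rewrite /norm1 re_mul im_mul.
apply: le_trans (lerD (ler_normB _ _) (ler_normD _ _)) _; rewrite !normrM.
by rewrite le_eqVlt; apply/orP; left; apply/eqP; ring.
Qed.

Lemma norm1_sum (I : Type) (r : seq I) (P : pred I) (f : I -> C) :
  norm1 (\sum_(i <- r | P i) f i) <= \sum_(i <- r | P i) norm1 (f i).
Proof.
elim/big_rec2: _ => [|i x y _ h]; first by rewrite /norm1 /= !normr0 addr0.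
by apply: le_trans (norm1D _ _) _; rewrite lerD2l.
Qed.

Lemma coord_le_norm1 z l : `|coord z l| <= norm1 z.
Proof. by case: l => [|l]; rewrite /norm1 ?lerDl ?lerDr. Qed.

Lemma combineB k (u v : 'I_k -> R) : combine u - combine v = combine (fun l => u l - v l).
Proof.
rewrite /combine -sumrB; apply: eq_bigr => l _.
by rewrite -mulrBl -rmorphB.
Qed.

Lemma norm1_combine k (u : 'I_k -> R) e : (0 < k <= 2)%N ->
  (forall l, `|u l| <= e) -> norm1 (combine u) <= 2 * e.
Proof.
case: k u => [|[|[|m]]]// u _ ue; rewrite /norm1.
  rewrite /combine big_ord1 expr0 mulr1 /= normr0 addr0.
  have := ue ord0; have := normr_ge0 (u ord0); lra.
have h0 := @coord_combine 2 isT u ord0.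
have h1 := @coord_combine 2 isT u (Ordinal (isT : 1 < 2)%N).
by move: h0 h1 => /= -> ->; rewrite mulrDl mul1r lerD.
Qed.

Lemma cvg_combine (T : Type) (F : set_system T) k (u : T -> 'I_k -> R) (a : 'I_k -> R) :
  Filter F -> (forall l, (fun t => u t l) @ F --> a l) ->
  (fun t => combine (u t) : C^o) @ F --> (combine a : C^o).
Proof.
move=> FF ua; apply: cvg_sumK => l _; apply: cvgM; last exact: cvg_cst.
by apply/cvg_complexP; split; [exact: ua | exact: cvg_cst].
Qed.

Lemma cvg_coord (T : Type) (F : set_system T) (f : T -> C^o) (a : C^o) l :
  Filter F -> f @ F --> a -> (fun t => coord (f t) l) @ F --> coord a l.
Proof. by move=> FF /cvg_complexP[fr fi]; case: l. Qed.

Definition mx_of_coords a b k (q : 'I_a * 'I_b * 'I_k -> R) : 'M[C^o]_(a, b) :=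
  \matrix_(i, j) combine (fun l => q (i, j, l)).

Section DependentRows.
Variables (m b k : nat).
Hypothesis k0 : (0 < k <= 2)%N.

(* Row [j] is the combination, with the coefficients stored in the left
   summand, of the other rows, stored in the right summand. *)
Definition dependent_mx (j : 'I_m.+1)
    (c : 'I_m * 'I_k + 'I_m * 'I_b * 'I_k -> R) : 'M[C^o]_(m.+1, b) :=
  \matrix_(i, jj) if unlift j i is Some h
    then combine (fun l => c (inr (h, jj, l)))
    else \sum_h combine (fun l => c (inl (h, l)))
           * combine (fun l => c (inr (h, jj, l))).

Definition dependent_coords j c (i : 'I_m.+1 * 'I_b * 'I_k) : R :=
  coord (dependent_mx j c i.1.1 i.1.2) i.2.

(** Products are Lipschitz on bounded data only, hence [B]. As [norm1] is at most twice a bound on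
    the coordinates, each of the [m] products varies by at most [2 * e * (2 * B) + 2 * B * (2 * e)],
    and a copied entry by [2 * e]. *)
Lemma dependent_coords_lipschitz (B : nat) j c c' e : 0 <= e ->
  (forall i, `|c i| <= B%:R) -> (forall i, `|c' i| <= B%:R) ->
  (forall i, `|c i - c' i| <= e) ->
  forall i, `|dependent_coords j c i - dependent_coords j c' i|
    <= (8 * m * B + 2)%:R * e.
Proof.
move=> e0 cB c'B cc' i; rewrite /dependent_coords.
have coordB z w l : coord z l - coord w l = coord (z - w) l.
  by case: l => [|l]; rewrite /= raddfB.
rewrite coordB; apply: le_trans (coord_le_norm1 _ _) _; rewrite !mxE.
have B0 : 0 <= B%:R :> R by [].
have mBe : 0 <= m%:R * B%:R * e by rewrite !mulr_ge0.
case: unliftP => [h|] _.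
  rewrite combineB; apply: le_trans (norm1_combine k0 (fun l => cc' _)) _.
  by rewrite natrD !natrM mulrDl; lra.
rewrite -sumrB; apply: le_trans (norm1_sum _ _ _) _.
apply: (@le_trans _ _ (\sum_(h < m) 8 * B%:R * e)); last first.
  by rewrite sumr_const card_ord -[_ *+ m]mulr_natl natrD !natrM; lra.
apply: ler_sum => h _.
set z := combine _; set w := combine _; set z' := combine _; set w' := combine _.
have -> : z * w - z' * w' = (z - z') * w + z' * (w - w') by ring.
apply: le_trans (norm1D _ _) _.
have zz : norm1 (z - z') <= 2 * e by rewrite combineB; exact: norm1_combine.
have ww : norm1 (w - w') <= 2 * e by rewrite combineB; exact: norm1_combine.
have wB : norm1 w <= 2 * B%:R by exact: norm1_combine.
have z'B : norm1 z' <= 2 * B%:R by exact: norm1_combine.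
apply: (@le_trans _ _ (2 * e * (2 * B%:R) + 2 * B%:R * (2 * e))); last first.
  by rewrite le_eqVlt; apply/orP; left; apply/eqP; ring.
apply: lerD; apply: le_trans (norm1M _ _) _; apply: ler_pM => //; exact: norm1_ge0.
Qed.

Lemma normc_coord (z : C) l : `|coord z l| <= re `|z|.
Proof.
rewrite -lecR RRe_real ?normr_real//.
by case: l => [|l] /=; [exact: normc_ge_Re | exact: normc_ge_Im].
Qed.

Lemma dependent_mxP (A : 'M[C^o]_(m.+1, b)) (B : nat) :
  (forall i j, in_field k (A i j)) -> ~~ row_free A -> (0 < B)%N ->
  (forall i j l, `|coord (A i j) l| <= B%:R) ->
  exists j c, (forall i, `|c i| <= B%:R) /\ A = dependent_mx j c.
Proof.
move=> Ak nf B0 AB.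
have [v [vk v0 vA]] : exists v : 'rV[C^o]_m.+1,
    [/\ forall i, in_field k (v 0 i), v != 0 & v *m A = 0].
  have [v vA v0] : exists2 v : 'rV[C^o]_m.+1, v *m A = 0 & v != 0.
    move: nf; rewrite -kermx_eq0 => /rowV0Pn[v /sub_kermxP vA v0].
    by exists v.
  (* For a real matrix the real and imaginary parts of a kernel vector are kernel vectors too, and
     one of them is nonzero. *)
  have [k1|k1] := leqP k 1; last first.
    by exists v; split=> // i; rewrite /in_field leqNgt k1.
  have A1 i j : im (A i j) = 0 by exact: Ak.
  have vre : (\row_i (re (v 0 i))%:C%C : 'rV[C^o]_m.+1) *m A = 0.
    apply/rowP => j; have /rowP/(_ j) := vA; rewrite !mxE => h.
    apply/eqP; rewrite eq_complex; apply/andP; split; apply/eqP.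
      rewrite -[RHS](congr1 (@complex.Re R) h) !raddf_sum; apply: eq_bigr => i _.
      by rewrite !mxE /= !re_mul A1 !mulr0.
    rewrite raddf_sum big1// => i _.
    by rewrite !mxE /= im_mul A1 mulr0 mul0r addr0.
  have vim : (\row_i (im (v 0 i))%:C%C : 'rV[C^o]_m.+1) *m A = 0.
    apply/rowP => j; have /rowP/(_ j) := vA; rewrite !mxE => h.
    apply/eqP; rewrite eq_complex; apply/andP; split; apply/eqP.
      rewrite -[RHS](congr1 (@complex.Im R) h) !raddf_sum; apply: eq_bigr => i _.
      by rewrite !mxE /= re_mul im_mul A1 !mulr0 add0r subr0.
    rewrite raddf_sum big1// => i _.
    by rewrite !mxE /= im_mul A1 mulr0 mul0r addr0.
  have [r0|rn0] := eqVneq (\row_i (re (v 0 i))%:C%C : 'rV[C^o]_m.+1) 0; last first.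
    exists (\row_i (re (v 0 i))%:C%C); split; [|exact: rn0|exact: vre].
    by move=> i _; rewrite mxE.
  exists (\row_i (im (v 0 i))%:C%C); split; [| |exact: vim].
    by move=> i _; rewrite mxE.
  apply: contraNneq v0 => i0; apply/eqP/rowP => i.
  apply/eqP; rewrite mxE eq_complex.
  have /rowP/(_ i) := r0; rewrite !mxE => /(congr1 (@complex.Re R)) /= ->.
  by have /rowP/(_ i) := i0; rewrite !mxE => /(congr1 (@complex.Re R)) /= ->; rewrite !eqxx.
(* Solving for the row with the largest coefficient leaves quotients of modulus at most 1, which is
   below [B]. *)
have [j _ jmax] := arg_maxP (fun i => re `|v 0 i|) (isT : xpredT (ord0 : 'I_m.+1)).
have vj i : `|v 0 i| <= `|v 0 j|.
  rewrite -(RRe_real (normr_real (v 0 i))) -(RRe_real (normr_real (v 0 j))) lecR.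
  exact: jmax.
have vj0 : v 0 j != 0.
  apply: contraNneq v0 => j0; apply/eqP/rowP => i; rewrite mxE.
  by apply/eqP; rewrite -normr_le0 (le_trans (vj i))// j0 normr0.
pose f (h : 'I_m) := - v 0 (lift j h) / v 0 j.
have fk h : in_field k (f h).
  by apply: in_fieldM; [apply: in_fieldN | apply: in_fieldV]; exact: vk.
exists j, (fun i : 'I_m * 'I_k + 'I_m * 'I_b * 'I_k => match i with
  | inl (h, l) => coord (f h) l
  | inr (h, jj, l) => coord (A (lift j h) jj) l end); split.
  move=> [[h l]|[[h jj] l]]; last exact: AB.
  apply: (@le_trans _ _ 1); last by rewrite ler1n.
  apply: le_trans (normc_coord _ _) _.
  rewrite -lecR RRe_real ?normr_real// /f normrM normrN normfV.
  by rewrite ler_pdivrMr ?normr_gt0// mul1r.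
apply/matrixP => i jj; rewrite mxE; case: unliftP => [h ->|->].
  by rewrite combine_coord.
under eq_bigr => h _ do rewrite !combine_coord//.
have /rowP/(_ jj) := vA; rewrite !mxE (bigD1_ord j)//= => /eqP.
rewrite addr_eq0 => /eqP h.
apply: (mulfI vj0); rewrite h mulr_sumr -sumrN; apply: eq_bigr => i' _.
by rewrite /f; field.
Qed.

End DependentRows.

(** If [v] kills the Gram matrix, then the Hermitian norm of [v *m A] vanishes. Independence of the
    rows thus becomes the nonvanishing of one continuous function, a determinant. *)
Lemma row_free_gram a b (A : 'M[C^o]_(a, b)) :
  row_free A = (A *m (cjmx A)^T \in unitmx).
Proof.
apply/idP/idP => [/row_free_inj rf|u]; last first.
  by apply/row_freeP; exists ((cjmx A)^T *m invmx (A *m (cjmx A)^T));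
     rewrite mulmxA mulmxV.
rewrite -row_free_unit -kermx_eq0; apply/rowV0P => v /sub_kermxP h.
apply: (rf); rewrite mul0mx; set w : 'rV[C^o]_b := v *m A.
have ww : w *m (cjmx w)^T = 0.
  by rewrite /w cjmxM trmx_mul mulmxA -(mulmxA v) h mul0mx.
apply/rowP => j; have /matrixP/(_ 0 0) := ww; rewrite !mxE => /eqP.
rewrite psumr_eq0 => [/allP/(_ j (mem_index_enum _))/=|i _].
  by rewrite !mxE mulf_eq0 conjC_eq0 orbb => /eqP.
by rewrite !mxE; exact: mul_conjC_ge0.
Qed.

Section MatrixExtension.
Variables (Y : normedModType R) (a b k : nat).
Hypothesis k0 : (0 < k <= 2)%N.

Lemma cvg_mx_of_coords (T : Type) (F : set_system T)
    (u : T -> 'I_a * 'I_b * 'I_k -> R) (v : 'I_a * 'I_b * 'I_k -> R) :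
  Filter F -> (forall i, (fun t => u t i) @ F --> v i) ->
  (fun t => mx_of_coords (u t)) @ F --> mx_of_coords v.
Proof.
move=> FF uv; apply/cvg_mxP => i j; rewrite mxE; under eq_fun do rewrite mxE.
by apply: cvg_combine => l; exact: uv.
Qed.

Lemma mx_of_coordsD (u v : 'I_a * 'I_b * 'I_k -> R) :
  mx_of_coords (fun i => u i + v i) = mx_of_coords u + mx_of_coords v.
Proof.
apply/matrixP => i j; rewrite !mxE /combine -big_split; apply: eq_bigr => l _.
by rewrite rmorphD /= mulrDl.
Qed.

Lemma mx_extension (S : set Y) (G : Y -> 'M[C^o]_(a, b)) : compact S ->
  (forall z, S z -> cwa S G z) ->
  (forall z, S z -> forall i j, in_field k (G z i j)) ->
  exists h : Y -> 'I_a * 'I_b * 'I_k -> R, (forall i, continuous (h^~ i)) /\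
    forall z, S z -> mx_of_coords (h z) = G z.
Proof.
move=> cS Gc Gk.
have ext i : exists f : Y -> R, continuous f /\
    forall z, S z -> f z = coord (G z i.1.1 i.1.2) (i : 'I_a * 'I_b * 'I_k).2.
  have [z Sz|f fc fE] := @tietze_compact R Y S (fun z => coord (G z i.1.1 i.1.2) i.2) cS.
    apply: cvg_coord; have := Gc z Sz; rewrite /cwa => /cvg_mxP; exact.
  by exists f.
have {ext}[f fP] := choice ext.
exists (fun y i => f i y); split=> [i|z Sz]; first by have [] := fP i.
apply/matrixP => i j; rewrite mxE -[RHS](combine_coord k0); last exact: Gk.
by congr combine; apply/funext => l; have [_ ->] := fP (i, j, l).
Qed.

Lemma bounded_family (I : finType) (K : set Y) (h : Y -> I -> R) : compact K ->
  (forall i, continuous (h^~ i)) -> exists M : nat, forall y, K y -> forall i,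
    `|h y i| <= M%:R.
Proof.
move=> cK hc.
have bd i : exists M : nat, forall y, K y -> `|h y i| <= M%:R.
  have [M [Mr Mf]] : bounded_set (h^~ i @` K).
    apply: compact_bounded; apply: continuous_compact => //.
    exact: continuous_subspaceT.
  exists (Num.truncn (`|M| + 1)).+1 => y Ky.
  apply: le_trans (ltW (truncnS_gt _)); apply: Mf; last by exists y.
  by rewrite (le_lt_trans (ler_norm M))// ltrDl.
have {bd}[M MP] := choice bd.
exists (\sum_i M i)%N => y Ky i; apply: le_trans (MP i y Ky) _.
by rewrite ler_nat (bigD1 i)//= leq_addr.
Qed.

Lemma uniform_row_free (K : set Y) (h : Y -> 'I_a * 'I_b * 'I_k -> R) : compact K ->
  (forall i, continuous (h^~ i)) ->
  (forall y, K y -> row_free (mx_of_coords (h y))) ->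
  exists2 e : R, 0 < e & forall y (u : 'I_a * 'I_b * 'I_k -> R), K y -> (forall i, `|u i| <= e) ->
    row_free (mx_of_coords (h y) + mx_of_coords u).
Proof.
move=> cK hc hK.
have : \forall E \near (0 : 'M[C^o]_(a, b)), K `<=` (fun y =>
    row_free (mx_of_coords (h y) + E)).
  apply: (proj1 (compact_near_coveringP K) cK _ (nbhs (0 : 'M[C^o]_(a, b)))
    (fun E y => row_free (mx_of_coords (h y) + E))) => y Ky.
  pose D (z : Y * 'M[C^o]_(a, b)) : 'M[C^o]_(a, b) := mx_of_coords (h z.1) + z.2.
  pose z0 : Y * 'M[C^o]_(a, b) := (y, 0).
  have Dc : D @ nbhs z0 --> D z0.
    apply: cvg_addmx; last exact: cvg_snd.
    apply: cvg_mx_of_coords => i.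
    by apply: (@cvg_comp _ _ _ fst (h^~ i)); [exact: cvg_fst | exact: hc].
  have dc : (fun z => \det (D z *m (cjmx (D z))^T) : C^o) @ nbhs z0
      --> (\det (D z0 *m (cjmx (D z0))^T) : C^o).
    by apply: cvg_det; apply: cvg_mulmx => //; apply: cvg_trmx; exact: cvg_cjmx.
  have nz : \det (D z0 *m (cjmx (D z0))^T) != 0 :> C^o.
    by rewrite -unitfE -unitmxE -row_free_gram /D addr0; exact: hK.
  have : nbhs z0 [set z | row_free (D z)].
    have dn : \forall z \near nbhs z0, \det (D z *m (cjmx (D z))^T) != 0 :> C^o.
      by have := cvgr_neq0 _ dc nz; apply.
    apply: filterS dn => z /=.
    by rewrite -unitfE -unitmxE -row_free_gram.
  case=> -[A B] /= [nA nB] AB; exists (A, B); first by split.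
  by move=> -[y' E] /= [Ay' BE]; exact: (AB (y', E)).
move=> /nbhs_ballP[e /= e0 eP].
have er : e = (re e)%:C%C by rewrite RRe_real// gtr0_real.
have re0 : 0 < re e by move: e0; rewrite er ltcR.
(* Coordinates bounded by a quarter of the radius give entries of [norm1] at most half of it, hence
   strictly inside the ball. *)
exists (re e / 4); first by rewrite divr_gt0.
move=> y u Ky ue; apply: eP => //; split=> // i j.
rewrite -ball_normE /= !mxE sub0r normrN; apply: le_lt_trans (normc_le_ReIm _) _.
rewrite er ltcR; apply: le_lt_trans (norm1_combine k0 (fun l => ue _)) _.
lra.
Qed.

End MatrixExtension.

(* Where the Tietze extension of [G] may fail to be injective, it is replaced
   by a Lipschitz approximation, translated by a constant matrix off the
   matrices with dependent rows: over [K] these are matched by data of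
   dimension [p + (m + m * b) * k] only. *)
Lemma row_free_extension (Y : normedModType R) (m b k p : nat) (K S : set Y)
    (G : Y -> 'M[C^o]_(m.+1, b)) : (0 < k <= 2)%N ->
  compact K -> closed S -> S `<=` K -> covered K p ->
  (p + (m + m * b) * k < m.+1 * b * k)%N ->
  (forall z, S z -> cwa S G z) -> (forall z, S z -> row_free (G z)) ->
  (forall z, S z -> forall i j, in_field k (G z i j)) ->
  exists G', [/\ continuous G', forall z, S z -> G' z = G z,
    forall z, K z -> row_free (G' z) &
    forall z i j, in_field k (G' z i j)].
Proof.
move=> k0 cK clS SK covK dim Gc Grf Gk.
have cS : compact S by exact: subclosed_compact clS cK SK.
have [h [hc hG]] := mx_extension k0 cS Gc Gk.
pose H y := mx_of_coords (h y).
have Hc y : H @ y --> H y by apply: cvg_mx_of_coords => i; exact: hc.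
pose Z := K `&` [set y | ~~ row_free (H y)].
have cZ : compact Z.
  apply: compact_closedI => //.
  pose D y := \det (H y *m (cjmx (H y))^T) : C^o.
  have Dc : continuous D.
    move=> y; apply: cvg_det; apply: cvg_mulmx; first exact: Hc.
    by apply: cvg_trmx; apply: cvg_cjmx; exact: Hc.
  rewrite (_ : mkset _ = D @^-1` [set 0]).
    apply: closed_comp => [y _|]; first exact: Dc.
    exact: (accessible_closed_set1 (hausdorff_accessible (@norm_hausdorff _ _))).
  apply/seteqP; split=> y /=; rewrite row_free_gram unitmxE unitfE negbK.
    by move/eqP.
  by move/eqP.
have [|l [lc lS lZ _]] := urysohn_compact cS cZ.
  by apply/seteqP; split=> // y [Sy [_ /=]]; rewrite /H hG// Grf.
(* The bad set [Z], where [l] vanishes, misses [S']; by compactness [H] is injective on [S'] with a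
   uniform margin [e]. Half of it is spent on the approximation, half on the translation. *)
pose S' := K `&` l @^-1` [set t | 1 / 2 <= t].
have cS' : compact S'.
  apply: compact_closedI => //.
  by apply: closed_comp => [y _|]; [exact: lc | exact: closed_ge].
have [|e e0 eP] := uniform_row_free k0 cS' hc.
  move=> y [Ky /= ly]; apply/negP => /negP nf.
  have Zy : Z y by [].
  by move: ly; rewrite lZ//; lra.
have e2 : 0 < e / 2 by rewrite divr_gt0.
have app i : exists gL : (Y -> R) * nat,
    (forall y y', `|gL.1 y - gL.1 y'| <= gL.2%:R * `|y - y'|) /\
    forall y, K y -> `|gL.1 y - h y i| <= e / 2.
  have [g [L [gL gh]]] := lipschitz_approximation cK e2
    (fun z (_ : K z) => cwa_continuous K (@hc i z)).
  by exists (g, L).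
have {app}[gL gLP] := choice app.
pose g y i := (gL i).1 y.
have gc i : continuous (g^~ i).
  by have [/lipschitz_continuous] := gLP i.
pose L := (\sum_i (gL i).2)%N.
have gLip y y' i : `|g y i - g y' i| <= L%:R * `|y - y'|.
  have [h1 _] := gLP i; apply: le_trans (h1 y y') _.
  by rewrite ler_wpM2r// ler_nat /L (bigD1 i)//= leq_addr.
have [M gM] := bounded_family cK gc.
(* The coordinates of [g'] are at most [M + e / 2], and [norm1_combine] costs a factor 2. *)
pose B := (2 * (M + (Num.truncn (e / 2)).+1))%N.
have B0 : (0 < B)%N by rewrite muln_gt0 addn_gt0 orbT.
have card : (p + #|{: 'I_m * 'I_k + 'I_m * 'I_b * 'I_k}|
    < #|{: 'I_m.+1 * 'I_b * 'I_k}|)%N.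
  by rewrite card_sum !card_prod !card_ord -mulnDl.
have [q [qe qP]] := generic_translate (L' := (8 * m * B + 2)%N) covK card e2 gLip
  (fun j c c' e => @dependent_coords_lipschitz m b k k0 B j c c' e).
pose g' y i := g y i - q i.
have g'h y i : K y -> `|g' y i - h y i| <= e.
  move=> Ky; have [_ /(_ y Ky)] := gLP i; have /andP[q0 q1] := qe i.
  rewrite -/(g y i) /g' !ler_norml => /andP[h1 h2]; apply/andP; split; lra.
have g'rf y : K y -> row_free (mx_of_coords (g' y)).
  move=> Ky; apply/negP => /negP nf.
  have Ak i j : in_field k (mx_of_coords (g' y) i j).
    by rewrite mxE; exact: in_field_combine.
  have [|j [c [cB cE]]] := dependent_mxP k0 Ak nf B0.
    move=> i j l'; apply: le_trans (coord_le_norm1 _ _) _; rewrite mxE.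
    rewrite /B natrM; apply: (norm1_combine k0) => l''; rewrite natrD.
    apply: le_trans (ler_normB _ _) _; apply: lerD; first exact: gM.
    have /andP[q0 q1] := qe (i, j, l''); rewrite ger0_norm//.
    exact: le_trans q1 (ltW (truncnS_gt _)).
  apply: (qP y Ky j c cB) => -[[i jj] l'].
  rewrite /dependent_coords -cE mxE /=.
  by rewrite coord_combine.
(* The switch from [g'] to [h] takes place where [1 / 2 <= l]; there they differ by at most [e], so
   the margin covers every mixture. *)
pose l' y := Num.max 0 (Num.min 1 (2 * l y - 1)).
have l'01 y : 0 <= l' y <= 1 by rewrite /l' le_max lexx /= ge_max ler01 ge_min lexx.
have l'c : continuous l'.
  move=> y; suff : {for y, continuous ((fun _ : Y => 0 : R^o) \max
      ((fun _ : Y => 1 : R^o) \min (fun z : Y => 2 * l z - 1 : R^o)))} by [].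
  apply: continuous_max; first exact: cvg_cst.
  apply: continuous_min; first exact: cvg_cst.
  by apply: cvgB; [apply: cvgM; [exact: cvg_cst | exact: lc] | exact: cvg_cst].
pose f y i := g' y i + l' y * (h y i - g' y i).
exists (fun y => mx_of_coords (f y)); split.
- move=> y; apply: cvg_mx_of_coords => i.
  have g'c : (g'^~ i) @ y --> g' y i by apply: cvgB; [exact: gc | exact: cvg_cst].
  apply: cvgD => //; apply: cvgM; first exact: l'c.
  by apply: cvgB => //; exact: hc.
- move=> z Sz; rewrite -hG//; congr mx_of_coords; apply/funext => i.
  have -> : f z i = h z i => //; rewrite /f (_ : l' z = 1) ?mul1r ?subrKC//.
  rewrite /l' lS// (_ : 2 * 1 - 1 = 1); last by lra.
  by rewrite minxx; apply/max_idPr.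
- move=> y Ky; have [l2|l2] := leP (1 / 2) (l y).
    have -> : f y = (fun i => h y i + (1 - l' y) * (g' y i - h y i)).
      by apply/funext => i; rewrite /f; ring.
    rewrite mx_of_coordsD; apply: eP => // i.
    rewrite normrM; have /andP[l'0 l'1] := l'01 y.
    rewrite -[leRHS]mul1r ler_pM//; last exact: g'h.
    by rewrite ger0_norm; lra.
  have -> : f y = g' y; last exact: g'rf.
  apply/funext => i; rewrite /f (_ : l' y = 0) ?mul0r ?addr0//.
  rewrite /l'; apply/max_idPl; rewrite ge_min; apply/orP; right; lra.
- by move=> z i j; rewrite mxE; exact: in_field_combine.
Qed.

End Coordinates.

(** * Local extension problems over a cell *)

Section LocalExtensions.
Variables (R : realType) (X : involutiveSpace) (n : nat) (phi : 'rV[R]_n -> X).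
Variables (T : set R) (real : bool).
Local Notation C := (R[i]%C).
Local Notation Y := ('rV[R]_n * R)%type.
Hypothesis phic : forall v, disc v -> cwa (@disc R n) phi v.
Hypothesis phi_real : real -> forall v, disc v -> tau (phi v) = phi v.

(* Over a fixed cell the matrices in real charts are real. *)
Let k := if real then 1%N else 2%N.
Let k0 : (0 < k <= 2)%N. Proof. by rewrite /k; case: real. Qed.

Lemma in_field_real a b (A : 'M[C^o]_(a, b)) :
  (real -> cjmx A = A) <-> forall i j, in_field k (A i j).
Proof.
rewrite /k; case: real; split=> [h i j|h]//.
  by apply/in_field1P; have /matrixP/(_ i j) := h isT; rewrite mxE.
by move=> _; apply/matrixP => i j; rewrite mxE; apply/in_field1P.
Qed.

Lemma covered_cell q (K : set Y) : covered (T : set R^o) q ->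
  K `<=` @disc R n `*` T -> @covered R ('rV[R]_n * R^o)%type K (n + q).
Proof.
move=> covT KT; apply: covered_sub (covered_prod (@covered_box R n) covT).
by move=> z /KT[dz Tz]; split=> // i; exact: disc_coord.
Qed.

(** [n + q] bounds the dimension of the cell times [T], and the inequality is the codimension bound
    [k * (b - a + 1)] without subtraction. *)
Lemma injective_local_extension (E F : realBundle R X) q : covered (T : set R^o) q ->
  (forall x a b (c : chart E a) (d : chart F b), chart_dom c x -> chart_dom d x ->
    n + q + k * a < k * b.+1)%N ->
  local_extension T (fun x t (f : hom (fibre E x) (fibre F x)) => injective f)
    real phi.
Proof.
move=> covT dim a b c d rcd K S cK clS SK KU G Gc Gi Gr.
(* A point of [K] is needed to relate [a] and [b] through [dim]. *)
have [K0|/set0P[z0 Kz0]] := eqVneq K set0.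
  by exists G; split=> // z; rewrite K0.
have Gk z : S z -> forall i j, in_field k (G z i j).
  by move=> Sz; apply/in_field_real => r; exact: Gr.
have rf z (A : 'M[C^o]_(a, b)) : K z ->
    injective (mxhom c d (phi z.1) A) <-> row_free A.
  move=> Kz; have [_ _ cz dz] := KU z Kz.
  by rewrite (chart_rank_iso (mxhom c d (phi z.1) A) cz dz) mxhomK.
have KT : K `<=` @disc R n `*` T by move=> z /KU[].
have := covered_cell covT KT; have [_ _ cz0 dz0] := KU z0 Kz0.
have := dim _ _ _ c d cz0 dz0.
(* A matrix without rows is always injective; [row_free_extension] treats [m.+1] rows. *)
case: a c {rcd cz0} G Gc Gi Gr Gk rf KU => [|m] c G Gc Gi Gr Gk rf KU dims covK.
  exists (fun=> 0); split=> [z _|z _|z Kz|_ z _]; try exact: cwa_cst.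
  - by rewrite [RHS]flatmx0.
  - by apply: (rf z _ Kz).2; rewrite -row_leq_rank.
  - by rewrite [LHS]flatmx0.
have [|||G' [G'c G'G G'rf G'k]] := @row_free_extension R ('rV[R]_n * R^o)%type m b k
  (n + q) K S G k0 cK clS SK covK _ Gc.
- by move: dims; clear; nia.
- by move=> z Sz; apply: (rf z _ (SK z Sz)).1; exact: Gi.
- exact: Gk.
exists G'; split=> //.
- by move=> z _; apply: cwa_continuous; exact: G'c.
- by move=> z Kz; apply: (rf z _ Kz).2; exact: G'rf.
- by move=> r z Kz; apply: (in_field_real (G' z)).2.
Qed.

(** With row vectors a left inverse of [N] is a right inverse of its matrix [H]. The Moore-Penrose
    inverse [p] is a continuous choice, real where [H] is; it serves as origin of the affine space
    of solutions. The premise [T t] sits inside the predicate because [N] is controlled at times in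
    [T] only. *)
Lemma left_inverse_local_extension (E F : realBundle R X)
    (N : forall x : X, R -> hom (fibre E x) (fibre F x)) :
  fcont (Z := X * R)%type fst snd (setT `*` T) N ->
  (forall x t, T t -> injective (N x t)) ->
  (forall x t, T t -> Theta_rel (N x t) (N (tau x) t)) ->
  local_extension T
    (fun x t (f : hom (fibre F x) (fibre E x)) => T t -> cancel (N x t) f) real phi.
Proof.
move=> Nc Ni Nr a b c d rcd K S cK clS SK KU G Gc Gi Gr.
have Gk z : S z -> forall i j, in_field k (G z i j).
  by move=> Sz; apply/in_field_real => r; exact: Gr.
have cS : compact S by exact: subclosed_compact clS cK SK.
have [h [hc hG]] := @mx_extension R ('rV[R]_n * R^o)%type a b k k0 S G cS Gc Gk.
pose H z := hmx d c (N (phi z.1) z.2).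
have canP z (A : 'M[C^o]_(a, b)) : K z ->
    cancel (N (phi z.1) z.2) (mxhom c d (phi z.1) A) <-> H z *m A = 1%:M.
  move=> Kz; have [_ _ cz dz] := KU z Kz.
  have e : hmx d d (hom_comp (mxhom c d (phi z.1) A) (N (phi z.1) z.2)) = H z *m A.
    by rewrite (hmx_comp d d _ _ cz) mxhomK.
  rewrite -e -(hmx_id dz); split=> [NA|/(hmx_eq dz dz) NA u].
    by congr hmx; apply: hom_ext => u; exact: NA.
  exact: (congr1 (fun f : hom _ _ => f u) NA).
have Hc z : K z -> cwa K H z.
  move=> Kz; have [_ Tz cz dz] := KU z Kz.
  apply: (@hcont_pull _ _ _ _ fst (setT `*` T) (fun z : Y => (phi z.1, z.2)) K
    E F (fun z => N z.1 z.2)) => //.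
  - move=> y Ky; have [dy Ty _ _] := KU y Ky; apply: cwa_pair.
      apply: (@cwa_comp _ _ _ _ (@disc R n) fst phi).
      + by apply: cwa_continuous; exact: cvg_fst.
      + by apply: near_withinW => w /KU[].
      + exact: phic.
    by apply: cwa_continuous; exact: cvg_snd.
  - by move=> y Ky; have [_ Ty _ _] := KU y Ky.
have Hu z : K z -> H z *m (cjmx (H z))^T \in unitmx.
  move=> Kz; have [_ Tz cz dz] := KU z Kz; rewrite -row_free_gram.
  by apply/(chart_rank_iso (N (phi z.1) z.2) dz cz); exact: Ni.
pose p z := (cjmx (H z))^T *m invmx (H z *m (cjmx (H z))^T).
have Hp z : K z -> H z *m p z = 1%:M by move=> Kz; rewrite /p mulmxA mulmxV// Hu.
have pc z : K z -> cwa K p z.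
  move=> Kz; have cc : cwa K (fun z => (cjmx (H z))^T) z.
    by apply: cvg_trmx; apply: cvg_cjmx; exact: Hc.
  apply: cvg_mulmx => //; apply: cvg_invmx; first exact: Hu.
  by apply: cvg_mulmx => //; exact: Hc.
(* [p + (1 - p H) g] is a left inverse for every [g], and is [g] itself
   wherever [g] is a left inverse already *)
pose g z := mx_of_coords (h z) : 'M[C^o]_(a, b).
exists (fun z => p z + (1%:M - p z *m H z) *m g z); split.
- move=> z Kz; apply: cvg_addmx; first exact: pc.
  apply: cvg_mulmx.
    apply: cvg_submx; first exact: cvg_cst.
    by apply: cvg_mulmx; [exact: pc | exact: Hc].
  by apply: cvg_mx_of_coords => i; apply: cwa_continuous; exact: hc.
- move=> z Sz; have [_ Tz _ _] := KU z (SK z Sz).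
  have /canP HG := Gi z Sz Tz.
  rewrite /g hG// mulmxBl mul1mx -mulmxA HG; last exact: SK.
  by rewrite mulmx1 addrC subrK.
- move=> z Kz _; apply: (canP z _ Kz).2.
  rewrite mulmxDr Hp// [X in _ + X]mulmxA mulmxBr [H z *m (p z *m H z)]mulmxA.
  by rewrite Hp// mulmx1 mul1mx subrr mul0mx addr0.
- move=> r z Kz; have [dz Tz cz dz'] := KU z Kz; have [rc rd] := rcd r.
  have cH : cjmx (H z) = H z.
    exact: (hmx_real (fun x => N x z.2) rd rc (phi_real r dz) dz' cz).1 (Nr _ _ Tz).
  have cp : cjmx (p z) = p z.
    have u := Hu z Kz; rewrite /p cH in u *; set W := H z *m (H z)^T in u *.
    have cW : cjmx W = W by rewrite /W cjmxM cjmx_tr cH.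
    rewrite cjmxM cjmx_tr cH; congr (_ *m _); apply: (can_inj (mulKmx u)).
    by rewrite -{1}cW -cjmxM mulmxV// cjmx1.
  rewrite cjmxD cp cjmxM cjmxB cjmx1 [cjmx (p z *m H z)]cjmxM cp cH.
  congr (_ + _ *m _).
  by apply: (in_field_real (g z)).2 => // i j; rewrite mxE; exact: in_field_combine.
Qed.

End LocalExtensions.

(** * A continuous invariant step size *)

Section StepSize.
Variables (R : realType) (X : involutiveSpace) (CW : Z2CW R X).
Variables (E : realBundle R X) (I : set R).
Variable W : forall x : X, R -> R -> hom (fibre E x) (fibre E x).
Hypothesis cI : compact I.
Hypothesis Wc : @hcont R X (X * R * R)%type (fun z => z.1.1) ((setT `*` I) `*` I) E E
  (fun z => W z.1.1 z.1.2 z.2).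
Hypothesis W_diag : forall x t, I t -> injective (W x t t).
Hypothesis W_Theta : forall x t t', I t -> I t' ->
  Theta_rel (W x t t') (W (tau x) t t').
Local Notation C := (R[i]%C).

Lemma near_injective x t t' : I t -> I t' -> injective (W x t t') ->
  \forall z \near (x, t, t'), I z.1.2 -> I z.2 -> injective (W z.1.1 z.1.2 z.2).
Proof.
move=> It It' inj; have [n [c cx]] := chart_exists E x.
pose D (z : X * R * R) := \det (hmx c c (W z.1.1 z.1.2 z.2)) : C^o.
have Dc : cwa ((setT `*` I) `*` I) D (x, t, t').
  by apply: cvg_det; exact: (@Wc (x, t, t')).
have nz : D (x, t, t') != 0.
  rewrite -unitfE -unitmxE -row_free_unit.
  exact: (chart_rank_iso (W x t t') cx cx).1.
have dn : \forall z \near (x, t, t'), ((setT `*` I) `*` I) z -> D z != 0.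
  by have := cvgr_neq0 _ Dc nz; apply.
have cn : \forall z \near (x, t, t'), chart_dom c z.1.1.
  have fc : {for (x, t, t'), continuous (fun z : X * R * R => z.1.1)}.
    by apply: (@continuous_comp _ _ _ fst fst); exact: cvg_fst.
  by apply: fc; apply: open_nbhs_nbhs; split=> //; exact: chart_open.
apply: filterS2 cn dn => z cz h Iz Iz'.
apply: (chart_rank_iso (W z.1.1 z.1.2 z.2) cz cz).2.
by rewrite row_free_unit unitmxE unitfE; exact: h.
Qed.

Definition step_allowed (x : X) (r : R) := forall t t', I t -> I t' -> `|t - t'| <= r ->
  injective (W x t t').

Lemma step_allowed_le x r r' : r' <= r -> step_allowed x r -> step_allowed x r'.
Proof. by move=> rr h t t' It It' tt; apply: h => //; exact: le_trans tt rr. Qed.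

Lemma near_injective_ball x t t' : I t -> I t' -> injective (W x t t') ->
  exists (A : set X) (r : R), [/\ nbhs x A, 0 < r & forall y s s', A y ->
    I s -> I s' -> `|t - s| < r -> `|t' - s'| < r -> injective (W y s s')].
Proof.
move=> It It' inj; have := near_injective It It' inj.
case=> -[B1 B2] /= [[[A1 A2] /= [nA1 nA2] AB] nB2] BP.
have /nbhs_ballP[r1 /= r10 r1P] := nA2.
have /nbhs_ballP[r2 /= r20 r2P] := nB2.
exists A1, (Num.min r1 r2); split=> //; first by rewrite lt_min r10.
move=> y s s' Ay Is Is'; rewrite !lt_min => /andP[h1 _] /andP[_ h2].
by apply: (BP (y, s, s')) => //=; split; [apply: AB; split=> //; exact: r1P | exact: r2P].
Qed.

(** By compactness of [I], the neighbourhoods of diagonal points on which [W] stays injective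
    contain a strip of uniform width. *)
Lemma step_allowed_small (x : X) : exists2 r : R, 0 < r &
  \forall y \near x, step_allowed y r.
Proof.
pose F := filter_prod (nbhs x) (0 : R)^'+.
have : \forall z \near F, I `<=` (fun t =>
    forall t', I t -> I t' -> `|t - t'| <= z.2 -> injective (W z.1 t t')).
  apply: (proj1 (compact_near_coveringP I) cI _ F
    (fun z t => forall t', I t -> I t' -> `|t - t'| <= z.2 -> injective (W z.1 t t'))).
  move=> t It; have [A [r [nA r0 AP]]] := @near_injective_ball x t t It It (W_diag (x := x) It).
  have r2 : 0 < r / 2 by rewrite divr_gt0.
  exists (ball t (r / 2), A `*` [set d | d < r / 2]).
    split=> /=; first exact: nbhsx_ballx.
    by exists (A, [set d | d < r / 2]) => //; split=> //=; exact: nbhs_right_lt.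
  move=> -[s [y d]] /= [ts [Ay dr]] s' Is Is' ss'.
  have ts' : `|t - s| < r / 2 by [].
  apply: AP => //; first by apply: lt_le_trans ts' _; lra.
  apply: (le_lt_trans (ler_distD s t s')).
  by rewrite (splitr r) ltrD// (le_lt_trans ss').
case=> -[A D] /= [nA nD] AD.
have [d [Dd d0]] := filter_ex (filterI nD (nbhs_right_gt (0 : R))).
exists d => //; apply: filterS nA => y Ay t t' It It' tt.
exact: (AD (y, d)).
Qed.

Lemma step_allowed_open (x : X) (r : R) : step_allowed x r ->
  \forall z \near (x, r), step_allowed z.1 z.2.
Proof.
move=> ok.
have cII : compact (I `*` I) by exact: compact_setX.
have H : \forall z \near (x, r), I `*` I `<=` (fun p => I p.1 -> I p.2 ->
    `|p.1 - p.2| <= z.2 -> injective (W z.1 p.1 p.2)).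
  apply: (proj1 (compact_near_coveringP (I `*` I)) cII _ (nbhs (x, r))
    (fun z p => I p.1 -> I p.2 -> `|p.1 - p.2| <= z.2 -> injective (W z.1 p.1 p.2))).
  move=> [t t'] [/= It It'].
  have [tt|tt] := leP `|t - t'| r.
    have [A [e [nA e0 AP]]] := near_injective_ball It It' (ok t t' It It' tt).
    exists (ball t e `*` ball t' e, A `*` setT).
      split=> /=.
        by exists (ball t e, ball t' e) => //; split; exact: nbhsx_ballx.
      by exists (A, setT) => //; split=> //; exact: filterT.
    by move=> [[s s'] [y d]] /= [[h1 h2] [Ay _]] Is Is' _; exact: AP.
  (* The gap is shared among the perturbations of [t], [t'] and [r], so pairs too far apart to
     matter remain so. *)
  pose e := (`|t - t'| - r) / 3.
  have e0 : 0 < e by rewrite divr_gt0// subr_gt0.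
  exists (ball t e `*` ball t' e, setT `*` ball r e).
    split=> /=.
      by exists (ball t e, ball t' e) => //; split; exact: nbhsx_ballx.
    by exists (setT, ball r e) => //; split; [exact: filterT | exact: nbhsx_ballx].
  move=> [[s s'] [y d]] /= [[h1 h2] [_ h3]] _ _ ss; exfalso.
  have {}h1 : `|t - s| < e by [].
  have {}h2 : `|t' - s'| < e by [].
  have {}h3 : `|r - d| < e by [].
  have h4 : `|t - t'| <= `|t - s| + `|s - s'| + `|t' - s'|.
    apply: le_trans (ler_distD s t t') _; rewrite -addrA lerD2l.
    by rewrite (distrC t' s'); exact: ler_distD.
  have h5 : d < r + e by move: h3; rewrite distrC ltr_norml => /andP[_]; rewrite ltrBlDl.
  have h6 : 3 * e = `|t - t'| - r by rewrite /e mulrC divfK.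
  lra.
apply: filterS H => z zP t t' It It'; exact: (zP (t, t') (conj It It')).
Qed.

(* A positive function is encoded as a scaling of the trivial line bundle, so
   that [cellular_extension] produces it. *)
Definition step_scaling (x : X) (t : R)
    (f : hom (fibre (trivial_bundle R X 1) x) (fibre (trivial_bundle R X 1) x)) :=
  exists r : R, [/\ 0 < r, forall u, f u = (r%:C)%C *: u & step_allowed x r].

Lemma compact_zero : compact [set (0 : R)].
Proof. exact: compact_set1. Qed.

(** At each point the admissible positive values form an interval ending at 0, and admissibility is
    an open condition on the point and the value. So a Tietze extension is admissible near [S], and
    elsewhere it can be mixed with a small constant. *)
Lemma step_local_extension n (phi : 'rV[R]_n -> X) (real : bool) :
  (forall v, disc v -> cwa (@disc R n) phi v) ->
  (real -> forall v, disc v -> tau (phi v) = phi v) ->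
  local_extension [set (0 : R)] step_scaling real phi.
Proof.
move=> phic phi_real a b c d rcd K S cK clS SK KU G Gc GP Gr.
have [K0|/set0P[z0 Kz0]] := eqVneq K set0.
  by exists G; split=> // z; rewrite K0.
have [_ _ cz0 dz0] := KU z0 Kz0.
have a1 := trivial_chart_dim cz0; have b1 := trivial_chart_dim dz0; subst a b.
pose L (x : X) := fibre (trivial_bundle R X 1) x.
(* The transition between the two charts of the line bundle: scaling by [r] has matrix [r J], and
   [J'] recovers [r] from it. *)
pose J (z : 'rV[R]_n * R) := @hmx _ _ _ _ _ _ c d (phi z.1) (hom_id (L (phi z.1))).
have phic' z : K z -> cwa K (phi \o fst) z.
  move=> Kz; apply: (@cwa_comp _ _ _ _ (@disc R n) fst phi).
  - by apply: cwa_continuous; exact: cvg_fst.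
  - by apply: near_withinW => w /KU[].
  - by apply: phic; have [] := KU z Kz.
have Jc z : K z -> cwa K J z.
  move=> Kz; have [_ _ cz dz] := KU z Kz.
  exact: (@hcont_id R X _ (phi \o fst) K phic' (trivial_bundle R X 1) z Kz).
pose J' (z : 'rV[R]_n * R) := @hmx _ _ _ _ _ _ d c (phi z.1) (hom_id (L (phi z.1))).
have J'c z : K z -> cwa K J' z.
  move=> Kz; have [_ _ cz dz] := KU z Kz.
  exact: (@hcont_id R X _ (phi \o fst) K phic' (trivial_bundle R X 1) z Kz).
have JJ z : K z -> J z *m J' z = 1%:M.
  move=> Kz; have [_ _ cz dz] := KU z Kz.
  by rewrite /J /J' -hmx_comp// -(hmx_id cz); congr hmx; exact: hom_ext.
have scaleE z (r : R) : K z -> mxhom c d (phi z.1) ((r%:C)%C *: J z)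
    = hom_scale (r%:C)%C (hom_id (L (phi z.1))).
  move=> Kz; have [_ _ cz dz] := KU z Kz; apply: (hmx_eq cz dz).
  by rewrite mxhomK// hmx_scale.
pose r z : R := complex.Re ((G z *m J' z) 0 0).
have rS z : S z -> [/\ 0 < r z, G z = ((r z)%:C)%C *: J z & step_allowed (phi z.1) (r z)].
  move=> Sz; have Kz := SK z Sz; have [_ _ cz dz] := KU z Kz.
  have [r0 [r00 fr ok]] := GP z Sz.
  have GJ : G z = (r0%:C)%C *: J z.
    rewrite -[LHS](mxhomK _ cz dz) -hmx_scale; congr hmx; apply: hom_ext => u.
    by rewrite fr.
  have -> : r z = r0 by rewrite /r GJ -scalemxAl JJ// !mxE eqxx mulr1.
  by [].
have cS : compact S by exact: subclosed_compact clS cK SK.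
have rc z : S z -> cwa S r z.
  move=> Sz; have GJc : cwa S (fun z => G z *m J' z) z.
    by apply: cvg_mulmx; [exact: Gc | apply: cwa_sub (J'c z (SK z Sz))].
  have e : cwa S (fun z => (G z *m J' z) 0 0) z.
    by move: GJc; rewrite /cwa => /cvg_mxP; exact.
  exact: (cvg_coord (l := 0%N) _ e).
have [rt rtc rtr] := @tietze_compact R ('rV[R]_n * R^o)%type S r cS rc.
have [dl dl0 dlP] : exists2 dl : R, 0 < dl & forall z, K z -> step_allowed (phi z.1) dl.
  have H : (0 : R)^'+ [set dl | K `<=` (fun z => K z -> step_allowed (phi z.1) dl)].
    apply: (proj1 (compact_near_coveringP K) cK _ (0 : R)^'+
      (fun dl z => K z -> step_allowed (phi z.1) dl)) => z Kz.
    have [e e0 eP] := step_allowed_small (phi z.1).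
    have := phic' z Kz _ eP => nz.
    exists ([set y | K y -> step_allowed (phi y.1) e], [set dl | dl < e]).
      by split=> //=; exact: nbhs_right_lt.
    move=> [y dl] /= [h dle] Ky; apply: step_allowed_le (h Ky); exact: ltW.
  have [dl []] := @filter_ex _ _ _ _ (filterI H (nbhs_right_gt (0 : R))).
  by move=> h dl0; exists dl => // z Kz; exact: h.
pose O z := 0 < rt z /\ step_allowed (phi z.1) (rt z).
have Onear z : K z -> O z -> \forall y \near z, K y -> O y.
  move=> Kz [r0 ok].
  have h1 : \forall y \near z, 0 < rt y by apply: (cvgr_gt _ (rtc z)).
  have h2 : \forall y \near within K (nbhs z), step_allowed (phi y.1) (rt y).
    have pc : cwa K (fun y => (phi y.1, rt y)) z.
      by apply: cwa_pair; [exact: phic' | apply: cwa_continuous; exact: rtc].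
    exact: pc _ (step_allowed_open ok).
  by apply: filterS2 h1 h2 => y r0' ok' Ky; split=> //; exact: ok'.
pose Z := K `&` ~` O.
have clK : closed K.
  by apply: compact_closed => //; exact: (@norm_hausdorff _ ('rV[R]_n * R^o)%type).
have cZ : compact Z.
  apply: (subclosed_compact _ cK) => [|z []//].
  rewrite -[Z]setCK closedC openE => z nZz.
  have [Kz|nKz] := pselect (K z).
    have Oz : O z by apply: contrapT => nO; apply: nZz.
    by apply: filterS (Onear z Kz Oz) => y yP [Ky nOy]; exact: nOy (yP Ky).
  have : \forall y \near z, ~ K y.
    by apply: open_nbhs_nbhs; split=> //; exact: closed_openC.
  by apply: filterS => y nKy [].
have SZ : S `&` Z = set0.
  apply/seteqP; split=> // z [Sz [_ []]]; have [r0 _ ok] := rS z Sz.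
  by split; rewrite rtr.
have [l [lc lS lZ l01]] := @urysohn_compact R ('rV[R]_n * R^o)%type S Z cS cZ SZ.
(* A mixture never exceeds the larger of [rt] and [dl]; where [rt] is not admissible, [l] vanishes
   and [dl] alone remains. *)
pose r' z := l z * rt z + (1 - l z) * dl.
have r'c : continuous r'.
  move=> z; apply: cvgD; apply: cvgM; [exact: lc | exact: rtc | | exact: cvg_cst].
  by apply: cvgB; [exact: cvg_cst | exact: lc].
have r'K z : K z -> 0 < r' z /\ step_allowed (phi z.1) (r' z).
  move=> Kz; have [Oz|nOz] := pselect (O z); last first.
    have -> : r' z = dl by rewrite /r' lZ//; ring.
    by split=> //; exact: dlP.
  have [rt0 ok] := Oz; have /andP[l0 l1] := l01 z.
  have [le|le] := leP dl (rt z); split; rewrite /r'.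
  - by nra.
  - by apply: step_allowed_le ok; nra.
  - by nra.
  - by apply: step_allowed_le (dlP z Kz); nra.
exists (fun z => ((r' z)%:C)%C *: J z); split.
- move=> z Kz; apply/cvg_mxP => i j; rewrite mxE; under eq_fun do rewrite mxE.
  have Jz : cwa K (fun z => J z i j) z by move: (Jc z Kz); rewrite /cwa => /cvg_mxP; exact.
  apply: cvgM Jz; apply/cvg_complexP; split; last exact: cvg_cst.
  by apply: cwa_continuous; exact: r'c.
- move=> z Sz; have [_ -> _] := rS z Sz.
  by rewrite /r' lS// rtr//; congr (_%:C%C *: _); ring.
- move=> z Kz; have [r0 ok] := r'K z Kz; exists (r' z); split=> // u.
  by rewrite scaleE.
- move=> rl z Kz; have [dz _ cz dz'] := KU z Kz; have [rcc rcd'] := rcd rl.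
  have cJ : cjmx (J z) = J z.
    apply: (hmx_real (fun x => hom_id (L x)) rcc rcd' (phi_real rl _ dz) cz dz').1.
    by move=> u.
  rewrite cjmxZ cJ; congr (_ *: _).
  by rewrite -[Num.conj _]/(conjc _) /= oppr0.
Qed.

Theorem step_size_exists N :
  (forall n, (N <= n)%N -> sheet (free_cell CW n) (fixed_cell CW n) -> False) ->
  exists e : X -> R, [/\ continuous e, forall x, 0 < e x,
    forall x, e (tau x) = e x & forall x, step_allowed x (e x)].
Proof.
move=> cells.
pose L := trivial_bundle R X 1.
have realJ (r : R) : (r%:C)%C^* = (r%:C)%C.
  by rewrite -[Num.conj _]/(conjc _) /= oppr0.
have LE n (s : sheet (free_cell CW n) (fixed_cell CW n)) : primary s ->
    local_extension [set (0 : R)] step_scaling (fixed_sheet s) (charmap s).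
  move=> _; apply: step_local_extension; first exact: charmap_cwa.
  exact: fixed_sheet_tau.
have PT (x : X) (t : R) (g : hom (fibre L x) (fibre L x)) g' : Theta_rel g g' ->
    step_scaling t g -> step_scaling t g'.
  move=> gg [r [r0 gr ok]]; exists r; split=> // [w|t' t'' It' It'' tt].
    by rewrite -[w](@ThetaVK R X L x) gg gr ThetaZ realJ.
  apply: Theta_rel_injective (ok _ _ It' It'' tt); exact: W_Theta.
pose f0 x (t : R) := hom_zero (fibre L x) (fibre L x).
have f0c : fcont (Z := X * R)%type fst snd (setT `*` set0) f0 by move=> z [].
have [f [fc fP fT _]] := @cellular_extension R X CW L L [set (0 : R)] set0
  compact_zero closed0 (@sub0set _ _) step_scaling LE PT f0 f0c
  (fun _ _ h => False_ind _ h) (fun _ _ h => False_ind _ h) N cells.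
have P0 x : step_scaling 0 (f x 0) by exact: fP.
pose e x := projT1 (cid (P0 x)).
have eP x : [/\ 0 < e x, forall u, f x 0 u = ((e x)%:C)%C *: u & step_allowed x (e x)].
  exact: projT2 (cid (P0 x)).
exists e; split.
- move=> x; have [c cU cm] := trivial_chart R X 1.
  have cx y : chart_dom c y by rewrite cU.
  have fcx : cwa setT (fun y => hmx c c (f y 0)) x.
    apply: (@hcont_pull _ _ _ _ fst (setT `*` [set (0 : R)]) (fun y : X => (y, 0 : R))
      setT L L (fun z => f z.1 z.2)) => //.
    by move=> y _; apply: cwa_pair; [exact: cwa_id | exact: cwa_cst].
  have fE y : hmx c c (f y 0) = ((e y)%:C)%C *: 1%:M.
    have [_ fe _] := eP y; rewrite -(hmx_id (cx y)) -hmx_scale; congr hmx.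
    by apply: hom_ext => u; rewrite fe.
  have fx : cwa setT (fun y => hmx c c (f y 0) 0 0) x.
    by move: fcx; rewrite /cwa => /cvg_mxP; exact.
  have ex : cwa setT (fun y => coord (hmx c c (f y 0) 0 0) 0) x.
    exact: (cvg_coord (l := 0%N) _ fx).
  have {}ex : cwa setT e x.
    apply: cwa_near_eq ex => //; apply: nearW => y.
    by rewrite fE !mxE eqxx mulr1.
  by move=> A /ex; apply: (@filterS _ (nbhs x)) => y; exact.
- by move=> x; have [] := eP x.
- move=> x; have [_ h _] := eP x; have [_ h' _] := eP (tau x).
  (* Equivariance, tested on the real vector 1, makes the scaling factor invariant. *)
  pose u : fibre L x := const_mx 1 : 'Cn[R]_1.
  have := fT x 0 erefl u; rewrite h h' ThetaZ realJ.
  move=> /(congr1 (fun v : 'Cn[R]_1 => v 0 0)); rewrite !mxE conjC1 !mulr1.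
  by move=> /(congr1 (@complex.Re R)).
- by move=> x; have [] := eP x.
Qed.

End StepSize.

(** * The kernel of a split surjection *)

Lemma ThetaB (R : realType) (X : involutiveSpace) (E : realBundle R X) x
    (u v : fibre E x) : Theta (u - v) = Theta u - Theta v.
Proof. by apply/esym/eqP; rewrite subr_eq -ThetaD subrK. Qed.

Section DirectSumHoms.
Variables (R : realType) (X : involutiveSpace) (E F : realBundle R X).
Local Notation C := (R[i]%C).

Definition sum_fst x : hom (fibre (dsum E F) x) (fibre E x).
Proof. by exists (fun u => u.1). Defined.

Definition sum_snd x : hom (fibre (dsum E F) x) (fibre F x).
Proof. by exists (fun u => u.2). Defined.

Definition sum_inl x : hom (fibre E x) (fibre (dsum E F) x).
Proof.
exists (fun u => (u, 0)) => a u v; congr (_, _).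
have e : a *: 0 + 0 = 0 :> fibre F x by rewrite scaler0 addr0.
exact: esym e.
Defined.

Definition sum_inr x : hom (fibre F x) (fibre (dsum E F) x).
Proof.
exists (fun u => (0, u)) => a u v; congr (_, _).
have e : a *: 0 + 0 = 0 :> fibre E x by rewrite scaler0 addr0.
exact: esym e.
Defined.

Lemma hcont_fst : @hcont R X X id setT (dsum E F) E sum_fst.
Proof. by apply/hcont_cont; exact: dsum_fst_continuous. Qed.

Lemma hcont_snd : @hcont R X X id setT (dsum E F) F sum_snd.
Proof. by apply/hcont_cont; exact: dsum_snd_continuous. Qed.

Lemma hcont_inl : @hcont R X X id setT E (dsum E F) sum_inl.
Proof.
apply/hcont_cont; apply: continuous_to_dsum.
  have : @hcont R X X id setT E E (fun x => hom_id (fibre E x)).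
    by apply: hcont_id => z _; exact: cwa_id.
  by move/hcont_cont.
have : @hcont R X X id setT E F (fun x => hom_zero (fibre E x) (fibre F x)).
  exact: hcont0.
by move/hcont_cont.
Qed.

Lemma hcont_inr : @hcont R X X id setT F (dsum E F) sum_inr.
Proof.
apply/hcont_cont; apply: continuous_to_dsum.
  have : @hcont R X X id setT F E (fun x => hom_zero (fibre F x) (fibre E x)).
    exact: hcont0.
  by move/hcont_cont.
have : @hcont R X X id setT F F (fun x => hom_id (fibre F x)).
  by apply: hcont_id => z _; exact: cwa_id.
by move/hcont_cont.
Qed.

(** Ranks are added chart by chart, as the bundle to be cancelled may have no constant rank. *)
Lemma dsum_chart_dim x n m b (c : chart E n) (d : chart F m)
    (e : chart (dsum E F) b) :
  chart_dom c x -> chart_dom d x -> chart_dom e x -> b = (n + m)%N.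
Proof.
move=> cx dx ex.
have [t tU _] := trivial_chart R X (n + m).
pose f (u : fibre (dsum E F) x) : CV R (n + m) :=
  row_mx (chart_map c x u.1 : 'Cn[R]_n) (chart_map d x u.2 : 'Cn[R]_m).
have fP (a : C) u v : f (a *: u + v) = a *: f u + f v.
  rewrite /f /= !homP; apply/rowP => j.
  by rewrite !mxE; case: splitP => k _; rewrite !mxE.
pose g (w : CV R (n + m)) : fibre (dsum E F) x :=
  (chart_inv c x (lsubmx (w : 'Cn[R]_(n + m))),
   chart_inv d x (rsubmx (w : 'Cn[R]_(n + m)))).
apply: (@bij_chart_dim _ _ (dsum E F) (trivial_fibred R X (n + m)) x b (n + m)%N e t
  (Hom fP) g) => //.
- by rewrite tU.
- by move=> [u v]; rewrite /= /f /g /= row_mxKl row_mxKr !chart_mapK.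
- by move=> w; rewrite /= /f /g /= !chart_invK// hsubmxK.
Qed.

End DirectSumHoms.

Section Kernel.

Lemma kernel_basis (K : fieldType) (k m : nat) (P : 'M[K]_(k, m)) :
  \rank P = m -> exists C0 : 'M[K]_(k - m, k), row_free C0 /\
    forall v : 'rV[K]_k, v *m P = 0 <-> exists w, v = w *m C0.
Proof.
move=> rP; have rk : \rank (kermx P) = (k - m)%N by rewrite mxrank_ker rP.
have : exists C0 : 'M[K]_(\rank (kermx P), k), row_free C0 /\
    forall v : 'rV[K]_k, v *m P = 0 <-> exists w, v = w *m C0.
  exists (row_base (kermx P)); split=> [|v]; first exact: row_base_free.
  split=> [/sub_kermxP|[w ->]].
    by rewrite -(eq_row_base (kermx P)) => /submxP[w ->]; exists w.
  by apply/sub_kermxP; rewrite -(eq_row_base (kermx P)) submxMl.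
by rewrite rk.
Qed.

Variables (R : realType) (X : involutiveSpace) (E L : realBundle R X) (k m : nat).
Local Notation C := (R[i]%C).
Hypotheses (Ek : has_rank E k) (Lm : has_rank L m).
Variables (i : forall x : X, hom (fibre L x) (fibre E x))
  (p : forall x : X, hom (fibre E x) (fibre L x)).
Hypotheses (ic : @hcont R X X id setT L E i) (pc : @hcont R X X id setT E L p).
Hypotheses (iK : forall x, cancel (i x) (p x)).
Hypotheses (iT : forall x, Theta_rel (i x) (i (tau x)))
  (pT : forall x, Theta_rel (p x) (p (tau x))).

Lemma kernel_embedding x : exists kernel_map : hom (CV R (k - m)) (fibre E x),
  injective kernel_map /\ forall u, p x u = 0 <-> exists w, u = kernel_map w.
Proof.
have [n [c cx]] := chart_exists E x; have nk := has_rank_chart Ek cx; subst n.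
have [n [d dx]] := chart_exists L x; have nm := has_rank_chart Lm dx; subst n.
have IP : hmx d c (i x) *m hmx c d (p x) = 1%:M.
  rewrite -hmx_comp// -(hmx_id dx); congr hmx.
  by apply: hom_ext => u; exact: iK.
have rP : \rank (hmx c d (p x)) = m.
  apply/eqP; rewrite eqn_leq rank_leq_col /= -[leqLHS](mxrank1 C) -IP.
  exact: mxrankM_maxr.
have [C0 [C0f C0P]] := kernel_basis rP.
pose kernel_map (w : CV R (k - m)) := chart_inv c x ((w : 'Cn[R]_(k - m)) *m C0).
have kernel_mapP (a : C) u v : kernel_map (a *: u + v) = a *: kernel_map u + kernel_map v.
  by rewrite /kernel_map mulmx_homP homP.
exists (Hom kernel_mapP); split.
  move=> w w' /(congr1 (chart_map c x)); rewrite /= /kernel_map !chart_invK//.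
  exact: (row_free_inj C0f).
move=> u; split.
  move=> /(congr1 (chart_map d x)); rewrite (hmxE' _ _ _ cx) hom0.
  by move=> /C0P[w uw]; exists w; rewrite /= /kernel_map -uw chart_mapK.
move=> [w ->]; apply: (can_inj (chart_mapK dx)); rewrite (hmxE' _ _ _ cx) hom0.
by rewrite /= /kernel_map chart_invK//; apply/C0P; exists w.
Qed.

(** Chosen in each fibre separately, with no continuity in [x]; the topology induced through
    [kernel_tot] compensates for this. *)
Definition kernel_map x := projT1 (cid (kernel_embedding x)).
Lemma kernel_map_inj x : injective (kernel_map x). Proof. by have [] := projT2 (cid (kernel_embedding x)). Qed.
Lemma kernel_mapP x u : p x u = 0 <-> exists w, u = kernel_map x w.
Proof. by have [_] := projT2 (cid (kernel_embedding x)); exact. Qed.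
Lemma retraction_kernel_map x w : p x (kernel_map x w) = 0. Proof. by apply/kernel_mapP; exists w. Qed.

Lemma kernel_map_inv_exists x (u : fibre E x) : exists w, p x u = 0 -> kernel_map x w = u.
Proof.
have [/kernel_mapP[w ->]|] := pselect (p x u = 0); first by exists w.
by exists 0.
Qed.
Definition kernel_map_inv x (u : fibre E x) := projT1 (cid (kernel_map_inv_exists u)).
Lemma kernel_map_invK x (u : fibre E x) : p x u = 0 -> kernel_map x (kernel_map_inv u) = u.
Proof. exact: projT2 (cid (kernel_map_inv_exists u)). Qed.

(* The kernel of [p], with the topology induced by its inclusion into [E];
   all its fibres are modelled on the same space. *)
Definition kernel_fibre (x : X) : lmodType C := CV R (k - m).
Definition kernel_tot (e : total kernel_fibre) : tot E := totpt (kernel_map (tag e) (tagged e)).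

Definition kernel_fibred : fibred R X :=
  @Fibred R X kernel_fibre (Topological.class (initial_topology kernel_tot)).

Lemma kernel_tot_continuous : continuous (kernel_tot : tot kernel_fibred -> tot E).
Proof. exact: (@initial_continuous _ _ kernel_tot). Qed.

Lemma to_kernel (T : topologicalType) (f : T -> tot kernel_fibred) :
  continuous (kernel_tot \o f) -> continuous f.
Proof. exact: (@continuous_comp_initial _ _ _ kernel_tot). Qed.

Lemma kernel_tot_inj : injective kernel_tot.
Proof.
move=> [x w] [y v] h; have xy : x = y by exact: (congr1 (@proj R X E) h).
by subst y; congr existT; apply: kernel_map_inj; exact: totpt_inj h.
Qed.

Lemma kernel_proj_continuous : continuous (@proj R X kernel_fibred).
Proof.
move=> e; exact: (continuous_comp (@kernel_tot_continuous e) (@vb_proj_continuous _ _ E _)).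
Qed.

(** The projection onto the kernel of [p] along the image of [i]. *)
Definition cokernel x := hom_sub (hom_id (fibre E x)) (hom_comp (i x) (p x)).
Lemma p_cokernel x u : p x (cokernel x u) = 0.
Proof. by rewrite /= homB iK subrr. Qed.

Lemma cokernel_hcont : @hcont R X X id setT E E cokernel.
Proof.
have idc (z : X) : setT z -> cwa setT id z by move=> _; exact: cwa_id.
by apply: hcont_sub; [exact: hcont_id | exact: hcont_comp].
Qed.

(** A basis [C0] of the kernel at [x], projected by [Q y], is a frame of the kernel at nearby
    points: with [B] a right inverse of [C0], the matrix [C0 *m Q y *m B] is the identity at [x],
    hence invertible nearby. It corrects the coordinates read off by [B]. *)
Lemma kernel_locally_trivial x : exists U : set X,
  [/\ open U, U x & trivial_over kernel_fibred U].
Proof.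
have [n [c cx]] := chart_exists E x; have nk := has_rank_chart Ek cx; subst n.
pose c0 : 'Cn[R]_(k - m) -> 'Cn[R]_k := fun w => chart_map c x (kernel_map x w).
pose C0 : 'M[C^o]_(k - m, k) := \matrix_(a, b) c0 (delta_mx 0 a) 0 b.
have C0E w : c0 w = w *m C0.
  transitivity (\sum_a w 0 a *: (c0 (delta_mx 0 a) : CV R k)).
    rewrite [in LHS](row_sum_delta w) /c0 !hom_sum.
    by apply: eq_bigr => a _; rewrite !homZ.
  by apply/rowP => b; rewrite summxE !mxE; apply: eq_bigr => a _; rewrite !mxE.
have C0f : row_free C0.
  rewrite -kermx_eq0; apply/rowV0P => v /sub_kermxP vC.
  apply: (@kernel_map_inj x); apply: (can_inj (chart_mapK cx)).
  by rewrite !hom0 -[LHS]/(c0 v) C0E.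
have /row_freeP[B C0B] := C0f.
pose Q y := hmx c c (cokernel y).
pose G y := C0 *m Q y *m B.
have Gx : G x = 1%:M.
  rewrite /G -C0B; congr (_ *m _); apply/row_matrixP => a.
  rewrite row_mul !rowE -C0E -hmxE'//; congr (chart_map c x _).
  by rewrite /= retraction_kernel_map hom0 subr0.
have Gc y : chart_dom c y -> cwa setT G y.
  move=> cy; apply: cvg_mulmx; last exact: cvg_cst.
  by apply: cvg_mulmx; [exact: cvg_cst | exact: cokernel_hcont].
pose U := [set y | chart_dom c y /\ G y \in unitmx].
have oU : open U.
  rewrite openE => y [cy Gy].
  have dy : cwa setT (fun y => \det (G y) : C^o) y by apply: cvg_det; exact: Gc.
  have nz : \det (G y) != 0 :> C^o by rewrite -unitfE -unitmxE.
  have h : \forall t \near y, setT t -> \det (G t) != 0 :> C^o.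
    by have := cvgr_neq0 _ dy nz; apply.
  have nc : nbhs y (chart_dom c) by apply: open_nbhs_nbhs; split=> //; exact: chart_open.
  suff : \forall t \near y, U t by [].
  by apply: filterS2 nc h => t ct /(_ I) dt; split=> //; rewrite unitmxE unitfE.
exists U; split=> //; first by split=> //; rewrite Gx unitmx1.
pose h0 y (w : kernel_fibre y) : CV R (k - m) :=
  (chart_map c y (kernel_map y w) : 'Cn[R]_k) *m B.
have h0P y (a : C) u v : @h0 y (a *: u + v) = a *: h0 y u + h0 y v.
  by rewrite /h0 !homP mulmx_homP.
pose v0 y (w : 'Cn[R]_(k - m)) : fibre E y :=
  chart_inv c y (w *m invmx (G y) *m C0 *m Q y).
have pv0 y w : U y -> p y (v0 y w) = 0.
  by move=> [cy _]; rewrite /v0 -hmxE chart_mapK// p_cokernel.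
pose g0 y w : kernel_fibre y := kernel_map_inv (v0 y w).
have hg0 y w : U y -> h0 y (g0 y w) = w.
  move=> Uy; have [cy Gy] := Uy.
  rewrite /h0 /g0 kernel_map_invK ?pv0// /v0 chart_invK// -!mulmxA [C0 *m _]mulmxA.
  by rewrite -/(G y) mulVmx// mulmx1.
(* Source and target have the same dimension [k - m], so a one-sided inverse is two-sided. *)
have gh0 y w : U y -> g0 y (h0 y w) = w.
  move=> Uy; have : injective (@h0 y); last by apply; rewrite hg0.
  pose A : 'M[C^o]_(k - m) := \matrix_(a, b) h0 y (delta_mx 0 a) 0 b.
  have h0E v : h0 y v = (v : 'Cn[R]_(k - m)) *m A.
    transitivity (\sum_a (v : 'Cn[R]_(k - m)) 0 a *: (h0 y (delta_mx 0 a) : CV R (k - m))).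
      rewrite [in LHS](row_sum_delta v) -[LHS]/(Hom (@h0P y) _) hom_sum.
      by apply: eq_bigr => a _; rewrite homZ.
    by apply/rowP => b; rewrite summxE !mxE; apply: eq_bigr => a _; rewrite !mxE.
  pose A' : 'M[C^o]_(k - m) := \matrix_(a, b) (g0 y (delta_mx 0 a) : 'Cn[R]_(k - m)) 0 b.
  have A'A : A' *m A = 1%:M.
    apply/row_matrixP => a; rewrite row_mul !rowE mulmx1.
    have -> : delta_mx 0 a *m A' = g0 y (delta_mx 0 a).
      by rewrite -rowE; apply/rowP => b; rewrite !mxE.
    by rewrite -h0E hg0.
  have [_ uA] := mulmx1_unit A'A.
  by move=> v v'; rewrite !h0E => /(can_inj (mulmxK uA)).
exists (k - m)%N, (fun y => hom_to_linear (Hom (@h0P y))), (fun y w => g0 y w); split.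
- by move=> y Uy; split=> w; [exact: gh0 | exact: hg0].
- apply/cwa_withinP => e Ue; have [ce _] := Ue.
  pose l (t : tot E) := chart_map c (tag t) (tagged t) : 'Cn[R]_k.
  apply: (@cvg_mulmx _ _ _ _ _ _ _ (fun e : tot kernel_fibred => l (kernel_tot e)) (fun=> B)); last exact: cvg_cst.
  apply: (@cwa_comp (tot kernel_fibred) (tot E) _ _ (@proj R X E @^-1` chart_dom c) kernel_tot l).
  + by apply: cwa_continuous; exact: kernel_tot_continuous.
  + by apply: near_withinW => t [].
  + exact: chart_map_cwa.
- apply: to_kernel.
  pose v1 (z : X * 'Cn[R]_(k - m)) := totpt (v0 z.1 z.2) : tot E.
  suff : {within U `*` setT, continuous v1}.
    apply: subspace_eq_continuous => z; rewrite inE => -[Uz _].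
    by rewrite /v1 /= /kernel_tot /= /g0 kernel_map_invK// pv0.
  apply/cwa_withinP => z [Uz _]; have [cz Gz] := Uz.
  pose q (z : X * 'Cn[R]_(k - m)) : X * 'Cn[R]_k :=
    (z.1, z.2 *m invmx (G z.1) *m C0 *m Q z.1).
  apply: (@cwa_comp _ _ _ _ (chart_dom c `*` setT) q
    (fun z : X * 'Cn[R]_k => totpt (chart_inv c z.1 z.2) : tot E)).
  + apply: cwa_pair; first by apply: cwa_continuous; exact: cvg_fst.
    apply: cvg_mulmx; first (apply: cvg_mulmx; last exact: cvg_cst).
      apply: cvg_mulmx; first by apply: cwa_continuous; exact: cvg_snd.
      apply: cvg_invmx => //; apply: (@cwa_comp _ _ _ _ setT fst G).
      * by apply: cwa_continuous; exact: cvg_fst.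
      * exact: nearW.
      * exact: Gc.
    apply: (@cwa_comp _ _ _ _ setT fst Q).
    * by apply: cwa_continuous; exact: cvg_fst.
    * exact: nearW.
    * exact: cokernel_hcont.
  + by apply: near_withinW => y [[]].
  + exact: chart_inv_cwa.
Qed.

Definition kernel_vbundle : vbundle R X :=
  VBundle kernel_proj_continuous kernel_locally_trivial.

Definition kernel_Theta (x : X) (w : fibre kernel_vbundle x) :
  fibre kernel_vbundle (tau x) := kernel_map_inv (Theta (kernel_map x w)).

Lemma kernel_map_Theta x (w : fibre kernel_vbundle x) :
  kernel_map (tau x) (kernel_Theta w) = Theta (kernel_map x w).
Proof. by rewrite kernel_map_invK// pT retraction_kernel_map Theta0. Qed.

Lemma kernel_ThetaD x (u v : fibre kernel_vbundle x) :
  kernel_Theta (u + v) = kernel_Theta u + kernel_Theta v.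
Proof.
apply: kernel_map_inj; apply: etrans (kernel_map_Theta (u + v)) _.
have e : kernel_map (tau x) (kernel_Theta u + kernel_Theta v)
    = Theta (kernel_map x u) + Theta (kernel_map x v).
  by apply: etrans (homD _ _ _) _; rewrite !kernel_map_Theta.
apply: etrans (esym e); rewrite -ThetaD; congr Theta; exact: homD.
Qed.

Lemma kernel_ThetaZ x (a : C) (u : fibre kernel_vbundle x) :
  kernel_Theta (a *: u) = a^* *: kernel_Theta u.
Proof.
apply: kernel_map_inj; apply: etrans (kernel_map_Theta (a *: u)) _.
have e : kernel_map (tau x) (a^* *: kernel_Theta u) = a^* *: Theta (kernel_map x u).
  by apply: etrans (homZ _ _ _) _; rewrite !kernel_map_Theta.
apply: etrans (esym e); rewrite -ThetaZ; congr Theta; exact: homZ.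
Qed.

Lemma kernel_Theta_continuous : continuous (fun e : tot kernel_vbundle =>
  totpt (kernel_Theta (tagged e)) : tot kernel_vbundle).
Proof.
apply: to_kernel => e.
rewrite (_ : _ \o _ = (fun t : tot E => totpt (Theta (tagged t)) : tot E) \o kernel_tot).
  by apply: continuous_comp; [exact: kernel_tot_continuous | exact: Theta_continuous].
by apply/funext => t; rewrite /= /kernel_tot /= kernel_map_Theta.
Qed.

Lemma kernel_ThetaK x (u : fibre kernel_vbundle x) :
  totpt (kernel_Theta (kernel_Theta u)) = totpt u :> tot kernel_vbundle.
Proof. by apply: kernel_tot_inj; rewrite /kernel_tot /= !kernel_map_Theta ThetaK. Qed.

Definition kernel_bundle : realBundle R X := @RealBundle R X kernel_vbundle kernel_Theta
  kernel_ThetaD kernel_ThetaZ kernel_Theta_continuous kernel_ThetaK.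

(** The isomorphism sends [u] to the pair of [u - i (p u)], read in the kernel, and [p u]; its
    inverse adds the kernel vector and the image under [i]. *)
Theorem retract_splits : exists E0 : realBundle R X, real_iso E (dsum E0 L).
Proof.
exists kernel_bundle.
have jc : @hcont R X X id setT kernel_bundle E (kernel_map : forall x,
    hom (fibre kernel_bundle x) (fibre E x)).
  by apply/hcont_cont; exact: kernel_tot_continuous.
pose f0 x (u : fibre E x) : fibre (dsum kernel_bundle L) x := (kernel_map_inv (cokernel x u), p x u).
have f0P x (a : C) u v : f0 x (a *: u + v) = a *: f0 x u + f0 x v.
  congr (_, _); last by rewrite homP.
  have e : kernel_map x (a *: kernel_map_inv (cokernel x u) + kernel_map_inv (cokernel x v))
      = cokernel x (a *: u + v).
    apply: etrans (homP _ _ _ _) _; rewrite [RHS]homP.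
    by rewrite !kernel_map_invK ?p_cokernel.
  by apply: kernel_map_inj; apply: etrans (kernel_map_invK (p_cokernel _)) (esym e).
pose g0 x : hom (fibre (dsum kernel_bundle L) x) (fibre E x) :=
  hom_add (hom_comp (kernel_map x : hom (fibre kernel_bundle x) (fibre E x))
             (sum_fst kernel_bundle L x))
          (hom_comp (i x) (sum_snd kernel_bundle L x)).
exists (fun x => hom_to_linear (Hom (@f0P x))), (fun x => g0 x); split.
- move=> x; split=> [u|[w c]].
    rewrite /= /f0 /=; have := kernel_map_invK (p_cokernel u).
    by rewrite /= => ->; rewrite subrK.
  have pg : p x (g0 x (w, c)) = c.
    by rewrite /= homD iK retraction_kernel_map add0r.
  congr (_, _); last exact: pg.
  apply: kernel_map_inj; apply: etrans (kernel_map_invK (p_cokernel _)) _.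
  by rewrite /= in pg *; rewrite pg addrK.
- apply: continuous_to_dsum.
    apply: to_kernel => e.
    rewrite (_ : _ \o _ = (fun t : tot E => totpt (cokernel (tag t) (tagged t)) : tot E)).
      by have /hcont_cont := cokernel_hcont; exact.
    by apply/funext => t; rewrite /= /kernel_tot /= kernel_map_invK ?p_cokernel.
  by move/hcont_cont: pc.
- have idc (z : X) : setT z -> cwa setT id z by move=> _; exact: cwa_id.
  have : @hcont R X X id setT (dsum kernel_bundle L) E g0.
    apply: hcont_add; apply: hcont_comp => //.
    + exact: hcont_fst.
    + exact: hcont_snd.
  by move/hcont_cont.
- move=> x u; congr (_, _); last exact: pT.
  apply: kernel_map_inj; apply: etrans (kernel_map_invK (p_cokernel _)) _.
  apply: etrans _ (esym (kernel_map_Theta _)).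
  apply: etrans _ (congr1 (@Theta R X E x) (esym (kernel_map_invK (p_cokernel u)))).
  by rewrite /= pT iT -ThetaB.
Qed.

End Kernel.

(** * Families of embeddings over a complex and transport of complements *)

Section Families.
Variables (R : realType) (X : involutiveSpace) (CW : Z2CW R X) (d1 d0 : nat).
Hypotheses (free_dim : forall n, free_cell CW n -> (n <= d1)%N)
  (fixed_dim : forall n, fixed_cell CW n -> (n <= d0)%N).

Lemma no_large_cells n : ((maxn d1 d0).+1 <= n)%N ->
  sheet (free_cell CW n) (fixed_cell CW n) -> False.
Proof.
rewrite gtn_max => /andP[h1 h0] [[/free_dim h _]|/fixed_dim h].
  by rewrite leqNgt h1 in h.
by rewrite leqNgt h0 in h.
Qed.

Variables (T T0 : set R) (cT : compact T).

Section TwoBundles.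
Variables E F : realBundle R X.

(** [q] is the dimension of [T]. The two inequalities are the complex codimension bound for free
    cells and the real one for fixed cells. *)
Lemma injective_family q (f0 : forall x : X, R -> hom (fibre E x) (fibre F x)) :
  covered (T : set R^o) q -> closed T0 -> T0 `<=` T ->
  (forall x a b (c : chart E a) (d : chart F b), chart_dom c x -> chart_dom d x ->
    (d1 + q + 2 * a < 2 * b.+1)%N /\ (d0 + q + a < b.+1)%N) ->
  fcont (Z := X * R)%type fst snd (setT `*` T0) f0 ->
  (forall x t, T0 t -> injective (f0 x t)) ->
  (forall x t, T0 t -> Theta_rel (f0 x t) (f0 (tau x) t)) ->
  exists f : forall x : X, R -> hom (fibre E x) (fibre F x),
   [/\ fcont (Z := X * R)%type fst snd (setT `*` T) f,
    forall x t, T t -> injective (f x t),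
    forall x t, T t -> Theta_rel (f x t) (f (tau x) t) &
    forall x t, T0 t -> f x t = f0 x t].
Proof.
move=> covT cT0 T0T dim f0c f0i f0T.
apply: (@cellular_extension R X CW E F T T0 cT cT0 T0T
  (fun x t (f : hom (fibre E x) (fibre F x)) => injective f) _ _ f0 f0c f0i f0T
  _ no_large_cells).
  move=> n s ps; apply: (injective_local_extension covT).
  move=> x a b c d cx dx; have [h1 h0] := dim x a b c d cx dx.
  case: s ps => [[e bb] _|e _] /=.
    by have := free_dim e; lia.
  by have := fixed_dim e; lia.
by move=> x t g g' gg; exact: Theta_rel_injective.
Qed.

Lemma left_inverse_family (N : forall x : X, R -> hom (fibre E x) (fibre F x)) :
  fcont (Z := X * R)%type fst snd (setT `*` T) N ->
  (forall x t, T t -> injective (N x t)) ->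
  (forall x t, T t -> Theta_rel (N x t) (N (tau x) t)) ->
  exists p : forall x : X, R -> hom (fibre F x) (fibre E x),
   [/\ fcont (Z := X * R)%type fst snd (setT `*` T) p,
    forall x t, T t -> cancel (N x t) (p x t) &
    forall x t, T t -> Theta_rel (p x t) (p (tau x) t)].
Proof.
move=> Nc Ni Nr.
pose f0 (x : X) (t : R) := hom_zero (fibre F x) (fibre E x).
have f0c : fcont (Z := X * R)%type fst snd (setT `*` set0) f0 by move=> z [].
have LE n (s : sheet (free_cell CW n) (fixed_cell CW n)) : primary s ->
    local_extension T (fun x t (f : hom (fibre F x) (fibre E x)) =>
      T t -> cancel (N x t) f) (fixed_sheet s) (charmap s).
  move=> _; apply: left_inverse_local_extension => //; first exact: charmap_cwa.
  exact: fixed_sheet_tau.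
have PT (x : X) (t : R) (g : hom (fibre F x) (fibre E x)) g' : Theta_rel g g' ->
    (T t -> cancel (N x t) g) -> (T t -> cancel (N (tau x) t) g').
  move=> gg NK Tt w; rewrite -[w]ThetaVK; set u := ThetaV w.
  by rewrite (Nr x t Tt) gg NK.
have [p [pc pN pT _]] := @cellular_extension R X CW F E T set0 cT closed0
  (@sub0set _ _) (fun x t (f : hom (fibre F x) (fibre E x)) => T t -> cancel (N x t) f)
  LE PT f0 f0c (fun _ _ h => False_ind _ h) (fun _ _ h => False_ind _ h) _ no_large_cells.
by exists p; split=> // x t Tt; exact: pN.
Qed.

End TwoBundles.
End Families.

Section Covered.
Variable R : realType.

Lemma truncn_approx N (t : R) : (0 < N)%N -> 0 <= t <= 1 ->
  exists2 h : nat, (h <= N)%N & `|t - h%:R / N%:R| <= N%:R^-1.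
Proof.
move=> N0 /andP[t0 t1].
have N0' : 0 < N%:R :> R by rewrite ltr0n.
have /andP[h1 h2] : (Num.truncn (t * N%:R))%:R <= t * N%:R < (Num.truncn (t * N%:R)).+1%:R.
  by apply: truncn_itv; rewrite mulr_ge0.
exists (Num.truncn (t * N%:R)).
  by rewrite -(ler_nat R); apply: le_trans h1 _; rewrite ler_piMl.
have -> : t - (Num.truncn (t * N%:R))%:R / N%:R
    = (t * N%:R - (Num.truncn (t * N%:R))%:R) / N%:R.
  by rewrite mulrBl mulfK ?gt_eqF.
rewrite normrM (ger0_norm (x := N%:R^-1)) ?invr_ge0//.
rewrite -[leRHS]mul1r ler_pM2r ?invr_gt0// ger0_norm ?subr_ge0//.
by move: h2; rewrite -natr1; lra.
Qed.

Lemma covered_interval : covered (`[0, 1]%classic : set R^o) 1.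
Proof.
exists 2%N => N N0; pose g (h : nat) : R^o := (h%:R / N%:R : R).
exists (map g (iota 0 N.+1)); split; first by rewrite size_map size_iota; lia.
move=> t /=; rewrite in_itv /= => t01.
have [h hN tE] := truncn_approx N0 t01.
exists (g h) => //.
have hm : h \in iota 0 N.+1 by rewrite mem_iota.
exact: (map_f g hm).
Qed.

End Covered.

(** * Transport along a path of complements *)

Section Transport.
Variables (R : realType) (X : involutiveSpace) (CW : Z2CW R X).
Variables E V : realBundle R X.
Local Notation I := (`[0, 1]%classic : set R).
Variables (N : forall x : X, R -> hom (fibre E x) (fibre V x))
  (P : forall x : X, R -> hom (fibre V x) (fibre E x)).
Hypotheses (Nc : fcont (Z := X * R)%type fst snd (setT `*` I) N)
  (Pc : fcont (Z := X * R)%type fst snd (setT `*` I) P)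
  (PN : forall x t, I t -> cancel (N x t) (P x t))
  (NT : forall x t, I t -> Theta_rel (N x t) (N (tau x) t))
  (PT : forall x t, I t -> Theta_rel (P x t) (P (tau x) t)).
Hypothesis cells : exists N : nat, forall n, (N <= n)%N ->
  sheet (free_cell CW n) (fixed_cell CW n) -> False.

Let idc (z : X) : setT z -> cwa setT id z. Proof. by move=> _; exact: cwa_id. Qed.

(** The identity for [t = t'], and the obstruction to a step: if [P t] kills [v] and the projection
    at [t'] kills [v], then [v = N t' w] with [w = P t' v], and [pairing t t'] kills [w]. *)
Definition pairing x t t' := hom_comp (P x t) (N x t').

Lemma small_steps : exists e : X -> R, [/\ continuous e, forall x, 0 < e x,
  forall x, e (tau x) = e x & forall x t t', I t -> I t' -> `|t - t'| <= e x ->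
    injective (pairing x t t')].
Proof.
have [M cellsM] := cells.
have [|||e [e1 e2 e3 e4]] := @step_size_exists R X CW E I pairing
  (@segment_compact _ _ _) _ _ _ M cellsM.
- pose S := (([set: X] `*` I) `*` I).
  have phic (z : X * R * R) : S z -> cwa S (fun z : X * R * R => z.1.1) z.
    move=> _; apply: cwa_continuous.
    by apply: (@continuous_comp _ _ _ fst fst); exact: cvg_fst.
  apply: (@hcont_comp R X _ (fun z : X * R * R => z.1.1) S phic E V E
    (fun z => N z.1.1 z.2) (fun z => P z.1.1 z.1.2)).
    apply: (@hcont_pull _ _ _ _ fst (setT `*` I) (fun z : X * R * R => (z.1.1, z.2))
      S E V (fun z => N z.1 z.2)) => //.
      by move=> z Sz; apply: cwa_pair; [exact: phic | apply: cwa_continuous; exact: cvg_snd].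
    by move=> z [[_ _] Iz]; split.
  apply: (@hcont_pull _ _ _ _ fst (setT `*` I) (fun z : X * R * R => z.1)
    S V E (fun z => P z.1 z.2)) => //.
    by move=> z _; apply: cwa_continuous; exact: cvg_fst.
  by move=> z [].
- by move=> x t It u v; rewrite /= !PN.
- by move=> x t t' It It' u; rewrite /= NT// PT.
by exists e; split=> // x t t' It It' tt; exact: e4.
Qed.

Definition complement_proj x t :=
  hom_sub (hom_id (fibre V x)) (hom_comp (N x t) (P x t)).

Lemma complement_proj_P x t v : I t -> P x t (complement_proj x t v) = 0.
Proof. by move=> It; rewrite /= homB PN// subrr. Qed.

Lemma complement_proj_id x t v : P x t v = 0 -> complement_proj x t v = v.
Proof. by move=> Pv; rewrite /= Pv hom0 subr0. Qed.

Lemma complement_proj_Theta x t : I t ->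
  Theta_rel (complement_proj x t) (complement_proj (tau x) t).
Proof. by move=> It u; rewrite /= PT// NT// ThetaB. Qed.

Section Steps.
Variable e : X -> R.
Hypotheses (ec : continuous e) (e0 : forall x, 0 < e x)
  (eT : forall x, e (tau x) = e x)
  (eP : forall x t t', I t -> I t' -> `|t - t'| <= e x -> injective (pairing x t t')).

Definition time (j : nat) x : R := Num.min (j%:R * e x) 1.

Lemma time_I j x : I (time j x).
Proof.
by rewrite /= in_itv /= /time ge_min lexx orbT andbT le_min ler01 mulr_ge0// ltW.
Qed.

Lemma time_step j x : `|time j x - time j.+1 x| <= e x.
Proof.
have ej := e0 x; rewrite /time -natr1 mulrDl mul1r.
have : 0 <= j%:R * e x by rewrite mulr_ge0// ltW.
set a := j%:R * e x => a0; rewrite ler_norml.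
by case: (leP a 1) => h1; case: (leP (a + e x) 1) => h2; apply/andP; split; lra.
Qed.

Lemma time_continuous j : continuous (time j).
Proof.
move=> x; suff : {for x, continuous ((fun z : X => j%:R * e z : R^o) \min
    (fun _ : X => 1 : R^o))} by [].
apply: continuous_min; last exact: cvg_cst.
by apply: cvgM; [exact: cvg_cst | exact: ec].
Qed.

Fixpoint transport (j : nat) x : hom (fibre V x) (fibre V x) :=
  if j is j'.+1 then hom_comp (complement_proj x (time j x)) (transport j' x)
  else complement_proj x (time 0 x).

Lemma transport_P j x v : P x (time j x) (transport j x v) = 0.
Proof. by case: j => [|j]; apply: complement_proj_P; exact: time_I. Qed.

(** Each later projection is injective on the kernel reached before it, so only the initial one can
    lose information. *)
Lemma transport_eq0 j x v : transport j x v = 0 -> complement_proj x (time 0 x) v = 0.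
Proof.
elim: j => [//|j IH] tv; apply: IH; set w := transport j x v.
have Pw : P x (time j x) w = 0 by exact: transport_P.
have wN : w = N x (time j.+1 x) (P x (time j.+1 x) w).
  by apply/eqP; rewrite -subr_eq0; apply/eqP; exact: tv.
have : pairing x (time j x) (time j.+1 x) (P x (time j.+1 x) w) = pairing x (time j x) (time j.+1 x) 0.
  by rewrite hom0 /= -wN.
move=> /(eP (time_I j x) (time_I j.+1 x) (time_step j x)) Pw0.
by rewrite wN Pw0 hom0.
Qed.

Lemma transport_stable j x v : 1 <= j%:R * e x -> transport j.+1 x v = transport j x v.
Proof.
move=> je; have t1 h : (j <= h)%N -> time h x = 1.
  move=> jh; rewrite /time; apply/min_idPr; apply: le_trans je _.
  by rewrite ler_pM2r// ler_nat.
have e1 : time j.+1 x = time j x by rewrite !t1.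
change (complement_proj x (time j.+1 x) (transport j x v) = transport j x v).
by rewrite e1; apply: complement_proj_id; exact: transport_P.
Qed.

Definition step_count x := (Num.truncn (e x)^-1).+1.

Lemma step_countP x : 1 < (step_count x)%:R * e x.
Proof. by rewrite -ltr_pdivrMr// div1r; exact: truncnS_gt. Qed.

Lemma transport_ge j x v : 1 <= j%:R * e x -> transport j x v = transport (step_count x) x v.
Proof.
have stab a b : 1 <= a%:R * e x -> transport (b + a)%N x v = transport a x v.
  move=> ha; elim: b => // b <-; rewrite addSn transport_stable//.
  by apply: le_trans ha _; rewrite ler_pM2r// ler_nat leq_addl.
move=> hj; rewrite -(stab j (step_count x))// addnC stab//.
exact: ltW (step_countP x).
Qed.

Lemma transport_hcont j : @hcont R X X id setT V V (transport j).
Proof.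
have Qc h : @hcont R X X id setT V V (fun x => complement_proj x (time h x)).
  apply: hcont_sub; first exact: hcont_id.
  have tc (x : X) : setT x -> cwa setT (fun y => (y, time h y)) x.
    move=> _; apply: cwa_pair; first exact: cwa_id.
    by apply: cwa_continuous; exact: time_continuous.
  have tI (x : X) : setT x -> (setT `*` I) (x, time h x) by move=> _; split=> //; exact: time_I.
  apply: (@hcont_comp R X _ id setT idc V E V (fun x => P x (time h x))
    (fun x => N x (time h x))).
    exact: (@hcont_pull _ _ _ _ fst (setT `*` I) (fun x : X => (x, time h x))
      setT V E (fun z => P z.1 z.2) tc tI Pc).
  exact: (@hcont_pull _ _ _ _ fst (setT `*` I) (fun x : X => (x, time h x))
    setT E V (fun z => N z.1 z.2) tc tI Nc).
elim: j => [|j IH]; first exact: (Qc 0%N).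
exact: (@hcont_comp R X _ id setT idc V V V (transport j)
  (fun x => complement_proj x (time j.+1 x)) IH (Qc j.+1)).
Qed.

Lemma transport_limit_hcont :
  @hcont R X X id setT V V (fun x => transport (step_count x) x).
Proof.
move=> x _ n m c d cx dx; pose j := step_count x.
(* The strict inequality at [x] persists nearby, so the fixed number [j] of steps suffices on a
   neighbourhood although [step_count] may jump. *)
have near_j : \forall y \near x, 1 < j%:R * e y.
  have fc : {for x, continuous (fun y : X => j%:R * e y : R^o)}.
    by apply: cvgM; [exact: cvg_cst | exact: ec].
  exact: (cvgr_gt _ fc _ (step_countP x)).
apply: (@cwa_near_eq _ _ _ (fun y => hmx c d (transport j y))) => //.
  suff : \forall y \near x, setT y -> hmx c d (transport j y)
      = hmx c d (transport (step_count y) y) by [].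
  apply: filterS near_j => y jy _; congr hmx; apply: hom_ext => v.
  by apply: transport_ge; exact: ltW.
exact: transport_hcont.
Qed.

Lemma transport_Theta j x : Theta_rel (transport j x) (transport j (tau x)).
Proof.
have tT h : time h (tau x) = time h x by rewrite /time eT.
elim: j => [|j IH] u; rewrite /transport -/transport tT.
  by apply: complement_proj_Theta; exact: time_I.
rewrite /= -/(transport j x u) IH; apply: complement_proj_Theta; exact: time_I.
Qed.

End Steps.
End Transport.

Lemma injective_real_iso (R : realType) (X : involutiveSpace) (E F : realBundle R X) k
    (f : forall x : X, hom (fibre E x) (fibre F x)) :
  has_rank E k -> has_rank F k -> @hcont R X X id setT E F f ->
  (forall x, injective (f x)) -> (forall x, Theta_rel (f x) (f (tau x))) ->
  real_iso E F.
Proof.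
move=> Ek Fk fc fi fT.
have finv (x : X) : exists g : hom (fibre F x) (fibre E x), cancel (f x) g /\ cancel g (f x).
  have [n [c cx]] := chart_exists E x; have [m [d dx]] := chart_exists F x.
  have nk := has_rank_chart Ek cx; have mk := has_rank_chart Fk dx.
  subst n m; have /(chart_rank_iso (f x) cx dx) := fi x.
  rewrite row_free_unit => fu.
  pose g := mxhom d c x (invmx (hmx c d (f x))).
  have e1 : hom_comp g (f x) = hom_id _.
    apply: (hmx_eq cx cx); rewrite (hmx_comp _ _ _ _ dx) mxhomK// hmx_id//.
    exact: mulmxV.
  have e2 : hom_comp (f x) g = hom_id _.
    apply: (hmx_eq dx dx); rewrite (hmx_comp _ _ _ _ cx) mxhomK// hmx_id//.
    exact: mulVmx.
  exists g; split=> u.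
    exact: (congr1 (fun h : hom _ _ => h u) e1).
  exact: (congr1 (fun h : hom _ _ => h u) e2).
pose g (x : X) := projT1 (cid (finv x)).
have gK (x : X) : cancel (f x) (g x) /\ cancel (g x) (f x) := projT2 (cid (finv x)).
have gc : @hcont R X X id setT F E g.
  by apply: (@hcont_inv _ _ _ id setT _ E F f g _ fc) => // z _; exact: cwa_id.
exists (fun x => hom_to_linear (f x)), (fun x => g x); split=> //.
- by move/hcont_cont: fc.
- by move/hcont_cont: gc.
Qed.

(** * Trivial summands and cancellation *)

Section Bundles.
Variables (R : realType) (X : involutiveSpace) (CW : Z2CW R X) (d1 d0 k : nat).
Hypotheses (free_dim : forall n, free_cell CW n -> (n <= d1)%N)
  (fixed_dim : forall n, fixed_cell CW n -> (n <= d0)%N).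

Lemma fcont_slice (E F : realBundle R X) (T : set R) (t : R)
    (f : forall x : X, R -> hom (fibre E x) (fibre F x)) :
  T t -> fcont (Z := X * R)%type fst snd (setT `*` T) f ->
  @hcont R X X id setT E F (fun x => f x t).
Proof.
move=> Tt fc; apply: (@hcont_pull R X (X * R)%type X fst (setT `*` T)
  (fun x : X => (x, t)) setT E F (fun z => f z.1 z.2)) => //.
by move=> x _; apply: cwa_pair; [exact: cwa_id | exact: cwa_cst].
Qed.

Lemma trivial_summand (E : realBundle R X) : has_rank E k -> (k0 d1 d0 <= k)%N ->
  exists E0 : realBundle R X,
    real_iso E (dsum E0 (trivial_bundle R X (k - k0 d1 d0)%N)).
Proof.
move=> Ek kk; pose m := (k - k0 d1 d0)%N; pose L := trivial_bundle R X m.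
have Lm : has_rank L m by move=> x; exists idfun; exists idfun.
have T0T : set0 `<=` [set (0 : R)] by [].
have cT : compact [set (0 : R)] by exact: compact_set1.
have cov : covered ([set 0] : set R^o) 0 by exact: covered_point.
have dims (x : X) a b (c : chart L a) (d : chart E b) : chart_dom c x -> chart_dom d x ->
    (d1 + 0 + 2 * a < 2 * b.+1)%N /\ (d0 + 0 + a < b.+1)%N.
  move=> cx dx; rewrite (has_rank_chart Lm cx) (has_rank_chart Ek dx) /m.
  move: kk; rewrite /k0; lia.
pose z (x : X) (t : R) := hom_zero (fibre L x) (fibre E x).
have zc : fcont (Z := X * R)%type fst snd (setT `*` set0) z by move=> y [].
have [N [Nc Ni NT _]] := injective_family free_dim fixed_dim cT cov closed0 T0T dims zc
  (fun _ _ h => False_ind _ h) (fun _ _ h => False_ind _ h).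
have [p [pc pN pT]] := left_inverse_family free_dim fixed_dim cT Nc Ni NT.
have t0 : [set (0 : R)] 0 by [].
apply: (@retract_splits R X E L k m Ek Lm (fun x => N x 0) (fun x => p x 0)).
- exact: fcont_slice t0 Nc.
- exact: fcont_slice t0 pc.
- by move=> x; exact: pN.
- by move=> x; exact: NT.
- by move=> x; exact: pT.
Qed.

Section Cancellation.
Variables E1 E2 E3 : realBundle R X.
Hypotheses (E1k : has_rank E1 k) (E2k : has_rank E2 k) (kk : (k1 d1 d0 <= k)%N).
Local Notation V := (dsum E2 E3).
Local Notation I := (`[0, 1]%classic : set R).
Variable Phi : forall x : X, hom (fibre (dsum E1 E3) x) (fibre V x).
Hypotheses (Phic : @hcont R X X id setT (dsum E1 E3) V Phi)
  (Phii : forall x, injective (Phi x)) (PhiT : forall x, Theta_rel (Phi x) (Phi (tau x))).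

Let idc (z : X) : setT z -> cwa setT id z. Proof. by move=> _; exact: cwa_id. Qed.

Let end0 (x : X) := hom_comp (Phi x) (sum_inr E1 E3 x).
Let end1 (x : X) := sum_inr E2 E3 x.
(** Only the values at 0 and 1 matter; continuity is pasted from these two closed slices. *)
Let ends (x : X) (t : R) := if t == 0 then end0 x else end1 x.

Let ends_hcont : fcont (Z := X * R)%type fst snd (setT `*` ([set 0] `|` [set 1])) ends.
Proof.
have fstc (S : set (X * R)%type) z : S z -> cwa S fst z.
  by move=> _; apply: cwa_continuous; exact: cvg_fst.
have closed_at (t : R) : closed ([set: X] `*` [set t]).
  by apply: closed_prod; [exact: closedT | exact: closed_eq].
apply: (@fcont_sub R X E3 V (X * R)%type fst snd
  ([set: X] `*` [set (0 : R)] `|` [set: X] `*` [set (1 : R)])).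
  by move=> [x t] [_ /= [h|h]]; [left | right].
apply: fcont_union; try exact: closed_at.
  apply: (@fcont_eq R X E3 V _ fst fst snd _ (fun x _ => end0 x)) => //.
    by move=> [x t] [_ /= ->]; rewrite /ends eqxx.
  apply: (@hcont_pull R X X _ id setT fst _ E3 V end0 (fstc _)) => //.
  exact: (@hcont_comp R X _ id setT idc E3 _ V _ Phi (@hcont_inr R X E1 E3) Phic).
apply: (@fcont_eq R X E3 V _ fst fst snd _ (fun x _ => end1 x)) => //.
  by move=> [x t] [_ /= ->]; rewrite /ends oner_eq0.
apply: (@hcont_pull R X X _ id setT fst _ E3 V end1 (fstc _)) => //.
exact: hcont_inr.
Qed.

(** The map includes [E1] into [V] by [Phi], transports and projects to [E2]. It is injective
    because [Phi] keeps [E1] transverse to the image of [N 0], which is the kernel of the first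
    projection, and because the kernel of the last map is the image of [N 1], which meets the kernel
    of [P 1] in 0. Equality of ranks does the rest. *)
Lemma cancel_summand : real_iso E1 E2.
Proof.
have cT : compact I by exact: segment_compact.
have cT0 : closed ([set (0 : R)] `|` [set 1]) by apply: closedU; exact: closed_eq.
have I0 : I 0 by rewrite /= in_itv /= lexx ler01.
have I1 : I 1 by rewrite /= in_itv /= lexx ler01.
have T0T : [set (0 : R)] `|` [set 1] `<=` I by move=> t [->|->].
have dims (x : X) a b (c : chart E3 a) (d : chart V b) : chart_dom c x -> chart_dom d x ->
    (d1 + 1 + 2 * a < 2 * b.+1)%N /\ (d0 + 1 + a < b.+1)%N.
  move=> cx dx; have [n [e ex]] := chart_exists E2 x.
  rewrite (dsum_chart_dim ex cx dx) (has_rank_chart E2k ex).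
  move: kk; rewrite /k1; lia.
have ends_inj (x : X) t : ([set 0] `|` [set 1]) t -> injective (ends x t).
  move=> _ u v; rewrite /ends; case: eqP => _.
    by move=> /Phii [].
  by move=> [].
have ends_Theta (x : X) t : ([set 0] `|` [set 1]) t -> Theta_rel (ends x t) (ends (tau x) t).
  move=> _ u; have inrT (E F : realBundle R X) (w : fibre F x) :
      sum_inr E F (tau x) (Theta w) = Theta (sum_inr E F x w).
    by congr (_, _); rewrite -[LHS](subrr (Theta 0)) -ThetaB subrr.
  rewrite /ends; case: eqP => _; last exact: inrT.
  by apply: etrans _ (PhiT _); congr (Phi _ _); exact: inrT.
have [N [Nc Ni NT NE]] := injective_family free_dim fixed_dim cT (covered_interval R)
  cT0 T0T dims ends_hcont ends_inj ends_Theta.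
have [P [Pc PN PT]] := left_inverse_family free_dim fixed_dim cT Nc Ni NT.
have cells : exists M : nat, forall n, (M <= n)%N ->
    sheet (free_cell CW n) (fixed_cell CW n) -> False.
  by exists (maxn d1 d0).+1 => n; exact: no_large_cells.
have [e [ec e0 eT eP]] := small_steps Nc Pc PN NT PT cells.
pose B (x : X) := transport N P e (step_count e x) x.
have Bc : @hcont R X X id setT V V B by exact: transport_limit_hcont.
have N0 (x : X) : N x 0 = end0 x by rewrite NE /ends ?eqxx//; left.
have N1 (x : X) : N x 1 = end1 x by rewrite NE /ends ?oner_eq0//; right.
have time1 (x : X) : time e (step_count e x) x = 1.
  by apply/min_idPr; exact: ltW (step_countP e0 x).
apply: (@injective_real_iso R X E1 E2 k (fun x => hom_comp (sum_fst E2 E3 x)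
  (hom_comp (B x) (hom_comp (Phi x) (sum_inl E1 E3 x))))) => //.
- apply: (@hcont_comp R X _ id setT idc E1 V E2 _ (sum_fst E2 E3)); last exact: hcont_fst.
  apply: (@hcont_comp R X _ id setT idc E1 V V _ B) => //.
  exact: (@hcont_comp R X _ id setT idc E1 _ V _ Phi (@hcont_inl R X E1 E3) Phic).
- move=> x; apply: hom_inj => u fu.
  set v := Phi x (sum_inl E1 E3 x u).
  have Bv1 : (B x v).1 = 0 by exact: fu.
  have PB : P x 1 (B x v) = 0 by rewrite -(time1 x); exact: (transport_P PN e0).
  have Bv : B x v = end1 x (B x v).2 by move: Bv1; case: (B x v) => a b /= ->.
  have Bv0 : B x v = 0.
    have w0 : (B x v).2 = 0 by rewrite -(PN x 1 I1 (B x v).2) N1 -Bv PB.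
    by rewrite Bv w0 hom0.
  have := transport_eq0 PN e0 eP Bv0; rewrite /time mul0r min_l ?ler01// => Qv.
  have vN : v = N x 0 (P x 0 v) by apply/eqP; rewrite -subr_eq0; apply/eqP.
  have : sum_inl E1 E3 x u = sum_inr E1 E3 x (P x 0 v).
    by apply: (@Phii x); rewrite -/v {1}vN N0.
  by case.
- move=> x u; have inlT : sum_inl E1 E3 (tau x) (Theta u) = Theta (sum_inl E1 E3 x u).
    by congr (_, _); rewrite -[LHS](subrr (Theta 0)) -ThetaB subrr.
  have BT (w : fibre V x) : B (tau x) (Theta w) = Theta (B x w).
    rewrite /B (_ : step_count e (tau x) = step_count e x); last by rewrite /step_count eT.
    exact: (transport_Theta NT PT e0 eT).
  change ((B (tau x) (Phi (tau x) (sum_inl E1 E3 (tau x) (Theta u)))).1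
    = Theta (B x (Phi x (sum_inl E1 E3 x u))).1).
  by rewrite inlT PhiT BT.
Qed.

End Cancellation.

End Bundles.

Theorem theorem1p1 (R : realType) (d1 d0 k : nat)
    (X : involutiveSpace) (CW : Z2CW R X)
    (free_dim : forall n, free_cell CW n -> (n <= d1)%N)
    (fixed_dim : forall n, fixed_cell CW n -> (n <= d0)%N) :
  (forall E : realBundle R X, has_rank E k -> (k0 d1 d0 <= k)%N ->
     exists E0 : realBundle R X,
       real_iso E (dsum E0 (trivial_bundle R X (k - k0 d1 d0)%N))) /\
  (forall E1 E2 : realBundle R X,
     has_rank E1 k -> has_rank E2 k -> (k1 d1 d0 <= k)%N ->
     (exists E3 : realBundle R X, real_iso (dsum E1 E3) (dsum E2 E3)) ->
     real_iso E1 E2).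
Proof.
split=> [E Ek kk|E1 E2 E1k E2k kk [E3 [f [g [fgK fc _ fT]]]]].
  exact: (trivial_summand free_dim fixed_dim Ek kk).
apply: (@cancel_summand R X CW d1 d0 k free_dim fixed_dim E1 E2 E3 E1k E2k kk
  (fun x => hom_of_linear (f x))).
- by apply/hcont_cont.
- by move=> x; exact: can_inj (proj1 (fgK x)).
- by move=> x u; exact: fT.
Qed.
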